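(* Let $\beta=(\beta_n)_{n\ge0}$ be an essentially decreasing sequence of positive numbers satisfying $\liminf_{n\to\infty}\beta_n^{1/n}\ge 1$. The following assertions are equivalent: 1) for every symbol $\phi$, the composition operator $C_\phi$ is bounded on $H^2(\beta)$; 2) for every $a\in(0,1)$, $C_{T_a}$ is bounded on $H^2(\beta)$; 3) for some $a\in(0,1)$, $C_{T_a}$ is bounded on $H^2(\beta)$; 4) $\beta$ satisfies the $\Delta_2$-condition.
   Context: $\mathbb D$ is the open unit disk. For a sequence $\beta=(\beta_n)_{n\ge0}$ of positive numbers with $\liminf_n \beta_n^{1/n}\ge1$, $H^2(\beta)$ is the Hilbert space of analytic functions $f(z)=\sum_{n\ge0}a_nz^n$ on $\mathbb D$ with $\|f\|^2=\sum_{n\ge0}|a_n|^2\beta_n<\infty$. A symbol is a non-constant analytic map $\phi:\mathbb D\to\mathbb D$, and $C_\phi f=f\circ\phi$; ''$C_\phi$ is bounded on $H^2(\beta)$'' means $C_\phi$ maps $H^2(\beta)$ into itself (hence boundedly). For $a\in\mathbb D$, $T_a(z)=\frac{a+z}{1+\bar a z}$. $\beta$ is essentially decreasing if there is $C\ge1$ with $\beta_m\le C\beta_n$ for all $m\ge n\ge0$. $\beta$ satisfies the $\Delta_2$-condition if there is $\delta\in(0,1)$ with $\beta_{2n}\ge\delta\beta_n$ for all $n\ge0$. *)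

(* Defs.v *)
From Stdlib Require Import Reals.
From Coquelicot Require Import Coquelicot.
Open Scope R_scope.

Definition inD (z : C) : Prop := Cmod z < 1.

Definition holo_on_D (f : C -> C) : Prop :=
  forall z : C, inD z -> @ex_derive C_AbsRing C_NormedModule f z.

Definition weight_ok (beta : nat -> R) : Prop :=
  (forall n, 0 < beta n) /\
  Rbar_le (Finite 1) (LimInf_seq (fun n => Rpower (beta n) (/ INR n))).

Definition inH2 (beta : nat -> R) (f : C -> C) : Prop :=
  exists a : nat -> C,
    (forall z : C, inD z ->
       @is_series C_AbsRing C_NormedModule (fun n => Cmult (a n) (Cpow z n)) (f z)) /\
    ex_series (fun n => (Cmod (a n))^2 * beta n).

Definition symbol (phi : C -> C) : Prop :=
  holo_on_D phi /\ (forall z, inD z -> inD (phi z)) /\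
  (exists z w, inD z /\ inD w /\ phi z <> phi w).

Definition Cphi_bounded (beta : nat -> R) (phi : C -> C) : Prop :=
  forall f : C -> C, inH2 beta f -> inH2 beta (fun z => f (phi z)).

Definition T (a : C) (z : C) : C :=
  Cdiv (Cplus a z) (Cplus (RtoC 1) (Cmult (Cconj a) z)).

Definition ess_decreasing (beta : nat -> R) : Prop :=
  exists K : R, 1 <= K /\ forall m n : nat, (n <= m)%nat -> beta m <= K * beta n.

Definition Delta2 (beta : nat -> R) : Prop :=
  exists delta : R, 0 < delta < 1 /\ forall n : nat, beta (2 * n)%nat >= delta * beta n.

(* Main.v *)
(** The hard directions are (4) => (1) and (3) => (4).

    (4) => (1).  Let [phi] be a self-map of the disk.  A Harnack-type bound gives
    [|phi z| <= rho(r) := 1 - kappa (1 - r)] on [|z| = r], and [|phi 0| / rho(r)] stays away from 1,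
    so Littlewood subordination for [phi / rho] yields, uniformly in [r],
    [sum |b_m|^2 r^(2m) <= K sum |a_n|^2 rho(r)^(2n)] for [f = sum a_n z^n] and
    [f o phi = sum b_m z^m].  For a decreasing weight with the doubling property there are
    positive combinations of the radii [r_j = 1 - 2^-(j+1)] under which the [r_j^(2m)] dominate a
    multiple of [beta_m] while the [rho(r_j)^(2n)] are dominated by a multiple of [beta_n];
    combining the inequalities for the radii [r_j] accordingly gives the claim.

    (3) => (4).  Let [k(r) = sum r^(2n) / beta_n] be the squared norm of evaluation at [r].
    Boundedness of [C_{T_a}] gives [k(T_a r) <= K k(r)], and [1 - T_a r] is smaller than [1 - r]
    by a definite factor.  Since [1 / beta] is essentially increasing, an elementary
    Karamata argument turns this doubling of [k] into doubling of [beta].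

    Symbols are only assumed complex differentiable, so their power series rest on Goursat's
    theorem; it is applied in logarithmic coordinates, where an annulus becomes a rectangle. *)
Require Import Defs.
From Stdlib Require Import Reals ZArith Lra Lia Psatz Classical ClassicalEpsilon.
From Coquelicot Require Import Coquelicot.
Open Scope R_scope.

(** * Complex differentiability *)

(** Boundedness only says that [C_phi] maps the space into itself, so (3) => (4) must extract a
    uniform constant without a norm inequality. Failure of comparability along a sequence of radii
    is packed into one function with nonnegative coefficients, whose values at real points are
    bounded below term by term. In (4) => (1) the quotient [phi / rho] is known to be at most 1 only
    on the circle of radius [r], and [rho] varies with [r]. Littlewood's inequality is therefore
    proved for polynomials from an explicit Poisson majorant: it uses the bound on that circle
    alone, and its constant depends only on a bound for [|phi 0| / rho]. Passing from [r] to [rho]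
    shrinks [1 - r] by the factor [kappa]; doubling absorbs this loss, because powers of [rho] decay
    faster than any power law in [n (1 - rho)], whereas a doubling weight decays at most like a
    power. The coefficients of the combination of radii are differences of weights at consecutive
    powers of two and must be nonnegative, which forces the passage from an essentially decreasing
    weight to a truly decreasing one. *)

Definition Cder (f : C -> C) (z l : C) : Prop :=
  forall eps : R, 0 < eps -> exists delta : R, 0 < delta /\
    forall w : C, Cmod (w - z)%C < delta ->
      Cmod (f w - f z - l * (w - z))%C <= eps * Cmod (w - z)%C.

Definition Cdiff (f : C -> C) (z : C) : Prop := exists l : C, Cder f z l.

Lemma Cmod_minus_sym (x y : C) : Cmod (x - y)%C = Cmod (y - x)%C.
Proof. rewrite <- Cmod_opp. f_equal. ring. Qed.

Lemma Cmod_minus_triangle (x y : C) : Cmod (x - y)%C <= Cmod x + Cmod y.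
Proof. unfold Cminus. rewrite <- (Cmod_opp y). apply Cmod_triangle. Qed.

Lemma Cmod_triangle_minus (x y : C) : Cmod x - Cmod y <= Cmod (x - y)%C.
Proof.
  assert (H := Cmod_triangle (x - y)%C y).
  replace (x - y + y)%C with x in H by ring. lra.
Qed.

Lemma ex_derive_Cdiff (f : C -> C) (z : C) :
  @ex_derive C_AbsRing C_NormedModule f z <-> Cdiff f z.
Proof.
  split.
  - intros [l [_ H]]. exists l. intros eps Heps.
    destruct (H z (fun P HP => HP) (mkposreal eps Heps)) as [d Hd].
    exists d. split; [apply cond_pos|]. intros w Hw.
    specialize (Hd w Hw).
    change (Cmod (f w - f z - (w - z) * l)%C <= eps * Cmod (w - z)%C) in Hd.
    now rewrite (Cmult_comm l).
  - intros [l H]. exists l. split.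
    + apply (@is_linear_scal_l C_AbsRing C_NormedModule).
    + intros x Hx.
      assert (z = x) as <-.
      { apply (@is_filter_lim_locally_unique C_AbsRing (AbsRing_NormedModule C_AbsRing) z x Hx). }
      intros [eps Heps]. destruct (H eps Heps) as [d [Hd Hw]].
      exists (mkposreal d Hd). intros w Hb.
      specialize (Hw w Hb).
      change (Cmod (f w - f z - (w - z) * l)%C <= eps * Cmod (w - z)%C).
      now rewrite (Cmult_comm _ l).
Qed.

Lemma Cder_continuous (f : C -> C) (z : C) : Cdiff f z ->
  forall eps, 0 < eps -> exists delta, 0 < delta /\
    forall w, Cmod (w - z)%C < delta -> Cmod (f w - f z)%C < eps.
Proof.
  intros [l H] eps Heps. destruct (H 1 Rlt_0_1) as [d [Hd Hw]].
  assert (Hl := Cmod_ge_0 l).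
  assert (0 < eps / (2 + Cmod l)) by (apply Rdiv_lt_0_compat; lra).
  exists (Rmin d (eps / (2 + Cmod l))). split; [now apply Rmin_pos|].
  intros w Hwd.
  assert (H1 := Rlt_le_trans _ _ _ Hwd (Rmin_l _ _)).
  assert (H2 := Rlt_le_trans _ _ _ Hwd (Rmin_r _ _)).
  specialize (Hw w H1).
  assert (H3 : Cmod (w - z)%C * (2 + Cmod l) < eps).
  { apply Rmult_lt_reg_r with (/ (2 + Cmod l)). apply Rinv_0_lt_compat; lra.
    rewrite Rmult_assoc, Rinv_r by lra. rewrite Rmult_1_r. exact H2. }
  replace (f w - f z)%C with ((f w - f z - l * (w - z)) + l * (w - z))%C by ring.
  eapply Rle_lt_trans; [apply Cmod_triangle|]. rewrite Cmod_mult.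
  assert (H4 := Cmod_ge_0 (w - z)%C). nra.
Qed.

Lemma Cder_const (c z : C) : Cder (fun _ => c) z 0.
Proof.
  intros eps He. exists 1. split; [lra|]. intros w _.
  replace (c - c - 0 * (w - z))%C with (RtoC 0) by ring. rewrite Cmod_0.
  assert (H := Cmod_ge_0 (w - z)%C). nra.
Qed.

Lemma Cder_id (z : C) : Cder (fun w => w) z 1.
Proof.
  intros eps He. exists 1. split; [lra|]. intros w _.
  replace (w - z - 1 * (w - z))%C with (RtoC 0) by ring. rewrite Cmod_0.
  assert (H := Cmod_ge_0 (w - z)%C). nra.
Qed.

Lemma Cder_plus (f g : C -> C) (z l m : C) :
  Cder f z l -> Cder g z m -> Cder (fun w => f w + g w)%C z (l + m)%C.
Proof.
  intros Hf Hg eps He.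
  destruct (Hf (eps/2)) as [d1 [Hd1 H1]]; [lra|].
  destruct (Hg (eps/2)) as [d2 [Hd2 H2]]; [lra|].
  exists (Rmin d1 d2). split; [now apply Rmin_pos|]. intros w Hw.
  specialize (H1 w (Rlt_le_trans _ _ _ Hw (Rmin_l _ _))).
  specialize (H2 w (Rlt_le_trans _ _ _ Hw (Rmin_r _ _))).
  replace (f w + g w - (f z + g z) - (l + m) * (w - z))%C
    with ((f w - f z - l * (w - z)) + (g w - g z - m * (w - z)))%C by ring.
  eapply Rle_trans; [apply Cmod_triangle|]. lra.
Qed.

Lemma Cder_comp (f g : C -> C) (z l m : C) :
  Cder f (g z) l -> Cder g z m -> Cder (fun w => f (g w)) z (l * m)%C.
Proof.
  intros Hf Hg eps He.
  assert (Hl := Cmod_ge_0 l). assert (Hm := Cmod_ge_0 m).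
  (* Each error gets half of [eps]: [e1] pays for [f] on an increment of size at most
     [(|m| + 1) |w - z|], and [e2] pays for [g] amplified by [|l|]. The cap [e2 <= 1] gives that
     Lipschitz bound. *)
  set (e1 := eps / (2 * (Cmod m + 1))).
  set (e2 := Rmin 1 (eps / (2 * (Cmod l + 1)))).
  assert (Pe1 : 0 < e1) by (apply Rdiv_lt_0_compat; lra).
  assert (Pe2 : 0 < e2) by (apply Rmin_pos; [lra|]; apply Rdiv_lt_0_compat; lra).
  assert (E1 : e1 * (Cmod m + 1) = eps / 2) by (unfold e1; field; lra).
  assert (E2 : e2 * (Cmod l + 1) <= eps / 2).
  { replace (eps / 2) with (eps / (2 * (Cmod l + 1)) * (Cmod l + 1)) by (field; lra).
    apply Rmult_le_compat_r; [lra|]. apply Rmin_r. }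
  assert (E3 : e2 <= 1) by apply Rmin_l.
  destruct (Hf e1) as [d1 [Hd1 H1]]; [assumption|].
  destruct (Hg e2) as [d2 [Hd2 H2]]; [assumption|].
  assert (Pd : 0 < d1 / (Cmod m + 2)) by (apply Rdiv_lt_0_compat; lra).
  exists (Rmin d2 (d1 / (Cmod m + 2))). split; [now apply Rmin_pos|]. intros w Hw.
  specialize (H2 w (Rlt_le_trans _ _ _ Hw (Rmin_l _ _))).
  assert (H3 := Rlt_le_trans _ _ _ Hw (Rmin_r _ _)).
  assert (H4 : Cmod (w - z)%C * (Cmod m + 2) < d1).
  { apply Rmult_lt_reg_r with (/ (Cmod m + 2)). apply Rinv_0_lt_compat; lra.
    rewrite Rmult_assoc, Rinv_r by lra. rewrite Rmult_1_r. exact H3. }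
  assert (Hw0 := Cmod_ge_0 (w - z)%C).
  assert (H5 : Cmod (g w - g z)%C <= (Cmod m + 1) * Cmod (w - z)%C).
  { replace (g w - g z)%C with ((g w - g z - m * (w - z)) + m * (w - z))%C by ring.
    eapply Rle_trans; [apply Cmod_triangle|]. rewrite Cmod_mult. nra. }
  specialize (H1 (g w)).
  assert (H6 : Cmod (f (g w) - f (g z) - l * (g w - g z))%C <= e1 * Cmod (g w - g z)%C)
    by (apply H1; nra).
  replace (f (g w) - f (g z) - l * m * (w - z))%C with
    ((f (g w) - f (g z) - l * (g w - g z)) + l * (g w - g z - m * (w - z)))%C by ring.
  eapply Rle_trans; [apply Cmod_triangle|]. rewrite Cmod_mult.
  assert (e1 * Cmod (g w - g z)%C <= eps / 2 * Cmod (w - z)%C).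
  { rewrite <- E1. rewrite Rmult_assoc. apply Rmult_le_compat_l; lra. }
  assert (Cmod l * Cmod (g w - g z - m * (w - z))%C <= eps / 2 * Cmod (w - z)%C).
  { apply Rle_trans with (Cmod l * (e2 * Cmod (w - z)%C)); nra. }
  lra.
Qed.

Lemma Cder_sqr (z : C) : Cder (fun w => w * w)%C z (z + z)%C.
Proof.
  intros eps He. exists eps. split; [lra|]. intros w Hw.
  replace (w * w - z * z - (z + z) * (w - z))%C with ((w - z) * (w - z))%C by ring.
  rewrite Cmod_mult. assert (H := Cmod_ge_0 (w - z)%C). nra.
Qed.

Lemma Cder_scal (f : C -> C) (c z l : C) :
  Cder f z l -> Cder (fun w => c * f w)%C z (c * l)%C.
Proof.
  intros Hf eps He. assert (Hc := Cmod_ge_0 c).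
  destruct (Hf (eps / (Cmod c + 1))) as [d [Hd H]]; [apply Rdiv_lt_0_compat; lra|].
  exists d. split; [easy|]. intros w Hw. specialize (H w Hw).
  replace (c * f w - c * f z - c * l * (w - z))%C with (c * (f w - f z - l * (w - z)))%C by ring.
  rewrite Cmod_mult.
  assert (Hw0 := Cmod_ge_0 (w - z)%C).
  apply Rle_trans with ((Cmod c + 1) * (eps / (Cmod c + 1) * Cmod (w - z)%C)).
  - apply Rmult_le_compat; try lra. apply Cmod_ge_0.
  - right. field. lra.
Qed.

(* By polarization, from the derivative of the square. *)
Lemma Cder_mult (f g : C -> C) (z l m : C) :
  Cder f z l -> Cder g z m -> Cder (fun w => f w * g w)%C z (l * g z + f z * m)%C.
Proof.
  intros Hf Hg.
  assert (Hm := Cder_plus _ _ _ _ _ Hf (Cder_scal _ (-1)%C _ _ Hg)).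
  assert (H1 := Cder_comp _ _ _ _ _ (Cder_sqr _) (Cder_plus _ _ _ _ _ Hf Hg)).
  assert (H2 := Cder_comp _ _ _ _ _ (Cder_sqr _) Hm).
  assert (H := Cder_scal _ (/4)%C _ _ (Cder_plus _ _ _ _ _ H1 (Cder_scal _ (-1)%C _ _ H2))).
  intros eps He. destruct (H eps He) as [d [Hd Hw]]. exists d. split; [easy|].
  intros w Hdw. eapply Rle_trans; [right|apply (Hw w Hdw)]. f_equal.
  simpl. field.
Qed.

Lemma Cder_inv (z : C) : z <> 0%C -> Cder Cinv z (- / (z * z))%C.
Proof.
  intros Hz eps He. assert (Hm : 0 < Cmod z) by now apply Cmod_gt_0.
  set (k := Cmod z) in *.
  assert (0 < eps * (k * k * k) / 2).
  { apply Rdiv_lt_0_compat; [|lra]. repeat apply Rmult_lt_0_compat; lra. }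
  (* The remainder is [(w - z)^2 / (w z^2)]. The first radius keeps [|w| > k / 2]; the second makes
     one factor [|w - z|] at most [eps |w| k^2]. *)
  exists (Rmin (k / 2) (eps * (k * k * k) / 2)). split; [apply Rmin_pos; lra|].
  intros w Hw.
  assert (H1 := Rlt_le_trans _ _ _ Hw (Rmin_l _ _)).
  assert (H2 := Rlt_le_trans _ _ _ Hw (Rmin_r _ _)).
  assert (Hwk : k / 2 < Cmod w).
  { assert (H3 := Cmod_triangle_minus z w). rewrite Cmod_minus_sym in H3. fold k in H3. lra. }
  assert (w <> 0%C) by (apply Cmod_gt_0; lra).
  replace (/ w - / z - - / (z * z) * (w - z))%C with ((w - z) * (w - z) * / (w * (z * z)))%C
    by (field; auto).
  rewrite Cmod_mult, Cmod_inv, !Cmod_mult by (repeat apply Cmult_neq_0; auto).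
  fold k. set (x := Cmod (w - z)%C) in *. assert (Hx : 0 <= x) by apply Cmod_ge_0.
  assert (Hp : 0 < Cmod w * (k * k)) by (repeat apply Rmult_lt_0_compat; lra).
  apply Rmult_le_reg_r with (Cmod w * (k * k)); [easy|].
  rewrite Rmult_assoc, Rinv_l, Rmult_1_r by lra.
  assert (x <= eps * (Cmod w * (k * k))).
  { assert (k / 2 * (k * k) <= Cmod w * (k * k)) by (apply Rmult_le_compat_r; nra). nra. }
  nra.
Qed.

Lemma Cdiff_const (c z : C) : Cdiff (fun _ => c) z.
Proof. eexists. apply Cder_const. Qed.

Lemma Cdiff_id (z : C) : Cdiff (fun w => w) z.
Proof. eexists. apply Cder_id. Qed.

Lemma Cdiff_plus (f g : C -> C) (z : C) :
  Cdiff f z -> Cdiff g z -> Cdiff (fun w => f w + g w)%C z.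
Proof. intros [l Hl] [m Hm]. eexists. now apply Cder_plus; eauto. Qed.

Lemma Cdiff_mult (f g : C -> C) (z : C) :
  Cdiff f z -> Cdiff g z -> Cdiff (fun w => f w * g w)%C z.
Proof. intros [l Hl] [m Hm]. eexists. now apply Cder_mult; eauto. Qed.

Lemma Cdiff_minus (f g : C -> C) (z : C) :
  Cdiff f z -> Cdiff g z -> Cdiff (fun w => f w - g w)%C z.
Proof.
  intros Hf [m Hm]. unfold Cminus. apply Cdiff_plus; [easy|].
  exists (-1 * m)%C. assert (H := Cder_scal _ (-1)%C _ _ Hm).
  intros eps He. destruct (H eps He) as [d [Hd Hw]]. exists d. split; [easy|].
  intros w Hdw. eapply Rle_trans; [right|apply (Hw w Hdw)]. f_equal. simpl. ring.
Qed.

Lemma Cdiff_comp (f g : C -> C) (z : C) :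
  Cdiff f (g z) -> Cdiff g z -> Cdiff (fun w => f (g w)) z.
Proof. intros [l Hl] [m Hm]. eexists. now apply Cder_comp; eauto. Qed.

Lemma Cdiff_inv (f : C -> C) (z : C) :
  f z <> 0%C -> Cdiff f z -> Cdiff (fun w => / f w)%C z.
Proof.
  intros H0 Hf. apply (Cdiff_comp Cinv); [|easy]. eexists. now apply Cder_inv.
Qed.

(** * The complex exponential *)

Definition cexp (w : C) : C := (exp (Re w) * cos (Im w), exp (Re w) * sin (Im w)).

Lemma cexp_plus (z w : C) : cexp (z + w)%C = (cexp z * cexp w)%C.
Proof.
  unfold cexp. rewrite re_plus, im_plus, exp_plus, cos_plus, sin_plus.
  unfold Cmult; simpl. f_equal; ring.
Qed.

Lemma cexp_0 : cexp 0 = 1%C.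
Proof. unfold cexp. simpl. rewrite exp_0, cos_0, sin_0. unfold RtoC. f_equal; ring. Qed.

Lemma Cmod_cexp (w : C) : Cmod (cexp w) = exp (Re w).
Proof.
  unfold Cmod, cexp; simpl.
  replace (_ + _) with (exp (Re w) * exp (Re w)).
  - apply sqrt_square. left. apply exp_pos.
  - assert (H := sin2_cos2 (Im w)). unfold Rsqr in H.
    transitivity (exp (Re w) * exp (Re w) * (sin (Im w) * sin (Im w) + cos (Im w) * cos (Im w))).
    rewrite H. ring. ring.
Qed.

Lemma cexp_neq_0 (w : C) : cexp w <> 0%C.
Proof. apply Cmod_gt_0. rewrite Cmod_cexp. apply exp_pos. Qed.

Lemma cexp_opp (w : C) : cexp (- w)%C = (/ cexp w)%C.
Proof.
  assert (H := cexp_neq_0 w).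
  transitivity (cexp (- w) * (cexp w * / cexp w))%C.
  - rewrite Cinv_r by easy. ring.
  - rewrite Cmult_assoc, <- cexp_plus. replace (- w + w)%C with (RtoC 0) by ring.
    rewrite cexp_0. ring.
Qed.

Lemma im_le_Cmod (c : C) : Rabs (Im c) <= Cmod c.
Proof. eapply Rle_trans; [apply Rmax_r|]. apply Rmax_Cmod. Qed.

Lemma Cmod_le_Re_Im (c : C) : Cmod c <= Rabs (Re c) + Rabs (Im c).
Proof.
  replace c with (RtoC (Re c) + Ci * RtoC (Im c))%C at 1.
  - eapply Rle_trans; [apply Cmod_triangle|]. rewrite Cmod_mult, Cmod_Ci, !Cmod_R. lra.
  - destruct c as [x y]; unfold Ci, RtoC, Cmult, Cplus; simpl. f_equal; ring.
Qed.

Lemma exp_at_0 (eps : R) : 0 < eps -> exists d, 0 < d /\ forall h, Rabs h < d ->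
  Rabs (exp h - 1 - h) <= eps * Rabs h.
Proof.
  intro He. destruct (derivable_pt_lim_exp 0 eps He) as [d Hd].
  exists d. split; [apply cond_pos|]. intros h Hh.
  destruct (Req_dec h 0) as [->|Hn].
  - rewrite exp_0, Rminus_diag, Rminus_0_r, Rabs_R0; lra.
  - specialize (Hd h Hn Hh). rewrite exp_0, Rplus_0_l in Hd.
    replace (exp h - 1 - h) with (((exp h - 1) / h - 1) * h) by (field; easy).
    rewrite Rabs_mult. apply Rmult_le_compat_r; [apply Rabs_pos|]. lra.
Qed.

Lemma cos_at_0 (eps : R) : 0 < eps -> exists d, 0 < d /\ forall h, Rabs h < d ->
  Rabs (cos h - 1) <= eps * Rabs h.
Proof.
  intro He. destruct (derivable_pt_lim_cos 0 eps He) as [d Hd].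
  exists d. split; [apply cond_pos|]. intros h Hh.
  destruct (Req_dec h 0) as [->|Hn].
  - rewrite cos_0, Rminus_diag, Rabs_R0; lra.
  - specialize (Hd h Hn Hh). rewrite cos_0, sin_0, Rplus_0_l in Hd.
    replace (cos h - 1) with (((cos h - 1) / h - - 0) * h) by (field; easy).
    rewrite Rabs_mult. apply Rmult_le_compat_r; [apply Rabs_pos|]. lra.
Qed.

Lemma sin_at_0 (eps : R) : 0 < eps -> exists d, 0 < d /\ forall h, Rabs h < d ->
  Rabs (sin h - h) <= eps * Rabs h.
Proof.
  intro He. destruct (derivable_pt_lim_sin 0 eps He) as [d Hd].
  exists d. split; [apply cond_pos|]. intros h Hh.
  destruct (Req_dec h 0) as [->|Hn].
  - rewrite sin_0, Rminus_diag, Rabs_R0; lra.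
  - specialize (Hd h Hn Hh). rewrite sin_0, cos_0, Rplus_0_l in Hd.
    replace (sin h - h) with (((sin h - 0) / h - 1) * h) by (field; easy).
    rewrite Rabs_mult. apply Rmult_le_compat_r; [apply Rabs_pos|]. lra.
Qed.

Lemma Cder_cexp_0 : Cder cexp 0 1.
Proof.
  intros eps He.
  (* The real and imaginary parts of the remainder are at most [4 e k] and [5 e k] with [k = |w|],
     so 16 leaves room. The radius is also at most [e], which makes the product term [2 |x| |y|]
     small relative to [k]. *)
  set (e := Rmin 1 (eps / 16)).
  assert (He0 : 0 < e) by (apply Rmin_pos; lra).
  assert (He1 : e <= 1) by apply Rmin_l. assert (He2 : e <= eps / 16) by apply Rmin_r.
  destruct (exp_at_0 e) as [d1 [Hd1 H1]]; [lra|].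
  destruct (cos_at_0 e) as [d2 [Hd2 H2]]; [lra|].
  destruct (sin_at_0 e) as [d3 [Hd3 H3]]; [lra|].
  exists (Rmin e (Rmin d1 (Rmin d2 d3))). split; [repeat apply Rmin_pos; lra|].
  intros w. rewrite cexp_0. replace (w - 0)%C with w by ring. intro Hw.
  assert (W1 := Rlt_le_trans _ _ _ Hw (Rmin_l _ _)).
  assert (W := Rlt_le_trans _ _ _ Hw (Rmin_r _ _)).
  assert (W2 := Rlt_le_trans _ _ _ W (Rmin_l _ _)).
  assert (W' := Rlt_le_trans _ _ _ W (Rmin_r _ _)).
  assert (W3 := Rlt_le_trans _ _ _ W' (Rmin_l _ _)).
  assert (W4 := Rlt_le_trans _ _ _ W' (Rmin_r _ _)).
  assert (Hr := re_le_Cmod w). assert (Hi := im_le_Cmod w).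
  destruct w as [x y]. simpl in Hr, Hi.
  set (k := Cmod (x, y)) in *.
  specialize (H1 x (Rle_lt_trans _ _ _ Hr W2)).
  specialize (H2 y (Rle_lt_trans _ _ _ Hi W3)).
  specialize (H3 y (Rle_lt_trans _ _ _ Hi W4)).
  assert (Hy := Rabs_pos y). assert (Hx := Rabs_pos x).
  assert (B : Rabs (exp x - 1) <= 2 * Rabs x).
  { replace (exp x - 1) with ((exp x - 1 - x) + x) by ring.
    eapply Rle_trans; [apply Rabs_triang|]. nra. }
  assert (Bx : Rabs (exp x) <= 3).
  { replace (exp x) with ((exp x - 1) + 1) by ring.
    eapply Rle_trans; [apply Rabs_triang|]. rewrite Rabs_R1. lra. }
  eapply Rle_trans; [apply Cmod_le_Re_Im|]. simpl.
  replace (exp x * cos y + - (1) + - (1 * x - 0 * y))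
    with ((exp x - 1 - x) + exp x * (cos y - 1)) by ring.
  replace (exp x * sin y + - 0 + - (1 * y + 0 * x))
    with (exp x * (sin y - y) + (exp x - 1) * y) by ring.
  assert (A1 : Rabs (exp x - 1 - x + exp x * (cos y - 1)) <= e * k + 3 * (e * k)).
  { eapply Rle_trans; [apply Rabs_triang|]. rewrite Rabs_mult.
    apply Rplus_le_compat; [nra|]. apply Rmult_le_compat; try apply Rabs_pos; nra. }
  assert (A2 : Rabs (exp x * (sin y - y) + (exp x - 1) * y) <= 3 * (e * k) + 2 * (k * e)).
  { eapply Rle_trans; [apply Rabs_triang|]. rewrite !Rabs_mult.
    apply Rplus_le_compat. apply Rmult_le_compat; try apply Rabs_pos; nra.
    apply Rle_trans with (2 * Rabs x * Rabs y); [apply Rmult_le_compat_r; lra|]. nra. }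
  assert (Hk : 0 <= k) by (unfold k; apply Cmod_ge_0).
  assert (e * k <= eps / 16 * k) by nra. nra.
Qed.

Lemma Cdiff_cexp (z : C) : Cdiff cexp z.
Proof.
  assert (H : Cder (fun w => cexp z * cexp (w - z))%C z (cexp z * (1 * (1 + 0)))%C).
  { apply Cder_scal. apply (Cder_comp cexp).
    - replace (z - z)%C with (RtoC 0) by ring. apply Cder_cexp_0.
    - unfold Cminus. apply Cder_plus; [apply Cder_id|apply Cder_const]. }
  eexists. intros eps He. destruct (H eps He) as [d [Hd Hw]]. exists d. split; [easy|].
  intros w Hdw. specialize (Hw w Hdw). simpl in Hw. rewrite <- !cexp_plus in Hw.
  replace (z + (w - z))%C with w in Hw by ring. replace (z + (z - z))%C with z in Hw by ring.
  exact Hw.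
Qed.

(** * Complex integrals and Goursat's theorem *)

Definition is_CInt (f : R -> C) (a b : R) (l : C) : Prop :=
  @is_RInt C_R_NormedModule f a b l.

Definition CInt (f : R -> C) (a b : R) : C := @RInt C_R_CompleteNormedModule f a b.

Definition ccont (f : R -> C) (t : R) : Prop :=
  forall eps, 0 < eps -> exists delta, 0 < delta /\
    forall s, Rabs (s - t) < delta -> Cmod (f s - f t)%C < eps.

Lemma ccont_continuous (f : R -> C) (t : R) :
  ccont f t -> @continuous R_UniformSpace C_R_NormedModule f t.
Proof.
  intros H P [e HP]. destruct (H e (cond_pos e)) as [d [Hd Hs]].
  exists (mkposreal d Hd). intros s Hb. apply HP.
  apply (C_NormedModule_mixin_compat1 (f t) (f s)). apply Hs, Hb.
Qed.

Lemma CInt_unique (f : R -> C) (a b : R) (l : C) : is_CInt f a b l -> CInt f a b = l.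
Proof. apply (@is_RInt_unique C_R_CompleteNormedModule). Qed.

Lemma CInt_correct (f : R -> C) (a b : R) : a <= b ->
  (forall t, a <= t <= b -> ccont f t) -> is_CInt f a b (CInt f a b).
Proof.
  intros Hab H. apply (@RInt_correct C_R_CompleteNormedModule).
  apply (@ex_RInt_continuous C_R_CompleteNormedModule).
  intros z. rewrite Rmin_left, Rmax_right by easy. intro Hz.
  now apply ccont_continuous, H.
Qed.

Lemma is_CInt_ext (f g : R -> C) (a b : R) (l : C) :
  (forall t, f t = g t) -> is_CInt f a b l -> is_CInt g a b l.
Proof. intro H. apply (@is_RInt_ext C_R_NormedModule). intros; apply H. Qed.

Lemma is_CInt_plus (f g : R -> C) (a b : R) (l m : C) :
  is_CInt f a b l -> is_CInt g a b m -> is_CInt (fun t => f t + g t)%C a b (l + m)%C.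
Proof. exact (@is_RInt_plus C_R_NormedModule f g a b l m). Qed.

Lemma is_CInt_pair (f g : R -> R) (a b l m : R) :
  is_RInt f a b l -> is_RInt g a b m -> is_CInt (fun t => (f t, g t)) a b (l, m).
Proof.
  intros Hf Hg.
  apply (@is_RInt_fct_extend_pair R_NormedModule R_NormedModule); [exact Hf|exact Hg].
Qed.

Lemma is_CInt_Re (f : R -> C) (a b : R) (l : C) :
  is_CInt f a b l -> is_RInt (fun t => Re (f t)) a b (Re l).
Proof. exact (@is_RInt_fct_extend_fst R_NormedModule R_NormedModule f a b l). Qed.

Lemma is_CInt_Im (f : R -> C) (a b : R) (l : C) :
  is_CInt f a b l -> is_RInt (fun t => Im (f t)) a b (Im l).
Proof. exact (@is_RInt_fct_extend_snd R_NormedModule R_NormedModule f a b l). Qed.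

Lemma is_CInt_RtoC (f : R -> R) (a b l : R) :
  is_RInt f a b l -> is_CInt (fun t => RtoC (f t)) a b (RtoC l).
Proof.
  intro H. apply is_CInt_pair; [easy|].
  assert (E := @is_RInt_const R_NormedModule a b 0).
  assert (E0 : scal (b - a) (0 : R_NormedModule) = 0) by apply Rmult_0_r.
  rewrite E0 in E. exact E.
Qed.

(** Integrals live in [C] as a real normed module, where multiplication by a complex constant is not
    the scalar action; hence the detour through components. *)
Lemma is_CInt_scal (f : R -> C) (c : C) (a b : R) (l : C) :
  is_CInt f a b l -> is_CInt (fun t => c * f t)%C a b (c * l)%C.
Proof.
  intro H. assert (Hr := is_CInt_Re _ _ _ _ H). assert (Hi := is_CInt_Im _ _ _ _ H).
  apply is_CInt_pair.
  - apply (@is_RInt_minus R_NormedModule); now apply (@is_RInt_scal R_NormedModule).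
  - apply (@is_RInt_plus R_NormedModule); now apply (@is_RInt_scal R_NormedModule).
Qed.

Lemma is_CInt_minus (f g : R -> C) (a b : R) (l m : C) :
  is_CInt f a b l -> is_CInt g a b m -> is_CInt (fun t => f t - g t)%C a b (l - m)%C.
Proof. exact (@is_RInt_minus C_R_NormedModule f g a b l m). Qed.

Lemma is_CInt_const (c : C) (a b : R) : is_CInt (fun _ => c) a b (RtoC (b - a) * c)%C.
Proof.
  rewrite <- scal_R_Cmult. exact (@is_RInt_const C_R_NormedModule a b c).
Qed.

Lemma is_CInt_Chasles (f : R -> C) (a b c : R) (l m : C) :
  is_CInt f a b l -> is_CInt f b c m -> is_CInt f a c (l + m)%C.
Proof. exact (@is_RInt_Chasles C_R_NormedModule f a b c l m). Qed.

Lemma Cmod_CInt_le (f : R -> C) (g : R -> R) (a b : R) (l : C) (m : R) : a <= b ->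
  (forall t, a <= t <= b -> Cmod (f t) <= g t) ->
  is_CInt f a b l -> is_RInt g a b m -> Cmod l <= m.
Proof.
  intros Hab H Hf Hg. rewrite Cmod_norm.
  apply (@norm_RInt_le C_R_NormedModule f g a b l m Hab); [|easy|easy].
  intros x Hx. assert (E := H x Hx). rewrite Cmod_norm in E. exact E.
Qed.

Lemma Cmod_CInt_le_const (f : R -> C) (M a b : R) (l : C) : a <= b ->
  (forall t, a <= t <= b -> Cmod (f t) <= M) ->
  is_CInt f a b l -> Cmod l <= (b - a) * M.
Proof.
  intros Hab H Hf. apply (Cmod_CInt_le f (fun _ => M) a b l); auto.
  exact (@is_RInt_const R_NormedModule a b M).
Qed.

Lemma CInt_Chasles (f : R -> C) (a b c : R) : a <= b <= c ->
  (forall t, a <= t <= c -> ccont f t) ->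
  CInt f a c = (CInt f a b + CInt f b c)%C.
Proof.
  intros H Hf. apply CInt_unique. apply is_CInt_Chasles with b;
  apply CInt_correct; try lra; intros; apply Hf; lra.
Qed.

(** The contour integral of [F] around the boundary, counterclockwise; [Ci] comes from [dz = i dy]
    on the vertical sides. *)
Definition rect_int (F : C -> C) (x1 x2 y1 y2 : R) : C :=
  (CInt (fun x => F (x, y1)) x1 x2 + Ci * CInt (fun y => F (x2, y)) y1 y2
   - CInt (fun x => F (x, y2)) x1 x2 - Ci * CInt (fun y => F (x1, y)) y1 y2)%C.

Definition diff_on_rect (F : C -> C) (x1 x2 y1 y2 : R) : Prop :=
  forall x y, x1 <= x <= x2 -> y1 <= y <= y2 -> Cdiff F (x, y).

Lemma Cdiff_ccont (F : C -> C) (g : R -> C) (t : R) :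
  Cdiff F (g t) -> (forall s, Cmod (g s - g t)%C <= Rabs (s - t)) ->
  ccont (fun s => F (g s)) t.
Proof.
  intros HF Hg eps He. destruct (Cder_continuous F (g t) HF eps He) as [d [Hd Hw]].
  exists d. split; [easy|]. intros s Hs. apply Hw.
  eapply Rle_lt_trans; [apply Hg|easy].
Qed.

Lemma ccont_horizontal (F : C -> C) (x y : R) :
  Cdiff F (x, y) -> ccont (fun s => F (s, y)) x.
Proof.
  intro H. apply (Cdiff_ccont F (fun s => (s, y))); [easy|].
  intro s. rewrite <- Cmod_R. right. f_equal.
  unfold Cminus, Cplus, Copp, RtoC; simpl. f_equal; ring.
Qed.

Lemma ccont_vertical (F : C -> C) (x y : R) :
  Cdiff F (x, y) -> ccont (fun s => F (x, s)) y.
Proof.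
  intro H. apply (Cdiff_ccont F (fun s => (x, s))); [easy|].
  intro s. rewrite <- Cmod_R. rewrite <- (Rmult_1_l (Cmod (s - y)%R)), <- Cmod_Ci, <- Cmod_mult.
  right. f_equal. unfold Cminus, Cplus, Cmult, Ci, Copp, RtoC; simpl. f_equal; ring.
Qed.

Lemma rect_int_split_x (F : C -> C) (x1 x2 x3 y1 y2 : R) :
  x1 <= x2 <= x3 -> y1 <= y2 -> diff_on_rect F x1 x3 y1 y2 ->
  rect_int F x1 x3 y1 y2 = (rect_int F x1 x2 y1 y2 + rect_int F x2 x3 y1 y2)%C.
Proof.
  intros Hx Hy HF. unfold rect_int.
  rewrite (CInt_Chasles (fun x => F (x, y1)) x1 x2 x3), (CInt_Chasles (fun x => F (x, y2)) x1 x2 x3).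
  ring. easy. intros; apply ccont_horizontal, HF; lra.
  easy. intros; apply ccont_horizontal, HF; lra.
Qed.

Lemma rect_int_split_y (F : C -> C) (x1 x2 y1 y2 y3 : R) :
  x1 <= x2 -> y1 <= y2 <= y3 -> diff_on_rect F x1 x2 y1 y3 ->
  rect_int F x1 x2 y1 y3 = (rect_int F x1 x2 y1 y2 + rect_int F x1 x2 y2 y3)%C.
Proof.
  intros Hx Hy HF. unfold rect_int.
  rewrite (CInt_Chasles (fun y => F (x1, y)) y1 y2 y3), (CInt_Chasles (fun y => F (x2, y)) y1 y2 y3).
  ring. easy. intros; apply ccont_vertical, HF; lra.
  easy. intros; apply ccont_vertical, HF; lra.
Qed.

Lemma CInt_line (c d : C) (a b : R) :
  is_CInt (fun t => c + RtoC t * d)%C a b (RtoC (b - a) * c + RtoC ((b * b - a * a) / 2) * d)%C.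
Proof.
  apply is_CInt_plus; [apply is_CInt_const|].
  apply is_CInt_ext with (fun t => d * RtoC t)%C; [intro; ring|].
  rewrite (Cmult_comm _ d). apply is_CInt_scal, is_CInt_RtoC.
  replace ((b * b - a * a) / 2) with (minus (b * b / 2) (a * a / 2))
    by (unfold minus, plus, opp; simpl; field).
  apply (@is_RInt_derive R_CompleteNormedModule (fun t => t * t / 2)).
  - intros x _. auto_derive; [easy|field].
  - intros x _. apply continuous_id.
Qed.

(** Lets the first-order part of [F] be subtracted in Goursat's argument; the four sides are
    computed explicitly. *)
Lemma rect_int_affine (c d : C) (x1 x2 y1 y2 : R) :
  rect_int (fun w => c + d * w)%C x1 x2 y1 y2 = 0%C.
Proof.
  assert (Hx : forall y, CInt (fun x => c + d * (x, y))%C x1 x2 =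
    (RtoC (x2 - x1) * (c + d * (Ci * RtoC y)) + RtoC ((x2 * x2 - x1 * x1) / 2) * d)%C).
  { intro y. apply CInt_unique.
    apply is_CInt_ext with (2 := CInt_line (c + d * (Ci * RtoC y)) d x1 x2).
    intro x. replace (x, y) with (RtoC x + Ci * RtoC y)%C. ring.
    unfold Ci, RtoC, Cmult, Cplus; simpl. f_equal; ring. }
  assert (Hy : forall x, CInt (fun y => c + d * (x, y))%C y1 y2 =
    (RtoC (y2 - y1) * (c + d * RtoC x) + RtoC ((y2 * y2 - y1 * y1) / 2) * (Ci * d))%C).
  { intro x. apply CInt_unique.
    apply is_CInt_ext with (2 := CInt_line (c + d * RtoC x) (Ci * d) y1 y2).
    intro y. replace (x, y) with (RtoC x + Ci * RtoC y)%C. ring.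
    unfold Ci, RtoC, Cmult, Cplus; simpl. f_equal; ring. }
  unfold rect_int. rewrite !Hx, !Hy.
  destruct c as [c1 c2], d as [d1 d2].
  unfold Ci, RtoC, Cmult, Cminus, Cplus, Copp; simpl. f_equal; field.
Qed.

Lemma Cmod_rect_int_le (F : C -> C) (x1 x2 y1 y2 M s : R) :
  x1 <= x2 -> y1 <= y2 -> x2 - x1 <= s -> y2 - y1 <= s -> 0 <= M ->
  diff_on_rect F x1 x2 y1 y2 ->
  (forall x y, x1 <= x <= x2 -> y1 <= y <= y2 -> Cmod (F (x, y)) <= M) ->
  Cmod (rect_int F x1 x2 y1 y2) <= 4 * (s * M).
Proof.
  intros Hx Hy Hsx Hsy HM HF HB.
  assert (Bx : forall y, y1 <= y <= y2 -> Cmod (CInt (fun x => F (x, y)) x1 x2) <= s * M).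
  { intros y Hyy. apply Rle_trans with ((x2 - x1) * M); [|nra].
    apply (Cmod_CInt_le_const (fun x => F (x, y))); [easy|auto|].
    apply CInt_correct; [easy|]. intros; now apply ccont_horizontal, HF. }
  assert (By : forall x, x1 <= x <= x2 -> Cmod (CInt (fun y => F (x, y)) y1 y2) <= s * M).
  { intros x Hxx. apply Rle_trans with ((y2 - y1) * M); [|nra].
    apply (Cmod_CInt_le_const (fun y => F (x, y))); [easy|auto|].
    apply CInt_correct; [easy|]. intros; now apply ccont_vertical, HF. }
  unfold rect_int.
  eapply Rle_trans; [apply Cmod_minus_triangle|].
  eapply Rle_trans; [apply Rplus_le_compat_r, Cmod_minus_triangle|].
  eapply Rle_trans; [apply Rplus_le_compat_r, Rplus_le_compat_r, Cmod_triangle|].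
  rewrite !Cmod_mult, Cmod_Ci.
  assert (X1 := Bx y1). assert (X2 := Bx y2). assert (Y1 := By x1). assert (Y2 := By x2).
  assert (Cmod (CInt (fun x => F (x, y1)) x1 x2) <= s * M) by (apply X1; lra).
  assert (Cmod (CInt (fun x => F (x, y2)) x1 x2) <= s * M) by (apply X2; lra).
  assert (Cmod (CInt (fun y => F (x1, y)) y1 y2) <= s * M) by (apply Y1; lra).
  assert (Cmod (CInt (fun y => F (x2, y)) y1 y2) <= s * M) by (apply Y2; lra).
  lra.
Qed.

Lemma rect_int_minus (F G : C -> C) (x1 x2 y1 y2 : R) :
  x1 <= x2 -> y1 <= y2 ->
  diff_on_rect F x1 x2 y1 y2 -> diff_on_rect G x1 x2 y1 y2 ->
  rect_int (fun w => F w - G w)%C x1 x2 y1 y2 = (rect_int F x1 x2 y1 y2 - rect_int G x1 x2 y1 y2)%C.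
Proof.
  intros Hx Hy HF HG.
  assert (Ex : forall y, y1 <= y <= y2 -> CInt (fun x => F (x, y) - G (x, y))%C x1 x2 =
     (CInt (fun x => F (x, y)) x1 x2 - CInt (fun x => G (x, y)) x1 x2)%C).
  { intros y Hyy. apply CInt_unique, is_CInt_minus; apply CInt_correct; try easy;
    intros; apply ccont_horizontal; auto. }
  assert (Ey : forall x, x1 <= x <= x2 -> CInt (fun y => F (x, y) - G (x, y))%C y1 y2 =
     (CInt (fun y => F (x, y)) y1 y2 - CInt (fun y => G (x, y)) y1 y2)%C).
  { intros x Hxx. apply CInt_unique, is_CInt_minus; apply CInt_correct; try easy;
    intros; apply ccont_vertical; auto. }
  unfold rect_int. rewrite !Ex, !Ey by lra. ring.
Qed.

Section Bisection.

Variables (F : C -> C) (A B eta : R).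

Let size_x (n : nat) := A / 2 ^ n.
Let size_y (n : nat) := B / 2 ^ n.

Let large (n : nat) (p : R * R) : Prop :=
  eta / 4 ^ n <=
  Cmod (rect_int F (fst p) (fst p + size_x n) (snd p) (snd p + size_y n)).

(** The last quarter is taken without a test: [bisect_large_step] shows that it is large whenever
    the other three are not. *)
Let choice (n : nat) (p : R * R) : R * R :=
  let x := fst p in let y := snd p in
  let x' := x + size_x (S n) in let y' := y + size_y (S n) in
  if excluded_middle_informative (large (S n) (x, y)) then (x, y)
  else if excluded_middle_informative (large (S n) (x', y)) then (x', y)
  else if excluded_middle_informative (large (S n) (x, y')) then (x, y')
  else (x', y').

Fixpoint bisect (p : R * R) (n : nat) : R * R :=
  match n with O => p | S n => choice n (bisect p n) end.

Lemma size_half_x (n : nat) : size_x n = size_x (S n) + size_x (S n).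
Proof. unfold size_x. simpl. field. apply pow_nonzero. lra. Qed.

Lemma size_half_y (n : nat) : size_y n = size_y (S n) + size_y (S n).
Proof. unfold size_y. simpl. field. apply pow_nonzero. lra. Qed.

Lemma bisect_choice_bounds (n : nat) (p : R * R) : 0 <= A -> 0 <= B ->
  fst p <= fst (choice n p) <= fst p + size_x (S n) /\
  snd p <= snd (choice n p) <= snd p + size_y (S n).
Proof.
  intros HA HB.
  assert (0 <= size_x (S n)).
  { unfold size_x. apply Rmult_le_pos; [easy|]. left. apply Rinv_0_lt_compat, pow_lt. lra. }
  assert (0 <= size_y (S n)).
  { unfold size_y. apply Rmult_le_pos; [easy|]. left. apply Rinv_0_lt_compat, pow_lt. lra. }
  unfold choice. repeat destruct excluded_middle_informative; simpl; lra.
Qed.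

(** The integrals over the four quarters add up to the whole, so they cannot all be smaller than a
    quarter of its lower bound. *)
Lemma bisect_large_step (n : nat) (p : R * R) : 0 <= A -> 0 <= B ->
  diff_on_rect F (fst p) (fst p + size_x n) (snd p) (snd p + size_y n) ->
  large n p -> large (S n) (choice n p).
Proof.
  intros HA HB HF HL.
  assert (Sx : 0 <= size_x (S n)).
  { unfold size_x. apply Rmult_le_pos; [easy|]. left. apply Rinv_0_lt_compat, pow_lt. lra. }
  assert (Sy : 0 <= size_y (S n)).
  { unfold size_y. apply Rmult_le_pos; [easy|]. left. apply Rinv_0_lt_compat, pow_lt. lra. }
  unfold choice.
  destruct excluded_middle_informative as [H|H1]; [exact H|].
  destruct excluded_middle_informative as [H|H2]; [exact H|].
  destruct excluded_middle_informative as [H|H3]; [exact H|].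
  apply NNPP. intro H4. unfold large in *. destruct p as [x y]; simpl fst in *; simpl snd in *.
  apply Rnot_le_lt in H1, H2, H3, H4.
  rewrite size_half_x, size_half_y, <- !Rplus_assoc in HL.
  rewrite size_half_x, size_half_y, <- !Rplus_assoc in HF.
  rewrite (rect_int_split_x F x (x + size_x (S n))) in HL; [|lra|lra|exact HF].
  rewrite (rect_int_split_y F x (x + size_x (S n)) y (y + size_y (S n))) in HL; [|lra|lra|].
  2: intros u v Hu Hv; apply HF; lra.
  rewrite (rect_int_split_y F (x + size_x (S n)) _ y (y + size_y (S n))) in HL; [|lra|lra|].
  2: intros u v Hu Hv; apply HF; lra.
  assert (T := Rle_trans _ _ _ HL (Cmod_triangle _ _)).
  assert (T1 := Rle_trans _ _ _ T (Rplus_le_compat _ _ _ _ (Cmod_triangle _ _) (Cmod_triangle _ _))).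
  replace (eta / 4 ^ n) with (4 * (eta / 4 ^ S n)) in T1.
  lra. simpl. field. apply pow_nonzero; lra.
Qed.

End Bisection.

Theorem Goursat (F : C -> C) (x1 x2 y1 y2 : R) :
  x1 <= x2 -> y1 <= y2 -> diff_on_rect F x1 x2 y1 y2 ->
  rect_int F x1 x2 y1 y2 = 0%C.
Proof.
  intros Hx Hy HF. apply NNPP. intro Hne.
  apply Cmod_gt_0 in Hne. set (eta := Cmod (rect_int F x1 x2 y1 y2)) in *.
  set (A := x2 - x1). set (B := y2 - y1).
  assert (HA : 0 <= A) by (unfold A; lra). assert (HB : 0 <= B) by (unfold B; lra).
  set (p := bisect F A B eta (x1, y1)).
  set (sx := fun n => A / 2 ^ n). set (sy := fun n => B / 2 ^ n).
  assert (Hsx : forall n, 0 <= sx n).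
  { intro n. apply Rmult_le_pos; [easy|]. left. apply Rinv_0_lt_compat, pow_lt. lra. }
  assert (Hsy : forall n, 0 <= sy n).
  { intro n. apply Rmult_le_pos; [easy|]. left. apply Rinv_0_lt_compat, pow_lt. lra. }
  assert (Hstep : forall n,
    (fst (p n) <= fst (p (S n)) /\ fst (p (S n)) + sx (S n) <= fst (p n) + sx n) /\
    (snd (p n) <= snd (p (S n)) /\ snd (p (S n)) + sy (S n) <= snd (p n) + sy n)).
  { intro n. assert (H := bisect_choice_bounds F A B eta n (p n) HA HB).
    assert (X := size_half_x A n). assert (Y := size_half_y B n). simpl in X, Y.
    unfold p in *. simpl. unfold sx, sy. simpl. simpl in H. lra. }
  assert (Hmono : forall n k,
    (fst (p n) <= fst (p (n + k)%nat) /\ fst (p (n + k)%nat) + sx (n + k)%nat <= fst (p n) + sx n) /\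
    (snd (p n) <= snd (p (n + k)%nat) /\ snd (p (n + k)%nat) + sy (n + k)%nat <= snd (p n) + sy n)).
  { intros n k. induction k as [|k IH].
    - rewrite Nat.add_0_r. lra.
    - rewrite Nat.add_succ_r. assert (H := Hstep (n + k)%nat). lra. }
  assert (Hin : forall n, x1 <= fst (p n) /\ fst (p n) + sx n <= x2 /\
                          y1 <= snd (p n) /\ snd (p n) + sy n <= y2).
  { intro n. assert (H := Hmono O n). simpl in H.
    assert (X0 : sx O = x2 - x1) by (unfold sx, A; simpl; field).
    assert (Y0 : sy O = y2 - y1) by (unfold sy, B; simpl; field).
    rewrite X0, Y0 in H. lra. }
  assert (Hlarge : forall n, eta / 4 ^ n <=
     Cmod (rect_int F (fst (p n)) (fst (p n) + sx n) (snd (p n)) (snd (p n) + sy n))).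
  { induction n as [|n IH].
    - simpl. unfold sx, sy, A, B, eta. simpl. unfold Rdiv. rewrite Rinv_1, !Rmult_1_r.
      replace (x1 + (x2 - x1)) with x2 by ring. replace (y1 + (y2 - y1)) with y2 by ring. lra.
    - apply (bisect_large_step F A B eta n (p n) HA HB); [|exact IH].
      assert (H := Hin n). unfold sx, sy in H.
      intros u v Hu Hv. apply HF; lra. }
  assert (Hlimx : exists u, forall n, fst (p n) <= u <= fst (p n) + sx n).
  { destruct (completeness (fun t => exists n, t = fst (p n))) as [u [Hu1 Hu2]].
    - exists x2. intros t [n ->]. assert (H := Hin n). assert (H' := Hsx n). lra.
    - exists (fst (p O)). now exists O.
    - exists u. intro n. split; [apply Hu1; now exists n|].
      apply Hu2. intros t [m ->].
      assert (H1 := Hmono n m). assert (H2 := Hmono m n). rewrite (Nat.add_comm m n) in H2.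
      assert (H3 := Hsx (n + m)%nat). lra. }
  assert (Hlimy : exists v, forall n, snd (p n) <= v <= snd (p n) + sy n).
  { destruct (completeness (fun t => exists n, t = snd (p n))) as [u [Hu1 Hu2]].
    - exists y2. intros t [n ->]. assert (H := Hin n). assert (H' := Hsy n). lra.
    - exists (snd (p O)). now exists O.
    - exists u. intro n. split; [apply Hu1; now exists n|].
      apply Hu2. intros t [m ->].
      assert (H1 := Hmono n m). assert (H2 := Hmono m n). rewrite (Nat.add_comm m n) in H2.
      assert (H3 := Hsy (n + m)%nat). lra. }
  destruct Hlimx as [u Hu]. destruct Hlimy as [v Hv].
  assert (Huv : Cdiff F (u, v)).
  { apply HF; [assert (H := Hin O); assert (H' := Hu O)|assert (H := Hin O); assert (H' := Hv O)]; lra. }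
  destruct Huv as [l Hl].
  (* The summand 1 keeps [s] positive for a degenerate rectangle. With tolerance [eta / (8 s^2)] the
     perimeter bound [4 sn (eps sn)], where [sn = s / 2^n], is exactly half of [eta / 4^n]. *)
  set (s := A + B + 1). assert (Hs : 0 < s) by (unfold s; lra).
  assert (Heps : 0 < eta / (8 * (s * s))) by (apply Rdiv_lt_0_compat; nra).
  destruct (Hl _ Heps) as [d [Hd Hw]].
  assert (Hn : exists n, s / 2 ^ n < d).
  { destruct (Rgt_dec d s) as [Hgt|Hgt].
    - exists O. simpl. lra.
    - assert (Hhalf : Rabs (/ 2) < 1) by (rewrite Rabs_pos_eq; lra).
      assert (Hds : 0 < d / s) by (apply Rdiv_lt_0_compat; lra).
      destruct (pow_lt_1_zero (/ 2) Hhalf (d / s) Hds) as [n Hn].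
      exists n. specialize (Hn n (Nat.le_refl n)).
      rewrite Rabs_pos_eq in Hn by (apply pow_le; lra).
      rewrite pow_inv in Hn. apply Rmult_lt_reg_r with (/ s). now apply Rinv_0_lt_compat.
      unfold Rdiv in *. replace (s * / 2 ^ n * / s) with (/ 2 ^ n). easy.
      field. split; [lra|apply pow_nonzero; lra]. }
  destruct Hn as [n Hn].
  specialize (Hlarge n). specialize (Hu n). specialize (Hv n). specialize (Hin n).
  set (x := fst (p n)) in *. set (y := snd (p n)) in *.
  assert (H2n : 0 < / 2 ^ n) by (apply Rinv_0_lt_compat, pow_lt; lra).
  assert (Hss : sx n + sy n <= s / 2 ^ n) by (unfold sx, sy, s, Rdiv; nra).
  assert (Px := Hsx n). assert (Py := Hsy n).
  set (sn := s / 2 ^ n) in *.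
  (* The affine approximation of [F] at the limit point; its contour integral vanishes, so only the
     remainder counts. *)
  set (L := fun w => (F (u, v) - l * (u, v) + l * w)%C).
  assert (HR : diff_on_rect F x (x + sx n) y (y + sy n)).
  { intros a b Ha Hb. apply HF; lra. }
  assert (HLd : diff_on_rect L x (x + sx n) y (y + sy n)).
  { intros a b Ha Hb. apply Cdiff_plus; [apply Cdiff_const|].
    apply Cdiff_mult; [apply Cdiff_const|apply Cdiff_id]. }
  assert (HE : rect_int F x (x + sx n) y (y + sy n) =
     rect_int (fun w => F w - L w)%C x (x + sx n) y (y + sy n)).
  { rewrite rect_int_minus; try lra; auto. unfold L. rewrite rect_int_affine. ring. }
  rewrite HE in Hlarge.
  assert (HB' : Cmod (rect_int (fun w => F w - L w)%C x (x + sx n) y (y + sy n)) <=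
     4 * (sn * (eta / (8 * (s * s)) * sn))).
  { apply Cmod_rect_int_le; try lra.
    - apply Rmult_le_pos; lra.
    - intros a b Ha Hb. apply Cdiff_minus; [now apply HR|now apply HLd].
    - intros a b Ha Hb.
      assert (Hab : Cmod ((a, b) - (u, v))%C <= sn).
      { eapply Rle_trans; [apply Cmod_le_Re_Im|]. simpl.
        assert (Rabs (a + - u) <= sx n) by (apply Rabs_le; lra).
        assert (Rabs (b + - v) <= sy n) by (apply Rabs_le; lra). lra. }
      replace (F (a, b) - L (a, b))%C with (F (a, b) - F (u, v) - l * ((a, b) - (u, v)))%C
        by (unfold L; ring).
      eapply Rle_trans; [apply Hw; lra|]. apply Rmult_le_compat_l; lra. }
  assert (E4 : 4 * (sn * (eta / (8 * (s * s)) * sn)) = / 2 * (eta / 4 ^ n)).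
  { unfold sn. replace (4 ^ n) with (2 ^ n * 2 ^ n) by (rewrite <- Rpow_mult_distr; f_equal; ring).
    field. split; [apply pow_nonzero; lra|lra]. }
  assert (0 < eta / 4 ^ n) by (apply Rdiv_lt_0_compat; [easy|apply pow_lt; lra]).
  lra.
Qed.

(** * Power series *)

Lemma sum_n_S (a : nat -> R) (n : nat) : sum_n a (S n) = sum_n a n + a (S n).
Proof. apply (sum_Sn (G := R_AbelianMonoid)). Qed.

Lemma sum_n_0 (a : nat -> R) : sum_n a 0 = a O.
Proof. apply (sum_O (G := R_AbelianMonoid)). Qed.

Lemma sum_n_le (a b : nat -> R) (n : nat) :
  (forall k, (k <= n)%nat -> a k <= b k) -> sum_n a n <= sum_n b n.
Proof.
  intro H. induction n as [|n IH].
  - rewrite !sum_n_0. apply H; lia.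
  - rewrite !sum_n_S. apply Rplus_le_compat; [apply IH; intros; apply H; lia|apply H; lia].
Qed.

Lemma sum_n_nonneg (a : nat -> R) (n : nat) : (forall k, 0 <= a k) -> 0 <= sum_n a n.
Proof.
  intro H. induction n as [|n IH]; [rewrite sum_n_0|rewrite sum_n_S; assert (X := H (S n))];
  [apply H|lra].
Qed.

Lemma sum_n_scal (c : R) (a : nat -> R) (n : nat) :
  sum_n (fun k => c * a k) n = c * sum_n a n.
Proof. exact (sum_n_mult_l (K := R_Ring) c a n). Qed.

Lemma sum_n_mono (a : nat -> R) (n m : nat) :
  (forall k, 0 <= a k) -> (n <= m)%nat -> sum_n a n <= sum_n a m.
Proof.
  intros H Hnm. induction Hnm as [|m Hm IH]; [lra|].
  rewrite sum_n_S. assert (X := H (S m)). lra.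
Qed.

Lemma sum_n_term_le (a : nat -> R) (n k : nat) :
  (forall j, 0 <= a j) -> (k <= n)%nat -> a k <= sum_n a n.
Proof.
  intros H Hk. apply Rle_trans with (sum_n a k); [|now apply sum_n_mono].
  destruct k; [rewrite sum_n_0; lra|]. rewrite sum_n_S. assert (X := sum_n_nonneg a k H). lra.
Qed.

Lemma ex_series_bounded (a : nat -> R) (M : R) :
  (forall n, 0 <= a n) -> (forall n, sum_n a n <= M) -> ex_series a.
Proof.
  intros Ha HM. apply (ex_finite_lim_seq_incr (sum_n a) M); [|easy].
  intro n. rewrite sum_n_S. assert (X := Ha (S n)). lra.
Qed.

Lemma is_series_lim (a : nat -> R) (l : R) : is_series a l <-> is_lim_seq (sum_n a) l.
Proof. reflexivity. Qed.

Lemma sum_n_le_Series (a : nat -> R) (n : nat) :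
  (forall k, 0 <= a k) -> ex_series a -> sum_n a n <= Series a.
Proof.
  intros Ha He. apply Series_correct in He.
  apply (is_lim_seq_incr_compare (sum_n a)); [exact He|].
  intro k. rewrite sum_n_S. assert (X := Ha (S k)). lra.
Qed.

Lemma Series_le_bound (a : nat -> R) (M : R) :
  ex_series a -> (forall n, sum_n a n <= M) -> Series a <= M.
Proof.
  intros He H. apply Series_correct in He.
  exact (is_lim_seq_le (sum_n a) (fun _ => M) (Series a) M H He (is_lim_seq_const M)).
Qed.

Lemma Series_nonneg (a : nat -> R) : (forall n, 0 <= a n) -> ex_series a -> 0 <= Series a.
Proof.
  intros Ha He. apply Rle_trans with (sum_n a 0); [now apply sum_n_nonneg|].
  now apply sum_n_le_Series.
Qed.

Lemma ex_series_nonneg_le (a b : nat -> R) :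
  (forall n, 0 <= a n <= b n) -> ex_series b -> ex_series a.
Proof.
  intros H He. apply (ex_series_bounded a (Series b)); [intro; apply H|].
  intro n. apply Rle_trans with (sum_n b n); [apply sum_n_le; intros; apply H|].
  apply sum_n_le_Series; [|easy]. intro k. specialize (H k). lra.
Qed.

Definition csum (a : nat -> C) (n : nat) : C := @sum_n C_AbelianMonoid a n.

Lemma csum_S (a : nat -> C) (n : nat) : csum a (S n) = (csum a n + a (S n))%C.
Proof. apply (sum_Sn (G := C_AbelianMonoid)). Qed.

Lemma csum_0 (a : nat -> C) : csum a 0 = a O.
Proof. apply (sum_O (G := C_AbelianMonoid)). Qed.

Lemma Cmod_csum_minus_le (a : nat -> C) (b : nat -> R) (n m : nat) :
  (forall k, Cmod (a k) <= b k) -> (n <= m)%nat ->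
  Cmod (csum a m - csum a n)%C <= sum_n b m - sum_n b n.
Proof.
  intros H Hnm. induction Hnm as [|m Hm IH].
  - replace (csum a n - csum a n)%C with (RtoC 0) by ring. rewrite Cmod_0. lra.
  - rewrite csum_S, sum_n_S.
    replace (csum a m + a (S m) - csum a n)%C with ((csum a m - csum a n) + a (S m))%C by ring.
    eapply Rle_trans; [apply Cmod_triangle|]. assert (X := H (S m)). lra.
Qed.

Lemma Cmod_csum_le (a : nat -> C) (b : nat -> R) (n : nat) :
  (forall k, Cmod (a k) <= b k) -> Cmod (csum a n) <= sum_n b n.
Proof.
  intros H. induction n as [|n IH].
  - rewrite csum_0, sum_n_0. apply H.
  - rewrite csum_S, sum_n_S.
    eapply Rle_trans; [apply Cmod_triangle|]. assert (X := H (S n)). lra.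
Qed.

Definition is_cseries (a : nat -> C) (l : C) : Prop :=
  @is_series C_AbsRing C_NormedModule a l.

Lemma is_cseries_eps (a : nat -> C) (l : C) : is_cseries a l <->
  forall eps, 0 < eps -> exists N, forall n, (N <= n)%nat -> Cmod (csum a n - l)%C < eps.
Proof.
  split.
  - intros H eps He.
    (* Balls of the uniform structure on [C] are boxes; a box of half-width [eps / 2] lies in the
       disk of radius [sqrt 2 * eps / 2 < eps]. *)
    assert (He2 : 0 < eps / 2) by lra.
    destruct (H (fun w => Cmod (w - l)%C < eps)) as [N HN].
    + exists (mkposreal _ He2). intros w Hw.
      assert (X := C_NormedModule_mixin_compat2 l w _ Hw). simpl in X.
      change (Cmod (w - l)%C < sqrt 2 * (eps / 2)) in X.
      assert (sqrt 2 < 2).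
      { apply Rsqr_incrst_0; [|apply sqrt_pos|lra]. rewrite Rsqr_sqrt by lra. unfold Rsqr; lra. }
      nra.
    + exists N. exact HN.
  - intros H P [e HP]. destruct (H e (cond_pos e)) as [N HN].
    exists N. intros n Hn. apply HP.
    apply (C_NormedModule_mixin_compat1 l (csum a n) e). now apply HN.
Qed.

Lemma is_cseries_Cmod_le (a : nat -> C) (b : nat -> R) (l : C) (m : R) :
  (forall n, Cmod (a n) <= b n) -> is_cseries a l -> is_series b m -> Cmod l <= m.
Proof.
  intros H Ha Hb. apply le_epsilon. intros eps He.
  destruct (proj1 (is_cseries_eps a l) Ha eps He) as [N HN].
  specialize (HN N (Nat.le_refl N)). rewrite Cmod_minus_sym in HN.
  assert (H1 := Cmod_triangle_minus l (csum a N)).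
  assert (H2 := Cmod_csum_le a b N H).
  assert (H3 : sum_n b N <= m).
  { rewrite <- (is_series_unique b m Hb). apply sum_n_le_Series; [|now exists m].
    intro k. eapply Rle_trans; [apply Cmod_ge_0|apply H]. }
  lra.
Qed.

Lemma is_cseries_tail_le (a : nat -> C) (b : nat -> R) (l : C) (N : nat) :
  (forall n, Cmod (a n) <= b n) -> is_cseries a l -> ex_series b ->
  Cmod (l - csum a N)%C <= Series b - sum_n b N.
Proof.
  intros H Ha Hb. apply le_epsilon. intros eps He.
  destruct (proj1 (is_cseries_eps a l) Ha eps He) as [M HM].
  specialize (HM (N + M)%nat ltac:(lia)). rewrite Cmod_minus_sym in HM.
  assert (H2 := Cmod_csum_minus_le a b N (N + M) H ltac:(lia)).
  assert (H3 : sum_n b (N + M) <= Series b).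
  { apply sum_n_le_Series; [|easy].
    intro k. eapply Rle_trans; [apply Cmod_ge_0|apply H]. }
  replace (l - csum a N)%C with ((l - csum a (N + M)) + (csum a (N + M) - csum a N))%C by ring.
  eapply Rle_trans; [apply Cmod_triangle|]. lra.
Qed.

Lemma Series_tail_small (b : nat -> R) (eps : R) : (forall n, 0 <= b n) -> ex_series b -> 0 < eps ->
  exists N, forall n, (N <= n)%nat -> 0 <= Series b - sum_n b n < eps.
Proof.
  intros Hp Hb He. assert (Hs := Series_correct b Hb).
  apply is_series_lim, is_lim_seq_spec in Hs.
  destruct (Hs (mkposreal eps He)) as [N HN]. exists N. intros n Hn.
  specialize (HN n Hn). simpl in HN.
  assert (X := sum_n_le_Series b n Hp Hb). apply Rabs_def2 in HN. lra.
Qed.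

Lemma ex_cseries_le (a : nat -> C) (b : nat -> R) :
  (forall n, Cmod (a n) <= b n) -> ex_series b -> exists l, is_cseries a l.
Proof.
  intros H Hb.
  destruct (@ex_series_le C_AbsRing C_CompleteNormedModule a b) as [l Hl]; [|easy|].
  - exact H.
  - exists l. exact Hl.
Qed.

Lemma is_cseries_ext (a b : nat -> C) (l : C) :
  (forall n, a n = b n) -> is_cseries a l -> is_cseries b l.
Proof. apply is_series_ext. Qed.

Lemma is_cseries_minus (a b : nat -> C) (l m : C) :
  is_cseries a l -> is_cseries b m -> is_cseries (fun n => a n - b n)%C (l - m)%C.
Proof. exact (@is_series_minus C_AbsRing C_NormedModule a b l m). Qed.

Lemma is_cseries_scal (c : C) (a : nat -> C) (l : C) :
  is_cseries a l -> is_cseries (fun n => c * a n)%C (c * l)%C.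
Proof. exact (@is_series_scal C_AbsRing C_NormedModule c a l). Qed.

Lemma is_cseries_RtoC (a : nat -> R) (l : R) :
  is_series a l -> is_cseries (fun n => RtoC (a n)) (RtoC l).
Proof.
  intro H. apply is_cseries_eps. intros eps He.
  apply is_series_lim, is_lim_seq_spec in H.
  destruct (H (mkposreal eps He)) as [N HN]. exists N. intros n Hn.
  specialize (HN n Hn). simpl in HN.
  replace (csum (fun n => RtoC (a n)) n) with (RtoC (sum_n a n)).
  - rewrite <- RtoC_minus, Cmod_R. exact HN.
  - clear. induction n as [|n IH]; [now rewrite csum_0, sum_n_0|].
    now rewrite csum_S, sum_n_S, RtoC_plus, IH.
Qed.

Lemma is_cseries_unique (a : nat -> C) (l m : C) : is_cseries a l -> is_cseries a m -> l = m.
Proof.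
  intros Hl Hm.
  assert (H : Cmod (l - m)%C <= 0).
  { apply le_epsilon. intros eps He.
    destruct (proj1 (is_cseries_eps a l) Hl (eps / 2)) as [N HN]; [lra|].
    destruct (proj1 (is_cseries_eps a m) Hm (eps / 2)) as [M HM]; [lra|].
    specialize (HN (N + M)%nat ltac:(lia)). specialize (HM (N + M)%nat ltac:(lia)).
    rewrite Cmod_minus_sym in HN.
    replace (l - m)%C with ((l - csum a (N + M)) + (csum a (N + M) - m))%C by ring.
    eapply Rle_trans; [apply Cmod_triangle|]. lra. }
  apply Ceq_minus, Cmod_eq_0. assert (X := Cmod_ge_0 (l - m)%C). lra.
Qed.

Definition summable_on_D (a : nat -> C) : Prop :=
  forall r, 0 <= r < 1 -> ex_series (fun n => Cmod (a n) * r ^ n).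

Lemma is_series_power_rules (a : nat -> R) (r : R) : (forall n, 0 <= a n) ->
  (forall s, 0 <= s < 1 -> ex_series (fun n => a n * s ^ n)) -> 0 <= r < 1 ->
  is_derive (PSeries a) r (PSeries (PS_derive a) r) /\
  ex_pseries (PS_derive a) r.
Proof.
  intros Ha He Hr.
  assert (HC : Rbar_lt (Rabs r) (CV_radius a)).
  { rewrite Rabs_pos_eq by lra.
    apply Rbar_lt_le_trans with ((1 + r) / 2); [simpl; lra|].
    destruct (CV_radius_bounded a) as [H _]. apply H.
    set (s := (1 + r) / 2). assert (Hs : 0 <= s < 1) by (unfold s; lra).
    exists (Series (fun n => a n * s ^ n)). intro n.
    assert (P : forall k, 0 <= a k * s ^ k).
    { intro k. apply Rmult_le_pos; [easy|]. apply pow_le; lra. }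
    rewrite Rabs_pos_eq by easy.
    eapply Rle_trans; [apply (sum_n_term_le (fun k => a k * s ^ k) n n P (Nat.le_refl n))|].
    apply sum_n_le_Series; auto. }
  split; [now apply is_derive_PSeries|now apply ex_pseries_derive].
Qed.

(** The remainder is a polynomial in [z] and [h] with nonnegative coefficients, so its modulus is at
    most its value at the moduli. A recursion in [n], common to the real and complex forms, replaces
    the binomial expansion. *)
Lemma Cpow_increment_bound (z h : C) (n : nat) :
  Cmod ((z + h) ^ n - z ^ n - RtoC (INR n) * z ^ pred n * h)%C <=
  (Cmod z + Cmod h) ^ n - Cmod z ^ n - INR n * Cmod z ^ pred n * Cmod h.
Proof.
  assert (Hz := Cmod_ge_0 z). assert (Hh := Cmod_ge_0 h).
  induction n as [|n IH].
  - simpl. replace (1 - 1 - 0 * 1 * h)%C with (RtoC 0) by ring. rewrite Cmod_0. lra.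
  - assert (Hr : forall x y : R, (x + y) ^ S n - x ^ S n - INR (S n) * x ^ pred (S n) * y =
      (x + y) * ((x + y) ^ n - x ^ n - INR n * x ^ pred n * y) + INR n * x ^ pred n * y * y).
    { intros x y. rewrite S_INR. simpl pred. destruct n as [|n]; simpl; ring. }
    assert (Hc : ((z + h) ^ S n - z ^ S n - RtoC (INR (S n)) * z ^ pred (S n) * h)%C =
      ((z + h) * ((z + h) ^ n - z ^ n - RtoC (INR n) * z ^ pred n * h)
        + RtoC (INR n) * z ^ pred n * h * h)%C).
    { rewrite S_INR, RtoC_plus. simpl pred. destruct n as [|n]; rewrite ?Cpow_S; simpl; ring. }
    rewrite Hr, Hc. eapply Rle_trans; [apply Cmod_triangle|].
    apply Rplus_le_compat.
    + rewrite Cmod_mult. apply Rmult_le_compat; try apply Cmod_ge_0; [apply Cmod_triangle|easy].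
    + rewrite !Cmod_mult, Cmod_R, Rabs_pos_eq, Cmod_pow by apply pos_INR. lra.
Qed.

(* The second-order remainder of the power series at [z] is dominated termwise by that of
   the real series of moduli at [Cmod z]. *)
Lemma Cdiff_pseries (a : nat -> C) (f : C -> C) : summable_on_D a ->
  (forall z, inD z -> is_cseries (fun n => a n * z ^ n)%C (f z)) ->
  forall z, inD z -> Cdiff f z.
Proof.
  intros Ha Hf z Hz. unfold inD in Hz.
  set (b := fun n => Cmod (a n)). set (x := Cmod z).
  assert (Hx : 0 <= x < 1) by (split; [apply Cmod_ge_0|exact Hz]).
  destruct (is_series_power_rules b x (fun n => Cmod_ge_0 _) Ha Hx) as [Hd He].
  assert (Hb : is_series (fun n => b n * (INR n * x ^ pred n)) (PSeries (PS_derive b) x)).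
  { apply PSeries_correct, is_pseries_R in He.
    (* The term of index 0 vanishes through the factor [INR 0], so the shifted series of the
       derivative is the whole sum. *)
    apply is_series_decr_1.
    match goal with |- is_series _ ?m => replace m with (PSeries (PS_derive b) x)
      by (change (PSeries (PS_derive b) x =
            PSeries (PS_derive b) x + - (b O * (INR 0 * x ^ pred 0))); simpl; ring) end.
    revert He. apply is_series_ext. intro n.
    change (INR (S n) * b (S n) * x ^ n = b (S n) * (INR (S n) * x ^ n)). ring. }
  destruct (ex_cseries_le (fun n => a n * (RtoC (INR n) * z ^ pred n))%C
     (fun n => b n * (INR n * x ^ pred n))) as [l Hl].
  { intro n. rewrite !Cmod_mult, Cmod_R, Rabs_pos_eq, Cmod_pow by apply pos_INR.
    apply Rle_refl. }
  { eexists. exact Hb. }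
  exists l. intros eps Heps.
  destruct Hd as [_ Hd].
  destruct (Hd x (fun P HP => HP) (mkposreal eps Heps)) as [d Hdd].
  exists (Rmin d (1 - x)). split; [apply Rmin_pos; [apply cond_pos|lra]|].
  intros w Hw. set (h := (w - z)%C) in *.
  assert (Hw1 := Rlt_le_trans _ _ _ Hw (Rmin_l _ _)).
  assert (Hw2 := Rlt_le_trans _ _ _ Hw (Rmin_r _ _)).
  set (y := Cmod h) in *. assert (Hy : 0 <= y) by apply Cmod_ge_0.
  assert (Ew : w = (z + h)%C) by (unfold h; ring).
  assert (HwD : inD w).
  { unfold inD. rewrite Ew. eapply Rle_lt_trans; [apply Cmod_triangle|]. fold x y. lra. }
  assert (S1 : is_cseries (fun n => a n * ((z + h) ^ n - z ^ n - RtoC (INR n) * z ^ pred n * h))%C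
     (f w - f z - h * l)%C).
  { apply is_cseries_ext with (fun n => a n * w ^ n - a n * z ^ n
       - h * (a n * (RtoC (INR n) * z ^ pred n)))%C.
    - intro n. rewrite Ew. ring.
    - apply is_cseries_minus; [apply is_cseries_minus; auto|now apply is_cseries_scal]. }
  assert (S2 : is_series (fun n => b n * ((x + y) ^ n - x ^ n - INR n * x ^ pred n * y))
     (PSeries b (x + y) - PSeries b x - y * PSeries (PS_derive b) x)).
  { apply is_series_ext with (fun n => b n * (x + y) ^ n - b n * x ^ n
       - y * (b n * (INR n * x ^ pred n))).
    - intro n. match goal with |- ?u = ?v => change (@eq R u v) end. ring.
    - apply (@is_series_minus R_AbsRing R_NormedModule).
      + apply (@is_series_minus R_AbsRing R_NormedModule); apply Series_correct, Ha; lra.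
      + now apply (@is_series_scal R_AbsRing R_NormedModule). }
  rewrite (Cmult_comm l).
  eapply Rle_trans.
  - refine (is_cseries_Cmod_le _ _ _ _ _ S1 S2). intro n.
    rewrite Cmod_mult. apply Rmult_le_compat_l; [apply Cmod_ge_0|].
    apply Cpow_increment_bound.
  - assert (Hb1 : Rabs ((x + y) - x) < d) by (rewrite Rabs_pos_eq; lra).
    specialize (Hdd (x + y) Hb1).
    unfold norm, minus, plus, opp, scal in Hdd; simpl in Hdd.
    unfold mult, abs in Hdd; simpl in Hdd.
    replace (x + y + - x) with y in Hdd by ring.
    rewrite (Rabs_pos_eq y) in Hdd by easy.
    eapply Rle_trans; [apply Rle_abs|].
    unfold Rminus. exact Hdd.
Qed.

(** * Means over circles *)

Lemma ccont_plus (f g : R -> C) (t : R) :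
  ccont f t -> ccont g t -> ccont (fun s => f s + g s)%C t.
Proof.
  intros Hf Hg eps He.
  destruct (Hf (eps / 2)) as [d1 [Hd1 H1]]; [lra|].
  destruct (Hg (eps / 2)) as [d2 [Hd2 H2]]; [lra|].
  exists (Rmin d1 d2). split; [now apply Rmin_pos|]. intros s Hs.
  specialize (H1 s (Rlt_le_trans _ _ _ Hs (Rmin_l _ _))).
  specialize (H2 s (Rlt_le_trans _ _ _ Hs (Rmin_r _ _))).
  replace (f s + g s - (f t + g t))%C with ((f s - f t) + (g s - g t))%C by ring.
  eapply Rle_lt_trans; [apply Cmod_triangle|]. lra.
Qed.

Lemma ccont_mult (f g : R -> C) (t : R) :
  ccont f t -> ccont g t -> ccont (fun s => f s * g s)%C t.
Proof.
  intros Hf Hg eps He.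
  set (A := Cmod (f t)). set (B := Cmod (g t)).
  assert (HA : 0 <= A) by apply Cmod_ge_0. assert (HB : 0 <= B) by apply Cmod_ge_0.
  set (e := Rmin 1 (eps / (A + B + 2))).
  assert (He0 : 0 < e) by (apply Rmin_pos; [lra|apply Rdiv_lt_0_compat; lra]).
  assert (He1 : e <= 1) by apply Rmin_l.
  assert (He2 : e * (A + B + 2) <= eps).
  { apply Rle_trans with (eps / (A + B + 2) * (A + B + 2)); [|right; field; lra].
    apply Rmult_le_compat_r; [lra|apply Rmin_r]. }
  destruct (Hf e He0) as [d1 [Hd1 H1]]. destruct (Hg e He0) as [d2 [Hd2 H2]].
  exists (Rmin d1 d2). split; [now apply Rmin_pos|]. intros s Hs.
  specialize (H1 s (Rlt_le_trans _ _ _ Hs (Rmin_l _ _))).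
  specialize (H2 s (Rlt_le_trans _ _ _ Hs (Rmin_r _ _))).
  replace (f s * g s - f t * g t)%C with
    ((f s - f t) * (g s - g t) + f t * (g s - g t) + (f s - f t) * g t)%C by ring.
  eapply Rle_lt_trans; [apply Cmod_triangle|].
  eapply Rle_lt_trans; [apply Rplus_le_compat_r, Cmod_triangle|].
  rewrite !Cmod_mult. fold A B.
  assert (P1 := Cmod_ge_0 (f s - f t)%C). assert (P2 := Cmod_ge_0 (g s - g t)%C).
  assert (Cmod (f s - f t)%C * Cmod (g s - g t)%C <= e * 1)
    by (apply Rmult_le_compat; lra).
  assert (A * Cmod (g s - g t)%C <= A * e) by (apply Rmult_le_compat_l; lra).
  assert (Cmod (f s - f t)%C * B <= e * B) by (apply Rmult_le_compat_r; lra).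
  nra.
Qed.

Lemma ccont_const (c : C) (t : R) : ccont (fun _ => c) t.
Proof.
  intros eps He. exists 1. split; [lra|]. intros s _.
  replace (c - c)%C with (RtoC 0) by ring. now rewrite Cmod_0.
Qed.

Lemma ccont_conj (f : R -> C) (t : R) : ccont f t -> ccont (fun s => Cconj (f s)) t.
Proof.
  intros Hf eps He. destruct (Hf eps He) as [d [Hd H]]. exists d. split; [easy|].
  intros s Hs. rewrite <- Cminus_conj, Cmod_conj. auto.
Qed.

Lemma ccont_Re_continuous (f : R -> C) (t : R) : ccont f t -> continuous (fun s => Re (f s)) t.
Proof.
  intros H P [e HP]. destruct (H e (cond_pos e)) as [d [Hd Hs]].
  exists (mkposreal d Hd). intros s Hb. apply HP.
  specialize (Hs s Hb). eapply Rle_lt_trans; [|exact Hs].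
  eapply Rle_trans; [|apply re_le_Cmod]. unfold Cminus. rewrite re_plus, re_opp. apply Rle_refl.
Qed.

Lemma ccont_bounded (f : R -> C) (a b : R) : (forall t, a <= t <= b -> ccont f t) ->
  exists M, forall t, a <= t <= b -> Cmod (f t) <= M.
Proof.
  intro H. destruct (@bounded_continuity _ C_R_NormedModule f a b) as [M HM].
  - intros x Hx. now apply ccont_continuous, H.
  - exists M. intros t Ht. left. rewrite Cmod_norm. apply HM, Ht.
Qed.

Lemma CInt_ext (f g : R -> C) (a b : R) : (forall t, f t = g t) -> CInt f a b = CInt g a b.
Proof. intro H. apply (@RInt_ext C_R_CompleteNormedModule). intros; apply H. Qed.

Definition pt (r t : R) : C := (r * cos t, r * sin t).

Definition circ_cont (g : C -> C) (r : R) : Prop := forall t, ccont (fun t => g (pt r t)) t.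

Definition mean (g : C -> C) (r : R) : C :=
  (RtoC (/ (2 * PI)) * CInt (fun t => g (pt r t)) 0 (2 * PI))%C.

Lemma pt_cexp (r t : R) : 0 < r -> pt r t = cexp (ln r, t).
Proof. intro H. unfold pt, cexp. simpl. now rewrite exp_ln. Qed.

Lemma Cmod_pt (r t : R) : 0 < r -> Cmod (pt r t) = r.
Proof. intro H. rewrite pt_cexp, Cmod_cexp by easy. simpl. now apply exp_ln. Qed.

Lemma pt_neq_0 (r t : R) : 0 < r -> pt r t <> 0%C.
Proof. intro H. apply Cmod_gt_0. now rewrite Cmod_pt. Qed.

Lemma circ_cont_Cdiff (g : C -> C) (r : R) : 0 < r ->
  (forall z, Cmod z = r -> Cdiff g z) -> circ_cont g r.
Proof.
  intros Hr H t.
  assert (X : ccont (fun s => g (cexp (ln r, s))) t).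
  { apply (ccont_vertical (fun w => g (cexp w))). apply (Cdiff_comp g cexp).
    - apply H. rewrite Cmod_cexp. now apply exp_ln.
    - apply Cdiff_cexp. }
  intros eps He. destruct (X eps He) as [d [Hd Hs]]. exists d. split; [easy|].
  intros s Hds. rewrite !pt_cexp by easy. auto.
Qed.

Lemma two_PI_pos : 0 < 2 * PI.
Proof. assert (H := PI_RGT_0). lra. Qed.

Lemma mean_is_CInt (g : C -> C) (r : R) : circ_cont g r ->
  is_CInt (fun t => g (pt r t)) 0 (2 * PI) (RtoC (2 * PI) * mean g r)%C.
Proof.
  intro H. assert (P := two_PI_pos). unfold mean.
  rewrite Cmult_assoc, <- RtoC_mult, Rinv_r, Cmult_1_l by lra.
  apply CInt_correct; [lra|]. intros t _. apply H.
Qed.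

Lemma mean_unique (g : C -> C) (r : R) (l : C) :
  is_CInt (fun t => g (pt r t)) 0 (2 * PI) (RtoC (2 * PI) * l)%C -> mean g r = l.
Proof.
  intro H. assert (P := two_PI_pos). unfold mean. rewrite (CInt_unique _ _ _ _ H).
  now rewrite Cmult_assoc, <- RtoC_mult, Rinv_l, Cmult_1_l by lra.
Qed.

Lemma mean_ext (f g : C -> C) (r : R) : (forall t, f (pt r t) = g (pt r t)) -> mean f r = mean g r.
Proof. intro H. unfold mean. f_equal. now apply CInt_ext. Qed.

Lemma mean_plus (f g : C -> C) (r : R) : circ_cont f r -> circ_cont g r ->
  mean (fun z => f z + g z)%C r = (mean f r + mean g r)%C.
Proof.
  intros Hf Hg. apply mean_unique. rewrite Cmult_plus_distr_l.
  now apply is_CInt_plus; apply mean_is_CInt.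
Qed.

Lemma mean_scal (c : C) (f : C -> C) (r : R) : circ_cont f r ->
  mean (fun z => c * f z)%C r = (c * mean f r)%C.
Proof.
  intros Hf. apply mean_unique.
  replace (RtoC (2 * PI) * (c * mean f r))%C with (c * (RtoC (2 * PI) * mean f r))%C by ring.
  now apply is_CInt_scal, mean_is_CInt.
Qed.

Lemma mean_minus (f g : C -> C) (r : R) : circ_cont f r -> circ_cont g r ->
  mean (fun z => f z - g z)%C r = (mean f r - mean g r)%C.
Proof.
  intros Hf Hg. apply mean_unique.
  replace (RtoC (2 * PI) * (mean f r - mean g r))%C with
    (RtoC (2 * PI) * mean f r - RtoC (2 * PI) * mean g r)%C by ring.
  now apply is_CInt_minus; apply mean_is_CInt.
Qed.

Lemma mean_const (c : C) (r : R) : mean (fun _ => c) r = c.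
Proof.
  apply mean_unique. assert (H := is_CInt_const c 0 (2 * PI)).
  now rewrite Rminus_0_r in H.
Qed.

Lemma mean_conj (f : C -> C) (r : R) : circ_cont f r ->
  mean (fun z => Cconj (f z)) r = Cconj (mean f r).
Proof.
  intro Hf. apply mean_unique. assert (H := mean_is_CInt f r Hf).
  set (l := mean f r) in *.
  assert (Hr := is_CInt_Re _ _ _ _ H). assert (Hi := is_CInt_Im _ _ _ _ H).
  replace (RtoC (2 * PI) * Cconj l)%C with
    ((Re (RtoC (2 * PI) * l)%C, - Im (RtoC (2 * PI) * l)%C) : C).
  - apply is_CInt_pair; [exact Hr|]. now apply (@is_RInt_opp R_NormedModule).
  - unfold Cconj, RtoC, Cmult; simpl. f_equal; ring.
Qed.

Lemma Cmod_mean_le (f : C -> C) (r M : R) : circ_cont f r ->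
  (forall t, Cmod (f (pt r t)) <= M) -> Cmod (mean f r) <= M.
Proof.
  intros Hf H. assert (P := two_PI_pos).
  assert (X := Cmod_CInt_le_const _ M 0 (2 * PI) _ (Rlt_le _ _ P) (fun t _ => H t) (mean_is_CInt f r Hf)).
  rewrite Cmod_mult, Cmod_R, Rabs_pos_eq, Rminus_0_r in X by lra.
  now apply Rmult_le_reg_l in X.
Qed.

Lemma circ_cont_plus (f g : C -> C) (r : R) :
  circ_cont f r -> circ_cont g r -> circ_cont (fun z => f z + g z)%C r.
Proof. intros Hf Hg t. now apply (ccont_plus (fun t => f (pt r t)) (fun t => g (pt r t))). Qed.

Lemma circ_cont_mult (f g : C -> C) (r : R) :
  circ_cont f r -> circ_cont g r -> circ_cont (fun z => f z * g z)%C r.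
Proof. intros Hf Hg t. now apply (ccont_mult (fun t => f (pt r t)) (fun t => g (pt r t))). Qed.

Lemma circ_cont_const (c : C) (r : R) : circ_cont (fun _ => c) r.
Proof. intro t. apply ccont_const. Qed.

Lemma circ_cont_conj (f : C -> C) (r : R) :
  circ_cont f r -> circ_cont (fun z => Cconj (f z)) r.
Proof. intros Hf t. now apply (ccont_conj (fun t => f (pt r t))). Qed.

Lemma circ_cont_minus (f g : C -> C) (r : R) :
  circ_cont f r -> circ_cont g r -> circ_cont (fun z => f z - g z)%C r.
Proof.
  intros Hf Hg t.
  assert (H := circ_cont_plus f (fun z => (-1) * g z)%C r Hf
     (circ_cont_mult _ _ r (circ_cont_const _ r) Hg) t).
  intros eps He. destruct (H eps He) as [d [Hd Hs]]. exists d. split; [easy|].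
  intros s Hds. specialize (Hs s Hds).
  match type of Hs with Cmod ?u < _ => match goal with |- Cmod ?v < _ =>
    replace v with u by ring end end. exact Hs.
Qed.

Lemma Cdiff_pow (f : C -> C) (n : nat) (z : C) : Cdiff f z -> Cdiff (fun w => f w ^ n)%C z.
Proof.
  intro H. induction n as [|n IH]; simpl; [apply Cdiff_const|now apply Cdiff_mult].
Qed.

Lemma circ_cont_pow (n : nat) (r : R) : 0 < r -> circ_cont (fun z => z ^ n)%C r.
Proof.
  intro Hr. apply circ_cont_Cdiff; [easy|]. intros z _. apply Cdiff_pow, Cdiff_id.
Qed.

Lemma Cdiff_inv_pow (n : nat) (z : C) : z <> 0%C -> Cdiff (fun z => (/ z) ^ n)%C z.
Proof.
  intros Hz. apply (Cdiff_pow Cinv). now apply (Cdiff_inv (fun z => z)); [|apply Cdiff_id].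
Qed.

Lemma circ_cont_inv_pow (n : nat) (r : R) : 0 < r -> circ_cont (fun z => (/ z) ^ n)%C r.
Proof.
  intro Hr. apply circ_cont_Cdiff; [easy|]. intros z Hz. apply Cdiff_inv_pow.
  apply Cmod_gt_0. lra.
Qed.

(** The horizontal sides of the rectangle cancel by periodicity of [cexp], and the vertical ones are
    the two means. Only the punctured disk enters, so [g] may contain negative powers of [z]. *)
Lemma mean_radius_const (g : C -> C) (r1 r2 : R) : 0 < r1 <= r2 -> r2 < 1 ->
  (forall z, 0 < Cmod z < 1 -> Cdiff g z) -> mean g r1 = mean g r2.
Proof.
  intros H1 H2 Hg. assert (P := two_PI_pos).
  assert (HG := Goursat (fun w => g (cexp w)) (ln r1) (ln r2) 0 (2 * PI)).
  unfold rect_int in HG.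
  rewrite (CInt_ext (fun x => g (cexp (x, 2 * PI))) (fun x => g (cexp (x, 0)))) in HG.
  2: { intro t. unfold cexp; simpl. now rewrite cos_2PI, sin_2PI, cos_0, sin_0. }
  unfold mean. f_equal.
  rewrite (CInt_ext (fun t => g (pt r1 t)) (fun y => g (cexp (ln r1, y))))
    by (intro t; rewrite pt_cexp; [easy|lra]).
  rewrite (CInt_ext (fun t => g (pt r2 t)) (fun y => g (cexp (ln r2, y))))
    by (intro t; rewrite pt_cexp; [easy|lra]).
  set (I1 := CInt (fun y => g (cexp (ln r1, y))) 0 (2 * PI)) in *.
  set (I2 := CInt (fun y => g (cexp (ln r2, y))) 0 (2 * PI)) in *.
  assert (E : (Ci * (I2 - I1))%C = 0%C).
  { rewrite <- HG; [ring|apply ln_le; lra|lra|].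
    intros x y Hx Hy. apply (Cdiff_comp g cexp); [|apply Cdiff_cexp].
    apply Hg. rewrite Cmod_cexp. simpl. split; [apply exp_pos|].
    apply Rle_lt_trans with (exp (ln r2)); [|rewrite exp_ln; lra].
    destruct Hx as [_ [Hx|Hx]]; [left; now apply exp_increasing|right; now rewrite Hx]. }
  assert (E' : (I2 - I1)%C = 0%C).
  { replace (I2 - I1)%C with (- Ci * (Ci * (I2 - I1)))%C; [rewrite E; ring|].
    rewrite Cmult_assoc. replace (- Ci * Ci)%C with (RtoC 1); [ring|].
    unfold Ci, Cmult, Copp, RtoC; simpl. f_equal; ring. }
  symmetry. now apply Ceq_minus.
Qed.

(** The mean does not change when the circle shrinks, and continuity at 0 brings it arbitrarily
    close to [g 0]. *)
Lemma mean_value (g : C -> C) (r : R) : 0 < r < 1 ->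
  (forall z, inD z -> Cdiff g z) -> mean g r = g 0.
Proof.
  intros Hr Hg. apply Ceq_minus, Cmod_eq_0. apply Rle_antisym; [|apply Cmod_ge_0].
  apply le_epsilon. intros eps He. rewrite Rplus_0_l.
  assert (H0 : inD 0) by (unfold inD; rewrite Cmod_0; lra).
  destruct (Cder_continuous g 0 (Hg _ H0) eps He) as [d [Hd Hw]].
  set (s := Rmin r (d / 2)).
  assert (Hs : 0 < s) by (apply Rmin_pos; lra).
  assert (Hsr : s <= r) by apply Rmin_l. assert (Hsd : s <= d / 2) by apply Rmin_r.
  rewrite <- (mean_radius_const g s r); [|lra|lra|intros z Hz; apply Hg; apply Hz].
  assert (Hc : circ_cont g s) by (apply circ_cont_Cdiff; [lra|]; intros z Hz; apply Hg; unfold inD; lra).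
  rewrite <- (mean_const (g 0) s) at 1. rewrite <- mean_minus; [|easy|apply circ_cont_const].
  apply Cmod_mean_le; [apply circ_cont_minus; [easy|apply circ_cont_const]|].
  intro t. left. apply Hw. replace (pt s t - 0)%C with (pt s t) by ring. rewrite Cmod_pt; lra.
Qed.

Lemma Cpow_inv_cancel (z : C) (n k : nat) : z <> 0%C -> (k <= n)%nat ->
  (z ^ n * (/ z) ^ k)%C = (z ^ (n - k))%C.
Proof.
  intros Hz H. replace n with ((n - k) + k)%nat at 1 by lia.
  rewrite Cpow_add_r, <- Cmult_assoc, <- Cpow_mult_l, Cinv_r, Cpow_1_l by easy. ring.
Qed.

Lemma mean_pow (n : nat) (r : R) : 0 < r < 1 ->
  mean (fun z => z ^ n)%C r = if Nat.eqb n 0 then 1%C else 0%C.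
Proof.
  intro Hr. rewrite mean_value; [|easy|intros; apply Cdiff_pow, Cdiff_id].
  destruct n; simpl; [easy|ring].
Qed.

Lemma mean_inv_pow (n : nat) (r : R) : 0 < r < 1 ->
  mean (fun z => (/ z) ^ n)%C r = if Nat.eqb n 0 then 1%C else 0%C.
Proof.
  intro Hr.
  assert (Hn : r ^ 2 <> 0) by (apply pow_nonzero; lra).
  (* On the circle [1 / z] equals [Cconj z / r^2], which reduces inverse powers to conjugates of
     positive ones. *)
  rewrite (mean_ext _ (fun z => (RtoC (/ r ^ 2)) ^ n * Cconj (z ^ n)))%C.
  - rewrite mean_scal by (apply circ_cont_conj, circ_cont_pow; lra).
    rewrite mean_conj by (apply circ_cont_pow; lra). rewrite mean_pow by easy.
    destruct n; simpl; [|apply injective_projections; simpl; ring].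
    apply injective_projections; simpl; ring.
  - intro t. rewrite Cpow_conj, <- Cpow_mult_l. f_equal.
    assert (Hz : pt r t <> 0%C) by (apply pt_neq_0; lra).
    assert (E := Cmod2_conj (pt r t)). rewrite Cmod_pt in E by lra.
    rewrite RtoC_inv by easy. rewrite E.
    assert (Hc : Cconj (pt r t) <> 0%C).
    { apply Cmod_gt_0. rewrite Cmod_conj. apply Cmod_gt_0, Hz. }
    field. now split.
Qed.

Lemma mean_orthogonal (n k : nat) (r : R) : 0 < r < 1 ->
  mean (fun z => z ^ n * (/ z) ^ k)%C r = if Nat.eqb n k then 1%C else 0%C.
Proof.
  intro Hr. destruct (Nat.le_gt_cases k n) as [H|H].
  - rewrite (mean_ext _ (fun z => z ^ (n - k)))%C.
    + rewrite mean_pow by easy. destruct (Nat.eqb_spec n k), (Nat.eqb_spec (n - k) 0); easy || lia.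
    + intro t. apply Cpow_inv_cancel; [apply pt_neq_0; lra|easy].
  - rewrite (mean_ext _ (fun z => (/ z) ^ (k - n)))%C.
    + rewrite mean_inv_pow by easy. destruct (Nat.eqb_spec n k), (Nat.eqb_spec (k - n) 0); easy || lia.
    + intro t. assert (Hz : pt r t <> 0%C) by (apply pt_neq_0; lra).
      replace k with ((k - n) + n)%nat at 1 by lia.
      rewrite Cpow_add_r, Cmult_comm, <- Cmult_assoc, <- Cpow_mult_l, Cinv_l, Cpow_1_l by easy. ring.
Qed.

(** The Taylor coefficient in Cauchy's form. The radius [/ 2] is arbitrary: [mean_coef] allows any
    other in [(0, 1)]. *)
Definition coef (h : C -> C) (n : nat) : C := mean (fun z => h z * (/ z) ^ n)%C (/ 2).

Lemma mean_coef (h : C -> C) (n : nat) (r : R) : 0 < r < 1 ->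
  (forall z, inD z -> Cdiff h z) -> mean (fun z => h z * (/ z) ^ n)%C r = coef h n.
Proof.
  intros Hr Hh. unfold coef.
  assert (Hg : forall z, 0 < Cmod z < 1 -> Cdiff (fun z => h z * (/ z) ^ n)%C z).
  { intros z Hz. apply Cdiff_mult; [apply Hh, Hz|]. apply Cdiff_inv_pow, Cmod_gt_0, Hz. }
  destruct (Rle_lt_dec r (/ 2)).
  - apply mean_radius_const; [lra|lra|exact Hg].
  - symmetry. apply mean_radius_const; [lra|lra|exact Hg].
Qed.

Lemma circ_cont_on_D (h : C -> C) (r : R) : 0 < r < 1 ->
  (forall z, inD z -> Cdiff h z) -> circ_cont h r.
Proof.
  intros Hr Hh. apply circ_cont_Cdiff; [lra|]. intros z Hz. apply Hh. unfold inD. lra.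
Qed.

Lemma coef_bound (h : C -> C) (r M : R) (n : nat) : 0 < r < 1 ->
  (forall z, inD z -> Cdiff h z) -> (forall t, Cmod (h (pt r t)) <= M) ->
  Cmod (coef h n) * r ^ n <= M.
Proof.
  intros Hr Hh HM. assert (Hrn : 0 < r ^ n) by (apply pow_lt; lra).
  rewrite <- (mean_coef h n r Hr Hh).
  apply Rmult_le_reg_r with (/ r ^ n); [now apply Rinv_0_lt_compat|].
  rewrite Rmult_assoc, Rinv_r, Rmult_1_r by lra.
  apply Cmod_mean_le.
  - apply circ_cont_mult; [now apply circ_cont_on_D|apply circ_cont_inv_pow; lra].
  - intro t. rewrite Cmod_mult, Cmod_pow, Cmod_inv, Cmod_pt, pow_inv by (try apply pt_neq_0; lra).
    apply Rmult_le_compat_r; [|apply HM]. left. now apply Rinv_0_lt_compat.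
Qed.

Lemma pt_period (r t : R) (k : nat) : pt r (t + 2 * INR k * PI) = pt r t.
Proof. unfold pt. now rewrite cos_period, sin_period. Qed.

Lemma pt_mod (r t : R) : exists s, 0 <= s < 2 * PI /\ pt r t = pt r s.
Proof.
  assert (P := two_PI_pos).
  destruct (archimed (t / (2 * PI))) as [H1 H2].
  set (m := (up (t / (2 * PI)) - 1)%Z).
  exists (t - 2 * IZR m * PI).
  assert (E : t = t / (2 * PI) * (2 * PI)) by (field; lra).
  assert (Hm : IZR m <= t / (2 * PI) < IZR m + 1).
  { unfold m. rewrite minus_IZR. lra. }
  split.
  - set (q := t / (2 * PI)) in *. nra.
  (* Periodicity is stated for natural multiples of the period, so the sign of [m] decides which of
     the two points is shifted. *)
  - destruct (Z_le_gt_dec 0 m) as [Hz|Hz].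
    + rewrite <- (pt_period r (t - 2 * IZR m * PI) (Z.to_nat m)).
      f_equal. rewrite INR_IZR_INZ, Z2Nat.id by easy. ring.
    + rewrite <- (pt_period r t (Z.to_nat (- m))).
      f_equal. rewrite INR_IZR_INZ, Z2Nat.id, opp_IZR by lia. ring.
Qed.

Lemma circ_bounded (h : C -> C) (r : R) : circ_cont h r -> exists M, forall t, Cmod (h (pt r t)) <= M.
Proof.
  intro H. destruct (ccont_bounded (fun t => h (pt r t)) 0 (2 * PI)) as [M HM].
  - intros t _. apply H.
  - exists M. intro t. destruct (pt_mod r t) as [s [Hs ->]]. apply HM. lra.
Qed.

Lemma coef_summable (h : C -> C) : (forall z, inD z -> Cdiff h z) -> summable_on_D (coef h).
Proof.
  intros Hh s Hs. set (r := (1 + s) / 2). assert (Hr : 0 < r < 1) by (unfold r; lra).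
  destruct (circ_bounded h r (circ_cont_on_D h r Hr Hh)) as [M HM].
  apply ex_series_nonneg_le with (fun n => M * (s / r) ^ n).
  - intro n. split; [apply Rmult_le_pos; [apply Cmod_ge_0|apply pow_le; lra]|].
    assert (X := coef_bound h r M n Hr Hh HM).
    assert (Hrn : 0 < r ^ n) by (apply pow_lt; lra).
    unfold Rdiv. rewrite Rpow_mult_distr, pow_inv.
    replace (Cmod (coef h n) * s ^ n) with (Cmod (coef h n) * r ^ n * (s ^ n * / r ^ n))
      by (field; lra).
    apply Rmult_le_compat_r; [|easy].
    apply Rmult_le_pos; [apply pow_le; lra|]. left; now apply Rinv_0_lt_compat.
  - apply (@ex_series_scal R_AbsRing R_NormedModule). apply ex_series_geom.
    assert (0 <= s / r) by (apply Rmult_le_pos; [lra|]; left; apply Rinv_0_lt_compat; lra).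
    rewrite Rabs_pos_eq by easy.
    apply Rmult_lt_reg_r with r; [lra|]. unfold Rdiv. rewrite Rmult_assoc, Rinv_l by lra.
    unfold r. lra.
Qed.

Lemma cos_le_away (d x : R) : 0 <= d <= PI -> d <= Rabs x <= 2 * PI - d -> cos x <= cos d.
Proof.
  intros Hd Hx.
  assert (E : cos x = cos (Rabs x)).
  { unfold Rabs. destruct (Rcase_abs x); [now rewrite cos_neg|easy]. }
  rewrite E. set (y := Rabs x) in *.
  destruct (Rle_lt_dec y PI) as [H|H].
  - apply cos_decr_1; lra.
  - replace (cos y) with (cos (2 * PI - y)).
    + apply cos_decr_1; lra.
    + rewrite cos_minus, cos_2PI, sin_2PI. ring.
Qed.

Lemma is_RInt_const_R (c a b : R) : is_RInt (fun _ => c) a b (c * (b - a)).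
Proof. rewrite Rmult_comm. exact (@is_RInt_const R_NormedModule a b c). Qed.

(* The powers of the kernel [(1 + cos (t - t0)) / 2] concentrate at [t0]. *)
Lemma peak_kernel (U : R -> R) (t0 : R) : 0 < t0 < 2 * PI -> (forall t, continuous U t) ->
  (forall N : nat, is_RInt (fun t => U t * ((1 + cos (t - t0)) / 2) ^ N) 0 (2 * PI) 0) ->
  U t0 <= 0.
Proof.
  intros Ht0 HU HI. apply Rnot_lt_le. intro Hpos.
  set (kap := fun t => (1 + cos (t - t0)) / 2).
  assert (Hk : forall t, 0 <= kap t <= 1).
  { intro t. unfold kap. assert (X := COS_bound (t - t0)). lra. }
  destruct (@bounded_continuity _ R_NormedModule U 0 (2 * PI)) as [B HB]; [intros; apply HU|].
  assert (HB' : forall t, 0 <= t <= 2 * PI -> Rabs (U t) <= B) by (intros t Ht; left; now apply HB).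
  assert (B0 : 0 <= B).
  { eapply Rle_trans; [apply Rabs_pos|apply (HB' 0)]. lra. }
  assert (Hhalf : 0 < U t0 / 2) by lra.
  assert (Hnear : exists d, 0 < d /\ forall t, Rabs (t - t0) < d -> U t0 / 2 < U t).
  { destruct (proj1 (@filterlim_locally R R_UniformSpace (locally t0) _ U (U t0)) (HU t0)
      (mkposreal _ Hhalf)) as [d Hd].
    exists d. split; [apply cond_pos|]. intros t Ht.
    assert (X := Hd t Ht). change (Rabs (U t - U t0) < U t0 / 2) in X.
    apply Rabs_def2 in X. lra. }
  destruct Hnear as [d0 [Hd0 Hnear]].
  (* The window around [t0] stays inside [[0, 2 PI]], so no point of the interval outside it comes
     close to [t0] modulo the period. *)
  set (d := Rmin d0 (Rmin t0 (2 * PI - t0))).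
  assert (Hd : 0 < d) by (repeat apply Rmin_pos; lra).
  assert (Hdd : d <= d0) by apply Rmin_l.
  assert (Hd' : d <= Rmin t0 (2 * PI - t0)) by apply Rmin_r.
  assert (Hd1 : d <= t0) by (eapply Rle_trans; [exact Hd'|apply Rmin_l]).
  assert (Hd2 : d <= 2 * PI - t0) by (eapply Rle_trans; [exact Hd'|apply Rmin_r]).
  (* The kernel is at least [q1] within distance [d / 2] of [t0] and at most [q2 < q1] beyond
     distance [d]; in between only the positivity of [U] is used. A vanishing integral then forces
     [q1^N] to be at most a constant times [q2^N], which fails for large [N]. *)
  set (q1 := (1 + cos (d / 2)) / 2). set (q2 := (1 + cos d) / 2).
  assert (Hq : q2 < q1).
  { unfold q1, q2. assert (cos d < cos (d / 2)) by (apply cos_decreasing_1; lra). lra. }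
  assert (Hq2 : 0 <= q2) by (unfold q2; assert (X := COS_bound d); lra).
  assert (Hfar : forall t, 0 <= t <= 2 * PI -> d <= Rabs (t - t0) -> kap t <= q2).
  { intros t Ht Hdt. unfold kap, q2. assert (cos (t - t0) <= cos d).
    { apply cos_le_away; [lra|]. split; [easy|]. apply Rabs_le. lra. }
    lra. }
  assert (Hclose : forall t, Rabs (t - t0) <= d / 2 -> q1 <= kap t).
  { intros t Hdt. unfold kap, q1.
    assert (E : cos (t - t0) = cos (Rabs (t - t0))).
    { unfold Rabs. destruct (Rcase_abs (t - t0)); [now rewrite cos_neg|easy]. }
    rewrite E. assert (X := Rabs_pos (t - t0)).
    assert (cos (d / 2) <= cos (Rabs (t - t0))) by (apply cos_decr_1; lra). lra. }
  assert (Hlow : forall N, d * (U t0 / 2 * q1 ^ N) <= 2 * PI * (B * q2 ^ N)).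
  { intro N. set (f := fun t => U t * kap t ^ N).
    assert (Hf : forall t, continuous f t).
    { intro t. apply (continuous_mult U (fun t => kap t ^ N) t); [apply HU|].
      apply (ex_derive_continuous (fun t => kap t ^ N)). unfold kap. auto_derive. easy. }
    assert (Ef : forall a b, is_RInt f a b (RInt f a b)).
    { intros a b. apply (@RInt_correct R_CompleteNormedModule).
      apply (@ex_RInt_continuous R_CompleteNormedModule). intros; apply Hf. }
    assert (Hout : forall t, 0 <= t <= 2 * PI -> - (B * q2 ^ N) <= f t).
    { intros t Ht. unfold f.
      assert (K0 : 0 <= kap t ^ N) by (apply pow_le, Hk).
      assert (Q0 : 0 <= q2 ^ N) by now apply pow_le.
      destruct (Rlt_dec (Rabs (t - t0)) d) as [H|H].
      - assert (X := Hnear t ltac:(lra)). nra.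
      - assert (K1 : kap t ^ N <= q2 ^ N).
        { apply pow_incr. split; [apply Hk|]. apply Hfar; lra. }
        assert (X := HB' t Ht). assert (Y := Rle_abs (- U t)). rewrite Rabs_Ropp in Y.
        assert (- U t * kap t ^ N <= B * q2 ^ N).
        { apply Rle_trans with (B * kap t ^ N); [apply Rmult_le_compat_r; lra|].
          now apply Rmult_le_compat_l. }
        lra. }
    assert (J1 : - (B * q2 ^ N) * (t0 - d / 2 - 0) <= RInt f 0 (t0 - d / 2)).
    { apply (is_RInt_le (fun _ => - (B * q2 ^ N)) f 0 (t0 - d / 2)); [lra| |apply Ef|].
      - apply is_RInt_const_R.
      - intros x Hx. apply Hout. lra. }
    assert (J2 : U t0 / 2 * q1 ^ N * (t0 + d / 2 - (t0 - d / 2)) <=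
       RInt f (t0 - d / 2) (t0 + d / 2)).
    { apply (is_RInt_le (fun _ => U t0 / 2 * q1 ^ N) f (t0 - d / 2) (t0 + d / 2)); [lra| |apply Ef|].
      - apply is_RInt_const_R.
      - intros x Hx. unfold f.
        assert (Hx' : Rabs (x - t0) <= d / 2) by (apply Rabs_le; lra).
        apply Rmult_le_compat; [lra|apply pow_le; lra| |].
        + left. apply Hnear. lra.
        + apply pow_incr. split; [lra|now apply Hclose]. }
    assert (J3 : - (B * q2 ^ N) * (2 * PI - (t0 + d / 2)) <= RInt f (t0 + d / 2) (2 * PI)).
    { apply (is_RInt_le (fun _ => - (B * q2 ^ N)) f (t0 + d / 2) (2 * PI)); [lra| |apply Ef|].
      - apply is_RInt_const_R.
      - intros x Hx. apply Hout. lra. }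
    assert (E : RInt f 0 (t0 - d / 2) + RInt f (t0 - d / 2) (t0 + d / 2) +
       RInt f (t0 + d / 2) (2 * PI) = 0).
    { transitivity (RInt f 0 (2 * PI)).
      - symmetry. apply (@is_RInt_unique R_CompleteNormedModule).
        apply (@is_RInt_Chasles R_NormedModule) with (t0 + d / 2); [|apply Ef].
        apply (@is_RInt_Chasles R_NormedModule) with (t0 - d / 2); apply Ef.
      - apply (@is_RInt_unique R_CompleteNormedModule). exact (HI N). }
    assert (Q0 : 0 <= B * q2 ^ N) by (apply Rmult_le_pos; [lra|now apply pow_le]).
    nra. }
  assert (Hq1 : 0 < q1) by lra.
  set (c := d * (U t0 / 2)). assert (Hc : 0 < c) by (apply Rmult_lt_0_compat; lra).
  assert (P := two_PI_pos).
  assert (Hy : 0 < c / (2 * PI * B + 1)) by (apply Rdiv_lt_0_compat; [easy|]; nra).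
  assert (Hx : Rabs (q2 / q1) < 1).
  { rewrite Rabs_pos_eq.
    - apply Rmult_lt_reg_r with q1; [easy|]. unfold Rdiv. rewrite Rmult_assoc, Rinv_l; lra.
    - apply Rmult_le_pos; [easy|]. left; now apply Rinv_0_lt_compat. }
  destruct (pow_lt_1_zero _ Hx _ Hy) as [N HN]. specialize (HN N (Nat.le_refl N)).
  specialize (Hlow N).
  assert (Q1 : 0 < q1 ^ N) by now apply pow_lt.
  assert (E : (q2 / q1) ^ N = q2 ^ N / q1 ^ N).
  { unfold Rdiv. now rewrite Rpow_mult_distr, pow_inv. }
  rewrite E, Rabs_pos_eq in HN.
  2: { apply Rmult_le_pos; [now apply pow_le|]. left; now apply Rinv_0_lt_compat. }
  set (x := q2 ^ N / q1 ^ N) in *.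
  assert (Ex : q2 ^ N = x * q1 ^ N) by (unfold x; field; lra).
  rewrite Ex in Hlow.
  assert (X : c <= 2 * PI * B * x).
  { apply Rmult_le_reg_r with (q1 ^ N); [easy|]. unfold c. lra. }
  assert (Y : x * (2 * PI * B + 1) < c).
  { apply Rmult_lt_reg_r with (/ (2 * PI * B + 1)); [apply Rinv_0_lt_compat; nra|].
    rewrite Rmult_assoc, Rinv_r, Rmult_1_r by nra. exact HN. }
  assert (0 <= x).
  { apply Rmult_le_pos; [now apply pow_le|]. left; now apply Rinv_0_lt_compat. }
  nra.
Qed.

(** * Holomorphic functions are power series *)

Lemma polar (z : C) : z <> 0%C -> exists t, z = pt (Cmod z) t.
Proof.
  intro Hz. apply Cmod_gt_0 in Hz. destruct z as [x y]. set (r := Cmod (x, y)) in *.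
  assert (E : r ^ 2 = x ^ 2 + y ^ 2) by apply (Cmod2_alt (x, y)).
  assert (Hx : -1 <= x / r <= 1).
  { assert (Rabs x <= r) by apply (re_le_Cmod (x, y)). apply Rabs_le_between in H.
    split; apply Rmult_le_reg_r with r; try easy; unfold Rdiv; rewrite Rmult_assoc, Rinv_l; lra. }
  assert (S : sqrt (1 - (x / r)²) = Rabs y / r).
  { replace (1 - (x / r)²) with ((Rabs y / r)²).
    - apply sqrt_Rsqr. apply Rmult_le_pos; [apply Rabs_pos|]. left; now apply Rinv_0_lt_compat.
    - rewrite !Rsqr_div', <- Rsqr_abs. unfold Rsqr.
      replace (y * y) with (r * r - x * x) by nra. field. lra. }
  destruct (Rle_lt_dec 0 y) as [Hy|Hy].
  - exists (acos (x / r)). unfold pt.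
    rewrite cos_acos, sin_acos, S, Rabs_pos_eq by easy. f_equal; field; lra.
  - exists (- acos (x / r)). unfold pt.
    rewrite cos_neg, sin_neg, cos_acos, sin_acos, S, Rabs_left by easy. f_equal; field; lra.
Qed.

Definition fourier_null (r : R) (e : C -> C) : Prop :=
  circ_cont e r /\ forall k,
    mean (fun z => e z * z ^ k)%C r = 0%C /\ mean (fun z => e z * (/ z) ^ k)%C r = 0%C.

(** On the circle through [z0] this is [cos^2 ((t - t0) / 2)]. Being a Laurent polynomial with
    frequencies -1, 0, 1, it preserves the vanishing of all Fourier coefficients under
    multiplication. *)
Definition kernel (z0 z : C) : C :=
  (RtoC (/ 2) + RtoC (/ 4) * / z0 * z + RtoC (/ 4) * z0 * / z)%C.

Lemma kernel_pt (r t0 t : R) : 0 < r ->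
  kernel (pt r t0) (pt r t) = RtoC ((1 + cos (t - t0)) / 2).
Proof.
  intro Hr. rewrite !pt_cexp by easy. unfold kernel.
  rewrite <- !cexp_opp, <- !Cmult_assoc, <- !cexp_plus.
  rewrite cos_minus. unfold cexp, RtoC, Cmult, Cplus, Copp; simpl.
  replace (- ln r + ln r) with 0 by ring. replace (ln r + - ln r) with 0 by ring.
  rewrite exp_0, !cos_plus, !sin_plus, !cos_neg, !sin_neg. f_equal; field.
Qed.

Lemma fourier_null_kernel (r t0 : R) (e : C -> C) : 0 < r ->
  fourier_null r e -> fourier_null r (fun z => e z * kernel (pt r t0) z)%C.
Proof.
  intros Hr [Hc He]. set (z0 := pt r t0).
  assert (HK : circ_cont (kernel z0) r).
  { apply circ_cont_Cdiff; [easy|]. intros z Hz. unfold kernel.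
    repeat apply Cdiff_plus; try apply Cdiff_const; apply Cdiff_mult; try apply Cdiff_const.
    - apply Cdiff_id.
    - apply (Cdiff_inv (fun z => z)); [apply Cmod_gt_0; lra|apply Cdiff_id]. }
  split; [now apply circ_cont_mult|].
  assert (Hpow : forall k, circ_cont (fun z => e z * z ^ k)%C r)
    by (intro; apply circ_cont_mult; [easy|now apply circ_cont_pow]).
  assert (Hinv : forall k, circ_cont (fun z => e z * (/ z) ^ k)%C r)
    by (intro; apply circ_cont_mult; [easy|now apply circ_cont_inv_pow]).
  assert (Hcomb : forall c1 c2 c3 (f1 f2 f3 : C -> C),
    circ_cont f1 r -> circ_cont f2 r -> circ_cont f3 r ->
    mean f1 r = 0%C -> mean f2 r = 0%C -> mean f3 r = 0%C ->
    mean (fun z => c1 * f1 z + c2 * f2 z + c3 * f3 z)%C r = 0%C).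
  { intros c1 c2 c3 f1 f2 f3 C1 C2 C3 M1 M2 M3.
    assert (S : forall c f, circ_cont f r -> circ_cont (fun z => c * f z)%C r)
      by (intros; apply circ_cont_mult; [apply circ_cont_const|easy]).
    rewrite (mean_plus (fun z => c1 * f1 z + c2 * f2 z)%C), (mean_plus (fun z => c1 * f1 z)%C),
      !mean_scal; auto; [|now apply circ_cont_plus; auto].
    rewrite M1, M2, M3. ring. }
  intro k. split.
  (* Frequency 0 is separate because a shift by one leads from powers of [z] to powers of [/ z]. *)
  - destruct k as [|k].
    + rewrite (mean_ext _ (fun z => RtoC (/ 2) * (e z * z ^ 0) + (RtoC (/ 4) * / z0) * (e z * z ^ 1)
        + (RtoC (/ 4) * z0) * (e z * (/ z) ^ 1))%C).
      exact (Hcomb _ _ _ _ _ _ (Hpow (0%nat)) (Hpow (1%nat)) (Hinv (1%nat))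
        (proj1 (He (0%nat))) (proj1 (He (1%nat))) (proj2 (He (1%nat)))).
      intro t. unfold kernel. simpl. ring.
    + rewrite (mean_ext _ (fun z => RtoC (/ 2) * (e z * z ^ S k)
        + (RtoC (/ 4) * / z0) * (e z * z ^ S (S k)) + (RtoC (/ 4) * z0) * (e z * z ^ k))%C).
      exact (Hcomb _ _ _ _ _ _ (Hpow (S k)) (Hpow (S (S k))) (Hpow (k))
        (proj1 (He (S k))) (proj1 (He (S (S k)))) (proj1 (He (k)))).
      intro t. unfold kernel. rewrite !Cpow_S. field; split; apply pt_neq_0; easy.
  - destruct k as [|k].
    + rewrite (mean_ext _ (fun z => RtoC (/ 2) * (e z * z ^ 0) + (RtoC (/ 4) * / z0) * (e z * z ^ 1)
        + (RtoC (/ 4) * z0) * (e z * (/ z) ^ 1))%C).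
      exact (Hcomb _ _ _ _ _ _ (Hpow (0%nat)) (Hpow (1%nat)) (Hinv (1%nat))
        (proj1 (He (0%nat))) (proj1 (He (1%nat))) (proj2 (He (1%nat)))).
      intro t. unfold kernel. simpl. ring.
    + rewrite (mean_ext _ (fun z => RtoC (/ 2) * (e z * (/ z) ^ S k)
        + (RtoC (/ 4) * / z0) * (e z * (/ z) ^ k)
        + (RtoC (/ 4) * z0) * (e z * (/ z) ^ S (S k)))%C).
      exact (Hcomb _ _ _ _ _ _ (Hinv (S k)) (Hinv (k)) (Hinv (S (S k)))
        (proj2 (He (S k))) (proj2 (He (k))) (proj2 (He (S (S k))))).
      intro t. unfold kernel. rewrite !Cpow_S. field; split; apply pt_neq_0; easy.
Qed.

Lemma fourier_null_peak (r t0 : R) (e : C -> C) (N : nat) : 0 < r -> fourier_null r e ->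
  fourier_null r (fun z => e z * kernel (pt r t0) z ^ N)%C.
Proof.
  intros Hr He. induction N as [|N IH].
  - simpl. destruct He as [Hc He]. split.
    + apply circ_cont_mult; [easy|apply circ_cont_const].
    + intro k. rewrite (mean_ext _ (fun z => e z * z ^ k)%C) by (intro; ring).
      rewrite (mean_ext (fun z => e z * 1 * (/ z) ^ k)%C (fun z => e z * (/ z) ^ k)%C)
        by (intro; ring). apply He.
  - destruct (fourier_null_kernel r t0 _ Hr IH) as [Hc Hk].
    split.
    + intro t. assert (X := Hc t). intros eps Heps. destruct (X eps Heps) as [d [Hd Hs]].
      exists d. split; [easy|]. intros s Hds. specialize (Hs s Hds). simpl in *.
      match type of Hs with Cmod ?u < _ => match goal with |- Cmod ?v < _ =>
        replace v with u by ring end end. exact Hs.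
    + intro k. rewrite (mean_ext _ (fun z => e z * kernel (pt r t0) z ^ N * kernel (pt r t0) z * z ^ k)%C)
        by (intro; rewrite Cpow_S; ring).
      rewrite (mean_ext (fun z => e z * kernel (pt r t0) z ^ S N * (/ z) ^ k)%C
        (fun z => e z * kernel (pt r t0) z ^ N * kernel (pt r t0) z * (/ z) ^ k)%C)
        by (intro; rewrite Cpow_S; ring). apply Hk.
Qed.

(** Multiplying [e] by the conjugate of its value at [t0] makes the real part there equal to
    [|e|^2], which [peak_kernel] bounds by 0. The endpoint [t = 0], not covered by [peak_kernel],
    follows by continuity. *)
Lemma fourier_uniqueness (r : R) (e : C -> C) : 0 < r -> fourier_null r e ->
  forall t, e (pt r t) = 0%C.
Proof.
  intros Hr He. assert (P := two_PI_pos).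
  assert (Hin : forall t, 0 < t < 2 * PI -> e (pt r t) = 0%C).
  { intros t0 Ht0. apply Cmod_eq_0.
    set (c := Cconj (e (pt r t0))).
    assert (HU : Re (c * e (pt r t0))%C <= 0).
    { apply (peak_kernel (fun t => Re (c * e (pt r t))%C) t0 Ht0).
      - intro t. apply (ccont_Re_continuous (fun t => c * e (pt r t))%C).
        apply ccont_mult; [apply ccont_const|apply He].
      - intro N. destruct (fourier_null_peak r t0 e N Hr He) as [Hc Hm].
        assert (M := proj1 (Hm O)). simpl in M.
        rewrite (mean_ext _ (fun z => e z * kernel (pt r t0) z ^ N)%C) in M by (intro; ring).
        assert (X := is_CInt_scal _ c _ _ _ (mean_is_CInt _ _ Hc)).
        rewrite M in X. replace (c * (RtoC (2 * PI) * 0))%C with (RtoC 0) in X by ring.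
        apply is_CInt_Re in X. rewrite re_RtoC in X. revert X. apply is_RInt_ext.
        intros t _. rewrite kernel_pt by easy. rewrite <- RtoC_pow.
        rewrite Cmult_assoc, re_scal_r. easy. }
    unfold c in HU. rewrite Cmult_comm, <- Cmod2_conj in HU.
    change (Cmod (e (pt r t0)) ^ 2 <= 0) in HU.
    assert (X := Cmod_ge_0 (e (pt r t0))). nra. }
  assert (H0 : e (pt r 0) = 0%C).
  { apply Cmod_eq_0. apply Rle_antisym; [|apply Cmod_ge_0].
    apply le_epsilon. intros eps Heps. rewrite Rplus_0_l.
    destruct (proj1 He 0 eps Heps) as [d [Hd Hs]].
    set (s := Rmin (d / 2) PI). assert (Pp := PI_RGT_0).
    assert (S0 : 0 < s) by (apply Rmin_pos; lra).
    assert (S1 : s <= d / 2) by apply Rmin_l. assert (S2 : s <= PI) by apply Rmin_r.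
    specialize (Hs s). rewrite (Hin s) in Hs by lra. rewrite Cmod_minus_sym in Hs.
    replace (e (pt r 0) - 0)%C with (e (pt r 0)) in Hs by ring.
    left. apply Hs. rewrite Rabs_pos_eq; lra. }
  intro t. destruct (pt_mod r t) as [s [Hs ->]].
  destruct (Req_dec s 0) as [->|Hn]; [easy|]. apply Hin. lra.
Qed.

Lemma csum_scal_r (a : nat -> C) (c : C) (n : nat) :
  (csum a n * c)%C = csum (fun k => a k * c)%C n.
Proof.
  induction n as [|n IH]; [now rewrite !csum_0|]. rewrite !csum_S, <- IH. ring.
Qed.

Lemma circ_cont_csum (a : nat -> C -> C) (r : R) (n : nat) :
  (forall k, circ_cont (a k) r) -> circ_cont (fun z => csum (fun k => a k z) n) r.
Proof.
  intro H. induction n as [|n IH]; intro t.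
  - intros eps He. destruct (H O t eps He) as [d [Hd Hs]]. exists d. split; [easy|].
    intros s Hds. rewrite !csum_0. auto.
  - intros eps He. destruct (circ_cont_plus _ _ _ IH (H (S n)) t eps He) as [d [Hd Hs]].
    exists d. split; [easy|]. intros s Hds. rewrite !csum_S. auto.
Qed.

Lemma mean_csum (a : nat -> C -> C) (r : R) (n : nat) :
  (forall k, circ_cont (a k) r) ->
  mean (fun z => csum (fun k => a k z) n) r = csum (fun k => mean (a k) r) n.
Proof.
  intro H. induction n as [|n IH].
  - rewrite csum_0. apply mean_ext. intro t. now rewrite csum_0.
  - rewrite csum_S, <- IH, <- mean_plus; [|now apply circ_cont_csum|easy].
    apply mean_ext. intro t. now rewrite csum_S.
Qed.

Lemma csum_single (c : nat -> C) (k n : nat) : (k <= n)%nat ->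
  csum (fun j => c j * (if Nat.eqb j k then 1 else 0))%C n = c k.
Proof.
  intro H.
  assert (Hz : forall m, (m < k)%nat -> csum (fun j => c j * (if Nat.eqb j k then 1 else 0))%C m = 0%C).
  { intros m Hm. induction m as [|m IH].
    - rewrite csum_0. destruct (Nat.eqb_spec 0 k); [lia|ring].
    - rewrite csum_S, IH by lia. destruct (Nat.eqb_spec (S m) k); [lia|ring]. }
  induction H as [|n Hn IH].
  - destruct k as [|k]; [rewrite csum_0; simpl; ring|].
    rewrite csum_S, Hz, Nat.eqb_refl by lia. ring.
  - rewrite csum_S, IH. destruct (Nat.eqb_spec (S n) k); [lia|ring].
Qed.

Lemma power_series_sum (c : nat -> C) : summable_on_D c ->
  exists f : C -> C, forall z, inD z -> is_cseries (fun n => c n * z ^ n)%C (f z).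
Proof.
  intro Hc.
  exists (fun z => epsilon (inhabits (RtoC 0)) (fun l => is_cseries (fun n => c n * z ^ n)%C l)).
  intros z Hz. apply epsilon_spec.
  apply ex_cseries_le with (fun n => Cmod (c n) * Cmod z ^ n).
  - intro n. rewrite Cmod_mult, Cmod_pow. apply Rle_refl.
  - apply Hc. split; [apply Cmod_ge_0|exact Hz].
Qed.

Lemma mean_power_series (c : nat -> C) (f : C -> C) (r : R) (k : nat) : 0 < r < 1 ->
  summable_on_D c -> (forall z, inD z -> is_cseries (fun n => c n * z ^ n)%C (f z)) ->
  mean (fun z => f z * (/ z) ^ k)%C r = c k.
Proof.
  intros Hr Hc Hf.
  assert (Hfd := Cdiff_pseries c f Hc Hf).
  assert (Hfc := circ_cont_on_D f r Hr Hfd).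
  set (b := fun n => Cmod (c n) * r ^ n).
  assert (Hb : ex_series b) by (apply Hc; lra).
  assert (Hb0 : forall n, 0 <= b n).
  { intro n. apply Rmult_le_pos; [apply Cmod_ge_0|apply pow_le; lra]. }
  apply Ceq_minus, Cmod_eq_0. apply Rle_antisym; [|apply Cmod_ge_0].
  apply le_epsilon. intros eps He. rewrite Rplus_0_l.
  assert (Hrk : 0 < r ^ k) by (apply pow_lt; lra).
  (* The factor [r^k] compensates the division by [z^k]; the cut-off is then raised by [k] so that
     the partial sum contains the term of index [k]. *)
  destruct (Series_tail_small b (eps * r ^ k) Hb0 Hb) as [N HN].
  { now apply Rmult_lt_0_compat. }
  set (M := (N + k)%nat). specialize (HN M ltac:(unfold M; lia)).
  assert (Hterm : forall j, circ_cont (fun z => c j * z ^ j * (/ z) ^ k)%C r).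
  { intro j. apply circ_cont_mult; [|apply circ_cont_inv_pow; lra].
    apply circ_cont_mult; [apply circ_cont_const|apply circ_cont_pow; lra]. }
  assert (E : c k = mean (fun z => csum (fun j => c j * z ^ j * (/ z) ^ k)%C M) r).
  { rewrite mean_csum by easy. rewrite <- (csum_single c k M) by (unfold M; lia).
    unfold csum. apply (sum_n_ext (G := C_AbelianMonoid)). intro j.
    rewrite (mean_ext _ (fun z => c j * (z ^ j * (/ z) ^ k)))%C by (intro; ring).
    rewrite mean_scal, mean_orthogonal; [easy|easy|].
    apply circ_cont_mult; [apply circ_cont_pow|apply circ_cont_inv_pow]; lra. }
  rewrite E. rewrite <- mean_minus.
  2: { apply circ_cont_mult; [easy|apply circ_cont_inv_pow; lra]. }
  2: { now apply circ_cont_csum. }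
  apply Cmod_mean_le.
  { apply circ_cont_minus; [|now apply circ_cont_csum].
    apply circ_cont_mult; [easy|apply circ_cont_inv_pow; lra]. }
  intro t. rewrite <- csum_scal_r. set (z := pt r t).
  assert (Hz : Cmod z = r) by (apply Cmod_pt; lra).
  replace (f z * (/ z) ^ k - csum (fun j => c j * z ^ j) M * (/ z) ^ k)%C with
    ((f z - csum (fun j => c j * z ^ j) M) * (/ z) ^ k)%C by ring.
  rewrite Cmod_mult, Cmod_pow, Cmod_inv, Hz, pow_inv by (apply pt_neq_0; lra).
  assert (HzD : inD z) by (unfold inD; lra).
  assert (T := is_cseries_tail_le (fun j => c j * z ^ j)%C b (f z) M).
  apply Rmult_le_reg_r with (r ^ k); [easy|]. rewrite Rmult_assoc, Rinv_l, Rmult_1_r by lra.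
  eapply Rle_trans; [apply T|lra]; auto.
  intro n. unfold b. rewrite Cmod_mult, Cmod_pow, Hz. apply Rle_refl.
Qed.

Lemma is_cseries_at_0 (c : nat -> C) : is_cseries (fun n => c n * 0 ^ n)%C (c O).
Proof.
  apply is_cseries_eps. intros eps He. exists O. intros n _.
  replace (csum (fun n => c n * 0 ^ n)%C n) with (c O).
  - replace (c O - c O)%C with (RtoC 0) by ring. now rewrite Cmod_0.
  - induction n as [|n IH]; [rewrite csum_0; simpl; ring|].
    rewrite csum_S, <- IH, Cpow_S. ring.
Qed.

(** Let [f] be the sum of the series of Cauchy coefficients. On every circle [h - f] has zero
    Fourier coefficients: against [z^k] by the mean value property, since [h 0 = f 0], and against
    [(/ z)^k] by construction. Fourier uniqueness then identifies [h] and [f]; the centre is treated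
    apart. *)
Theorem holomorphic_power_series (h : C -> C) : (forall z, inD z -> Cdiff h z) ->
  forall z, inD z -> is_cseries (fun n => coef h n * z ^ n)%C (h z).
Proof.
  intros Hh z Hz. assert (Hs := coef_summable h Hh).
  destruct (power_series_sum _ Hs) as [f Hf].
  assert (Hfd := Cdiff_pseries _ f Hs Hf).
  assert (H0 : inD 0) by (unfold inD; rewrite Cmod_0; lra).
  assert (E0 : coef h 0 = h 0).
  { unfold coef. rewrite (mean_ext _ h) by (intro; simpl; ring). apply mean_value; [lra|easy]. }
  assert (Ef : f 0 = h 0).
  { apply (is_cseries_unique (fun n => coef h n * 0 ^ n)%C); [now apply Hf|].
    rewrite <- E0. apply is_cseries_at_0. }
  destruct (Ceq_dec z 0) as [->|Hn]; [rewrite <- Ef; now apply Hf|].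
  set (r := Cmod z). assert (Hr : 0 < r < 1) by (split; [now apply Cmod_gt_0|exact Hz]).
  assert (He : fourier_null r (fun w => h w - f w)%C).
  { assert (Ch := circ_cont_on_D h r Hr Hh). assert (Cf := circ_cont_on_D f r Hr Hfd).
    split; [now apply circ_cont_minus|]. intro k. split.
    - rewrite mean_value; [rewrite Ef; ring|easy|].
      intros w Hw. apply Cdiff_mult; [apply Cdiff_minus; auto|apply Cdiff_pow, Cdiff_id].
    - rewrite (mean_ext _ (fun z => h z * (/ z) ^ k - f z * (/ z) ^ k)%C) by (intro; ring).
      rewrite mean_minus by (apply circ_cont_mult; [easy|apply circ_cont_inv_pow; lra]).
      rewrite (mean_power_series (coef h) f r k Hr Hs Hf). rewrite mean_coef by easy. ring. }
  destruct (polar z Hn) as [t Ht]. fold r in Ht.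
  assert (X := fourier_uniqueness r _ (proj1 Hr) He t). simpl in X. rewrite <- Ht in X.
  apply Ceq_minus in X. rewrite X. now apply Hf.
Qed.

(** * Subordination *)

Definition energy (g : C -> C) (r : R) : R := Re (mean (fun z => g z * Cconj (g z))%C r).

Lemma Re_mul_conj (c : C) : Re (c * Cconj c)%C = Cmod c ^ 2.
Proof. now rewrite <- Cmod2_conj. Qed.

Lemma Re_mean_is_RInt (f : C -> C) (r : R) : circ_cont f r ->
  is_RInt (fun t => Re (f (pt r t))) 0 (2 * PI) (2 * PI * Re (mean f r)).
Proof.
  intro Hf. rewrite <- re_scal_l. now apply is_CInt_Re, mean_is_CInt.
Qed.

Lemma Re_mean_le (f g : C -> C) (r : R) : circ_cont f r -> circ_cont g r ->
  (forall t, Re (f (pt r t)) <= Re (g (pt r t))) -> Re (mean f r) <= Re (mean g r).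
Proof.
  intros Hf Hg H. assert (P := two_PI_pos).
  apply Rmult_le_reg_l with (2 * PI); [easy|].
  apply (is_RInt_le (fun t => Re (f (pt r t))) (fun t => Re (g (pt r t))) 0 (2 * PI));
    [lra|now apply Re_mean_is_RInt|now apply Re_mean_is_RInt|]. intros; apply H.
Qed.

Lemma Cmod_mean_le_Re_mean (f g : C -> C) (r : R) : circ_cont f r -> circ_cont g r ->
  (forall t, Cmod (f (pt r t)) <= Re (g (pt r t))) -> Cmod (mean f r) <= Re (mean g r).
Proof.
  intros Hf Hg H. assert (P := two_PI_pos).
  apply Rmult_le_reg_l with (2 * PI); [easy|].
  replace (2 * PI * Cmod (mean f r)) with (Cmod (RtoC (2 * PI) * mean f r)%C)
    by (rewrite Cmod_mult, Cmod_R, Rabs_pos_eq; lra).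
  apply (Cmod_CInt_le (fun t => f (pt r t)) (fun t => Re (g (pt r t))) 0 (2 * PI));
    [lra| |now apply mean_is_CInt|now apply Re_mean_is_RInt]. intros; apply H.
Qed.

Lemma circ_cont_energy (g : C -> C) (r : R) :
  circ_cont g r -> circ_cont (fun z => g z * Cconj (g z))%C r.
Proof. intro H. now apply circ_cont_mult; [|apply circ_cont_conj]. Qed.

Lemma energy_nonneg (g : C -> C) (r : R) : circ_cont g r -> 0 <= energy g r.
Proof.
  intro H. replace 0 with (Re (mean (fun _ => RtoC 0) r)) by now rewrite mean_const.
  apply Re_mean_le; [apply circ_cont_const|now apply circ_cont_energy|].
  intro t. rewrite Re_mul_conj. simpl Re. apply pow2_ge_0.
Qed.

Lemma conj_pt_pow (r t : R) (k : nat) : 0 < r ->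
  Cconj (pt r t ^ k)%C = (RtoC ((r ^ 2) ^ k) * (/ pt r t) ^ k)%C.
Proof.
  intro Hr. rewrite Cpow_conj, RtoC_pow, <- Cpow_mult_l. f_equal.
  assert (Hz := pt_neq_0 r t Hr).
  assert (E := Cmod2_conj (pt r t)). rewrite Cmod_pt in E by easy. rewrite E. field. easy.
Qed.

(** Pythagoras in the mean over the circle, where the [z^k] are orthogonal with squared norm
    [(r^2)^k]. *)
Lemma energy_remove_mode (u : C -> C) (r : R) (k : nat) (c : C) : 0 < r < 1 -> circ_cont u r ->
  mean (fun z => u z * (/ z) ^ k)%C r = c ->
  energy (fun z => u z - c * z ^ k)%C r = energy u r - Cmod c ^ 2 * (r ^ 2) ^ k.
Proof.
  intros Hr Hu Hc. unfold energy.
  assert (Hp : circ_cont (fun z => z ^ k)%C r) by (apply circ_cont_pow; lra).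
  assert (Hq : circ_cont (fun z => (/ z) ^ k)%C r) by (apply circ_cont_inv_pow; lra).
  assert (C1 : circ_cont (fun z => u z * (/ z) ^ k)%C r) by now apply circ_cont_mult.
  assert (C2 := circ_cont_conj _ _ C1).
  assert (C3 : circ_cont (fun z => z ^ k * (/ z) ^ k)%C r) by now apply circ_cont_mult.
  assert (S : forall d f, circ_cont f r -> circ_cont (fun z => d * f z)%C r)
    by (intros; now apply circ_cont_mult; [apply circ_cont_const|]).
  set (R2 := RtoC ((r ^ 2) ^ k)).
  rewrite (mean_ext _ (fun z => u z * Cconj (u z) - (R2 * Cconj c) * (u z * (/ z) ^ k)
     - (R2 * c) * Cconj (u z * (/ z) ^ k) + (R2 * (c * Cconj c)) * (z ^ k * (/ z) ^ k)))%C.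
  - rewrite (mean_plus (fun z => u z * Cconj (u z) - (R2 * Cconj c) * (u z * (/ z) ^ k)
     - (R2 * c) * Cconj (u z * (/ z) ^ k)))%C; [|repeat apply circ_cont_minus; auto|auto].
    2: now apply circ_cont_energy.
    rewrite (mean_minus (fun z => u z * Cconj (u z) - (R2 * Cconj c) * (u z * (/ z) ^ k)))%C;
      [|apply circ_cont_minus; auto; now apply circ_cont_energy|auto].
    rewrite (mean_minus (fun z => u z * Cconj (u z)))%C; [|now apply circ_cont_energy|auto].
    rewrite !mean_scal, mean_conj, mean_orthogonal, Hc, Nat.eqb_refl by auto.
    match goal with |- Re ?x = _ =>
      replace x with (mean (fun z => u z * Cconj (u z))%C r - R2 * (c * Cconj c))%C by ring end.
    unfold Cminus. rewrite re_plus, re_opp. unfold R2. rewrite re_scal_l, Re_mul_conj. ring.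
  - intro t. rewrite Cminus_conj, !Cmult_conj.
    replace (Cconj ((/ pt r t) ^ k)) with (/ R2 * pt r t ^ k)%C.
    + rewrite conj_pt_pow by lra. fold R2.
      assert (HR : R2 <> 0%C).
      { intro E. apply RtoC_inj in E. revert E. apply pow_nonzero, pow_nonzero. lra. }
      field. easy.
    + assert (E := conj_pt_pow r t k ltac:(lra)). fold R2 in E.
      rewrite <- (Cconj_conj (pt r t ^ k)), E, Cmult_conj.
      replace (Cconj R2) with R2 by (unfold R2, RtoC, Cconj; simpl; f_equal; ring).
      assert (HR : R2 <> 0%C).
      { intro E'. apply RtoC_inj in E'. revert E'. apply pow_nonzero, pow_nonzero. lra. }
      field. easy.
Qed.

(** The induction removes the top mode, which leaves the lower coefficients unchanged; [u] is
    quantified after [M] so that the hypothesis applies to the remainder. *)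
Lemma Bessel (r : R) (M : nat) : 0 < r < 1 -> forall u, circ_cont u r ->
  sum_n (fun m => Cmod (mean (fun z => u z * (/ z) ^ m)%C r) ^ 2 * (r ^ 2) ^ m) M <= energy u r.
Proof.
  intro Hr.
  assert (Hrem : forall u c k, circ_cont u r -> circ_cont (fun z => u z - c * z ^ k)%C r).
  { intros u c k Hu. apply circ_cont_minus; [easy|].
    apply circ_cont_mult; [apply circ_cont_const|apply circ_cont_pow; lra]. }
  induction M as [|M IH]; intros u Hu.
  - rewrite sum_n_0. set (c := mean (fun z => u z * (/ z) ^ 0)%C r).
    assert (E := energy_remove_mode u r 0 c Hr Hu eq_refl).
    assert (X := energy_nonneg _ r (Hrem u c O Hu)). lra.
  - rewrite sum_n_S. set (c := mean (fun z => u z * (/ z) ^ S M)%C r).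
    assert (E := energy_remove_mode u r (S M) c Hr Hu eq_refl).
    specialize (IH _ (Hrem u c (S M) Hu)). rewrite E in IH.
    erewrite sum_n_ext_loc in IH.
    2: { intros n Hn. rewrite (mean_ext _ (fun z => u z * (/ z) ^ n - c * (z ^ S M * (/ z) ^ n)))%C
           by (intro; ring).
         rewrite mean_minus, mean_scal, mean_orthogonal.
         - replace (Nat.eqb (S M) n) with false by (symmetry; apply Nat.eqb_neq; lia).
           replace (mean (fun z => u z * (/ z) ^ n) r - c * 0)%C with
             (mean (fun z => u z * (/ z) ^ n) r)%C by ring. reflexivity.
         - easy.
         - apply circ_cont_mult; [apply circ_cont_pow|apply circ_cont_inv_pow]; lra.
         - apply circ_cont_mult; [easy|apply circ_cont_inv_pow; lra].
         - apply circ_cont_mult; [apply circ_cont_const|].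
           apply circ_cont_mult; [apply circ_cont_pow|apply circ_cont_inv_pow]; lra. }
    lra.
Qed.

(** * The Poisson majorant of a polynomial and Littlewood's inequality *)

Fixpoint horner (a : nat -> C) (N : nat) (w : C) : C :=
  match N with
  | O => 0%C
  | S N => (a O + w * horner (fun n => a (S n)) N w)%C
  end.

(* [Re (majorant a N)] is harmonic, dominates [|horner a N|^2] on the closed disk and equals it
   on the unit circle: it is the Poisson integral of [|horner a N|^2]. *)
Fixpoint majorant (a : nat -> C) (N : nat) (w : C) : C :=
  match N with
  | O => 0%C
  | S N => (majorant (fun n => a (S n)) N w + RtoC (Cmod (a O) ^ 2)
      + 2 * Cconj (a O) * (w * horner (fun n => a (S n)) N w))%C
  end.

Fixpoint sqsum (a : nat -> C) (N : nat) : R :=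
  match N with O => 0 | S N => Cmod (a O) ^ 2 + sqsum (fun n => a (S n)) N end.

Lemma Cmod2_plus (x y : C) :
  Cmod (x + y)%C ^ 2 = Cmod x ^ 2 + 2 * Re (Cconj x * y)%C + Cmod y ^ 2.
Proof.
  rewrite !Cmod2_alt. destruct x as [x1 x2], y as [y1 y2]. simpl. ring.
Qed.

Lemma Re_majorant_S (a : nat -> C) (N : nat) (w : C) :
  Re (majorant a (S N) w) = Re (majorant (fun n => a (S n)) N w) + Cmod (a O) ^ 2
    + 2 * Re (Cconj (a O) * (w * horner (fun n => a (S n)) N w))%C.
Proof.
  simpl majorant. rewrite !re_plus, re_RtoC, <- Cmult_assoc. rewrite re_scal_l. ring.
Qed.

(** Expanding [|a 0 + w g|^2] gives the recursion of the majorant, except for a factor [|w|^2 <= 1]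
    in front of [|g|^2]. *)
Lemma horner_le_majorant (N : nat) (w : C) : Cmod w <= 1 -> forall a,
  Cmod (horner a N w) ^ 2 <= Re (majorant a N w).
Proof.
  intro Hw. induction N as [|N IH]; intro a.
  - simpl. rewrite Cmod_0. lra.
  - rewrite Re_majorant_S. simpl horner. rewrite Cmod2_plus, Cmod_mult, Rpow_mult_distr.
    specialize (IH (fun n => a (S n))).
    set (g := horner (fun n => a (S n)) N w) in *.
    assert (Cmod w ^ 2 * Cmod g ^ 2 <= 1 * Cmod g ^ 2).
    { apply Rmult_le_compat_r; [apply pow2_ge_0|]. assert (X := Cmod_ge_0 w). nra. }
    lra.
Qed.

(** The extra term [|horner|^2] strengthens the induction: in the step it shrinks by [q^2], which
    frees [(1 - q^2) |g|^2] to absorb the cross terms by the arithmetic-geometric inequality. *)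
Lemma majorant_le_sqsum (q : R) (N : nat) (w : C) : 0 <= q < 1 -> Cmod w <= q -> forall a,
  Re (majorant a N w) + Cmod (horner a N w) ^ 2 <= (2 + 4 * q ^ 2 / (1 - q ^ 2)) * sqsum a N.
Proof.
  intros Hq Hw.
  assert (Hq2 : 0 < 1 - q ^ 2) by nra.
  set (K := 4 * q ^ 2 / (1 - q ^ 2)).
  assert (HK : K * (1 - q ^ 2) = 4 * q ^ 2) by (unfold K; field; lra).
  induction N as [|N IH]; intro a.
  - simpl. rewrite Cmod_0. lra.
  - rewrite Re_majorant_S. simpl horner. simpl sqsum.
    rewrite Cmod2_plus, Cmod_mult, Rpow_mult_distr.
    specialize (IH (fun n => a (S n))).
    set (g := horner (fun n => a (S n)) N w) in *.
    assert (Hre : Re (Cconj (a O) * (w * g))%C <= Cmod (a O) * (q * Cmod g)).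
    { eapply Rle_trans; [apply Rle_abs|]. eapply Rle_trans; [apply re_le_Cmod|].
      rewrite !Cmod_mult, Cmod_conj. apply Rmult_le_compat_l; [apply Cmod_ge_0|].
      apply Rmult_le_compat_r; [apply Cmod_ge_0|easy]. }
    assert (Hw2 : Cmod w ^ 2 * Cmod g ^ 2 <= q ^ 2 * Cmod g ^ 2).
    { apply Rmult_le_compat_r; [apply pow2_ge_0|]. assert (X := Cmod_ge_0 w).
      apply pow_incr. lra. }
    set (x := Cmod (a O)) in *. set (y := Cmod g) in *.
    set (s := sqsum (fun n => a (S n)) N) in *.
    assert (AG : 4 * (x * (q * y)) <= K * x ^ 2 + (1 - q ^ 2) * y ^ 2).
    { apply Rmult_le_reg_r with (1 - q ^ 2); [easy|].
      assert (E : (K * x ^ 2 + (1 - q ^ 2) * y ^ 2) * (1 - q ^ 2) =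
        4 * q ^ 2 * x ^ 2 + ((1 - q ^ 2) * y) ^ 2) by (rewrite <- HK; ring).
      rewrite E. set (v := (1 - q ^ 2) * y).
      replace (4 * (x * (q * y)) * (1 - q ^ 2)) with (4 * x * q * v) by (unfold v; ring).
      assert (X := pow2_ge_0 (2 * q * x - v)). nra. }
    lra.
Qed.

Lemma Cdiff_horner (f : C -> C) (N : nat) (z : C) : Cdiff f z -> forall a,
  Cdiff (fun z => horner a N (f z)) z.
Proof.
  intro Hf. induction N as [|N IH]; intro a; simpl; [apply Cdiff_const|].
  apply Cdiff_plus; [apply Cdiff_const|]. now apply Cdiff_mult.
Qed.

Lemma Cdiff_majorant (f : C -> C) (N : nat) (z : C) : Cdiff f z -> forall a,
  Cdiff (fun z => majorant a N (f z)) z.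
Proof.
  intro Hf. induction N as [|N IH]; intro a; simpl; [apply Cdiff_const|].
  apply Cdiff_plus; [apply Cdiff_plus; [apply IH|apply Cdiff_const]|].
  apply Cdiff_mult; [apply Cdiff_const|]. apply Cdiff_mult; [easy|]. now apply Cdiff_horner.
Qed.

(** The majorant composed with [psi] is holomorphic, so its mean is its value at [psi 0]. The bound
    [|psi| <= 1] is asked on one circle only, because [phi / rho] may exceed 1 farther out. *)
Lemma energy_horner_comp (psi : C -> C) (a : nat -> C) (N : nat) (r q : R) :
  0 < r < 1 -> 0 <= q < 1 -> (forall z, inD z -> Cdiff psi z) ->
  (forall z, Cmod z = r -> Cmod (psi z) <= 1) -> Cmod (psi 0) <= q ->
  energy (fun z => horner a N (psi z)) r <= (2 + 4 * q ^ 2 / (1 - q ^ 2)) * sqsum a N.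
Proof.
  intros Hr Hq Hpsi H1 H0.
  apply Rle_trans with (Re (mean (fun z => majorant a N (psi z)) r)).
  - apply Re_mean_le.
    + apply circ_cont_energy. apply circ_cont_on_D; [easy|]. intros; now apply Cdiff_horner; auto.
    + apply circ_cont_on_D; [easy|]. intros; now apply Cdiff_majorant; auto.
    + intro t. rewrite Re_mul_conj. apply horner_le_majorant, H1, Cmod_pt. lra.
  - rewrite mean_value; [|easy|intros; now apply Cdiff_majorant; auto].
    assert (X := majorant_le_sqsum q N (psi 0) Hq H0 a).
    assert (Y := pow2_ge_0 (Cmod (horner a N (psi 0)))). lra.
Qed.

Lemma csum_shift (a : nat -> C) (n : nat) : csum a (S n) = (a O + csum (fun k => a (S k)) n)%C.
Proof.
  induction n as [|n IH].
  - now rewrite csum_S, !csum_0.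
  - rewrite csum_S, IH, (csum_S (fun k => a (S k))). ring.
Qed.

Lemma horner_csum (N : nat) (w : C) : forall a,
  horner a (S N) w = csum (fun n => a n * w ^ n)%C N.
Proof.
  induction N as [|N IH]; intro a.
  - rewrite csum_0. simpl. ring.
  - rewrite csum_shift. change (horner a (S (S N)) w) with
      (a O + w * horner (fun n => a (S n)) (S N) w)%C.
    rewrite IH, (Cmult_comm w), csum_scal_r. simpl Cpow at 2. f_equal; [ring|].
    apply (sum_n_ext (G := C_AbelianMonoid)). intro n. rewrite Cpow_S.
    match goal with |- ?u = ?v => change (@eq C u v) end. ring.
Qed.

Lemma sum_n_shift (a : nat -> R) (n : nat) : sum_n a (S n) = a O + sum_n (fun k => a (S k)) n.
Proof.
  induction n as [|n IH].
  - now rewrite sum_n_S, !sum_n_0.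
  - rewrite sum_n_S, IH, (sum_n_S (fun k => a (S k))).
    match goal with |- ?u = ?v => change (@eq R u v) end. ring.
Qed.

Lemma sqsum_sum_n (N : nat) : forall a, sqsum a (S N) = sum_n (fun n => Cmod (a n) ^ 2) N.
Proof.
  induction N as [|N IH]; intro a.
  - rewrite sum_n_0. simpl. ring.
  - rewrite sum_n_shift, <- IH. reflexivity.
Qed.

(* Carathéodory's estimate: positivity of the real part bounds every coefficient by [2 |h 0|]. *)
Lemma positive_real_part_growth (h : C -> C) : (forall z, inD z -> Cdiff h z) ->
  (forall z, inD z -> 0 <= Re (h z)) ->
  forall z, inD z -> Cmod (h z) * (1 - Cmod z) <= 4 * Cmod (h 0).
Proof.
  intros Hh Hpos z Hz. unfold inD in Hz.
  set (s := Cmod z) in *. assert (Hs : 0 <= s) by apply Cmod_ge_0.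
  set (r := (1 + s) / 2). assert (Hr : 0 < r < 1) by (unfold r; lra).
  assert (Ch := circ_cont_on_D h r Hr Hh).
  assert (Hre0 : Re (h 0) <= Cmod (h 0)).
  { eapply Rle_trans; [apply Rle_abs|apply re_le_Cmod]. }
  assert (Hcoef : forall n, Cmod (coef h n) * r ^ n <= 2 * Cmod (h 0)).
  { intro n. assert (Hrn : 0 < r ^ n) by (apply pow_lt; lra).
    destruct n as [|n].
    - unfold coef. rewrite (mean_ext _ h) by (intro; simpl; ring).
      rewrite mean_value by (easy || lra). simpl. assert (X := Cmod_ge_0 (h 0)). lra.
    - set (k := S n) in *.
      assert (Cq : circ_cont (fun z => (/ z) ^ k)%C r) by (apply circ_cont_inv_pow; lra).
      (* Up to a constant this is the conjugate of the mean of [h z * z^k], which vanishes for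
         [k > 0]. So [coef h k] is also the coefficient of [2 Re h], a nonnegative function whose
         mean is [2 Re (h 0)]. *)
      assert (M0 : mean (fun z => Cconj (h z) * (/ z) ^ k)%C r = 0%C).
      { assert (Hr2 : (r ^ 2) ^ k <> 0) by (apply pow_nonzero, pow_nonzero; lra).
        rewrite (mean_ext _ (fun z => RtoC (/ (r ^ 2) ^ k) * Cconj (h z * z ^ k)))%C.
        - rewrite mean_scal, mean_conj.
          + rewrite mean_value; [|easy|intros; apply Cdiff_mult; [auto|apply Cdiff_pow, Cdiff_id]].
            unfold k. rewrite Cpow_S. apply injective_projections; simpl; ring.
          + apply circ_cont_mult; [easy|apply circ_cont_pow; lra].
          + apply circ_cont_conj, circ_cont_mult; [easy|apply circ_cont_pow; lra].
        - intro t. rewrite Cmult_conj, conj_pt_pow, RtoC_inv by (easy || lra).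
          field. intro E. apply Hr2. now apply RtoC_inj. }
      assert (M1 : coef h k = mean (fun z => (h z + Cconj (h z)) * (/ z) ^ k)%C r).
      { rewrite (mean_ext _ (fun z => h z * (/ z) ^ k + Cconj (h z) * (/ z) ^ k))%C by (intro; ring).
        rewrite mean_plus, M0, mean_coef; try easy; [ring| |];
        apply circ_cont_mult; try easy; now apply circ_cont_conj. }
      rewrite M1.
      apply Rmult_le_reg_r with (/ r ^ k); [now apply Rinv_0_lt_compat|].
      rewrite Rmult_assoc, Rinv_r, Rmult_1_r by lra.
      assert (E2 : Re (mean (fun z => RtoC (/ r ^ k) * (h z + Cconj (h z)))%C r) =
        2 * Re (h 0) * / r ^ k).
      { rewrite mean_scal, mean_plus, mean_conj, mean_value; try easy.
        - rewrite re_scal_l, re_plus, re_conj. ring.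
        - now apply circ_cont_conj.
        - apply circ_cont_plus; [easy|now apply circ_cont_conj]. }
      apply Rle_trans with (2 * Re (h 0) * / r ^ k).
      + rewrite <- E2. apply Cmod_mean_le_Re_mean.
        * apply circ_cont_mult; [|easy]. apply circ_cont_plus; [easy|now apply circ_cont_conj].
        * apply circ_cont_mult; [apply circ_cont_const|].
          apply circ_cont_plus; [easy|now apply circ_cont_conj].
        * intro t. rewrite Cmod_mult, Cmod_pow, Cmod_inv, Cmod_pt, pow_inv by (try apply pt_neq_0; lra).
          rewrite re_scal_l. rewrite (Rmult_comm (/ r ^ k)).
          apply Rmult_le_compat_r; [left; now apply Rinv_0_lt_compat|].
          rewrite re_plus, re_conj.
          replace (h (pt r t) + Cconj (h (pt r t)))%C with (RtoC (Re (h (pt r t)) + Re (h (pt r t)))).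
          -- rewrite Cmod_R, Rabs_pos_eq; [lra|].
             assert (X := Hpos (pt r t)). unfold inD in X. rewrite Cmod_pt in X by lra.
             assert (Y := X (proj2 Hr)). lra.
          -- destruct (h (pt r t)) as [x y]. unfold RtoC, Cplus, Cconj; simpl. f_equal; ring.
      + apply Rmult_le_compat_r; [left; now apply Rinv_0_lt_compat|]. lra. }
  assert (Hsr : 0 <= s / r < 1).
  { split; [apply Rmult_le_pos; [easy|]; left; apply Rinv_0_lt_compat; lra|].
    apply Rmult_lt_reg_r with r; [lra|]. unfold Rdiv. rewrite Rmult_assoc, Rinv_l by lra.
    unfold r; lra. }
  (* With [r] the midpoint of [s] and 1, [1 - s / r = (1 - s) / (2 r)]; this is where 2 becomes
     4. *)
  assert (HB : Cmod (h z) <= 2 * Cmod (h 0) * / (1 - s / r)).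
  { apply (is_cseries_Cmod_le (fun n => coef h n * z ^ n)%C (fun n => 2 * Cmod (h 0) * (s / r) ^ n)).
    - intro n. rewrite Cmod_mult, Cmod_pow. fold s.
      assert (Hrn : 0 < r ^ n) by (apply pow_lt; lra).
      unfold Rdiv. rewrite Rpow_mult_distr, pow_inv.
      replace (Cmod (coef h n) * s ^ n) with (Cmod (coef h n) * r ^ n * (s ^ n * / r ^ n))
        by (field; lra).
      apply Rmult_le_compat_r; [|apply Hcoef].
      apply Rmult_le_pos; [now apply pow_le|]. left; now apply Rinv_0_lt_compat.
    - now apply holomorphic_power_series.
    - apply (@is_series_scal R_AbsRing R_NormedModule). apply is_series_geom.
      rewrite Rabs_pos_eq; lra. }
  assert (X := Cmod_ge_0 (h 0)).
  apply Rmult_le_compat_r with (r := 1 - s) in HB; [|lra].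
  eapply Rle_trans; [exact HB|].
  replace (2 * Cmod (h 0) * / (1 - s / r) * (1 - s)) with (4 * Cmod (h 0) * r).
  - nra.
  - unfold r. field. lra.
Qed.

Lemma self_map_growth (phi : C -> C) : (forall z, inD z -> Cdiff phi z) ->
  (forall z, inD z -> inD (phi z)) ->
  forall z, inD z -> Cmod (phi z) <= 1 - (1 - Cmod (phi 0)) / 4 * (1 - Cmod z).
Proof.
  intros Hphi Hmap z Hz.
  assert (H0 : inD 0) by (unfold inD; rewrite Cmod_0; lra).
  assert (B0 := Hmap _ H0). assert (Bz := Hmap _ Hz). unfold inD in B0, Bz.
  assert (P0 := Cmod_ge_0 (phi 0)). assert (Pz := Cmod_ge_0 z). assert (Hz' := Hz). unfold inD in Hz'.
  destruct (Ceq_dec (phi z) 0) as [E|Hn].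
  - rewrite E, Cmod_0. nra.
  - (* Apply the growth bound to [1 / (1 - zeta phi)], where [zeta phi z = |phi z|]. *)
    apply Cmod_gt_0 in Hn. set (m := Cmod (phi z)) in *.
    set (zeta := (RtoC (/ m) * Cconj (phi z))%C).
    assert (Hzeta : Cmod zeta = 1).
    { unfold zeta. rewrite Cmod_mult, Cmod_R, Cmod_conj, Rabs_pos_eq; fold m.
      field; lra. left; now apply Rinv_0_lt_compat. }
    assert (Hre : forall w, inD w -> 0 < Re (1 - zeta * phi w)%C).
    { intros w Hw. unfold Cminus. rewrite re_plus, re_opp, re_RtoC.
      assert (X := Rle_trans _ _ _ (Rle_abs _) (re_le_Cmod (zeta * phi w)%C)).
      rewrite Cmod_mult, Hzeta in X. assert (Y := Hmap w Hw). unfold inD in Y. lra. }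
    assert (Hne : forall w, inD w -> (1 - zeta * phi w)%C <> 0%C).
    { intros w Hw E. assert (X := Hre w Hw). rewrite E in X. simpl in X. lra. }
    assert (G := positive_real_part_growth (fun w => / (1 - zeta * phi w))%C).
    assert (G' : Cmod (/ (1 - zeta * phi z))%C * (1 - Cmod z) <= 4 * Cmod (/ (1 - zeta * phi 0))%C).
    { apply G; [| |easy].
      - intros w Hw. apply Cdiff_inv; [now apply Hne|].
        apply Cdiff_minus; [apply Cdiff_const|]. apply Cdiff_mult; [apply Cdiff_const|auto].
      - intros w Hw. assert (X := Hre w Hw). set (u := (1 - zeta * phi w)%C) in *.
        destruct u as [x y]. simpl in *.
        apply Rmult_le_pos; [lra|]. left. apply Rinv_0_lt_compat. nra. }
    rewrite !Cmod_inv in G' by now apply Hne.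
    assert (Ez : (zeta * phi z)%C = RtoC m).
    { unfold zeta. rewrite <- Cmult_assoc, (Cmult_comm (Cconj _)), <- Cmod2_conj. fold m.
      rewrite <- RtoC_mult. f_equal. field. lra. }
    rewrite Ez, <- RtoC_minus, Cmod_R, Rabs_pos_eq in G' by lra.
    assert (L0 : 1 - Cmod (phi 0) <= Cmod (1 - zeta * phi 0)%C).
    { assert (X := Cmod_triangle_minus 1 (zeta * phi 0)%C). rewrite Cmod_mult, Hzeta, Cmod_1 in X. lra. }
    set (L := Cmod (1 - zeta * phi 0)%C) in *.
    assert (G2 : (1 - Cmod z) * L <= 4 * (1 - m)).
    { apply Rmult_le_reg_l with (/ (1 - m)); [apply Rinv_0_lt_compat; lra|].
      replace (/ (1 - m) * (4 * (1 - m))) with 4 by (field; lra).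
      replace (/ (1 - m) * ((1 - Cmod z) * L)) with (/ (1 - m) * (1 - Cmod z) * L) by ring.
      apply Rmult_le_reg_r with (/ L); [apply Rinv_0_lt_compat; lra|].
      rewrite Rmult_assoc, Rinv_r by lra. lra. }
    nra.
Qed.

Theorem composition_energy (phi f : C -> C) (a : nat -> C) :
  (forall z, inD z -> Cdiff phi z) -> (forall z, inD z -> inD (phi z)) ->
  summable_on_D a -> (forall z, inD z -> is_cseries (fun n => a n * z ^ n)%C (f z)) ->
  exists K kappa, 0 < K /\ 0 < kappa < 1 /\ forall r S M, 0 < r < 1 ->
    (forall N, sum_n (fun n => Cmod (a n) ^ 2 * ((1 - kappa * (1 - r)) ^ 2) ^ n) N <= S) ->
    sum_n (fun m => Cmod (coef (fun z => f (phi z)) m) ^ 2 * (r ^ 2) ^ m) M <= K * S.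
Proof.
  intros Hphi Hmap Ha Hf.
  assert (Hgrow := self_map_growth phi Hphi Hmap).
  assert (H0 : inD 0) by (unfold inD; rewrite Cmod_0; lra).
  assert (B0 := Hmap _ H0). unfold inD in B0.
  set (b := Cmod (phi 0)) in *. assert (Pb : 0 <= b) by apply Cmod_ge_0.
  set (kappa := (1 - b) / 4) in *.
  (* For every [r] the radius [rho] is at least [1 - kappa = (3 + b) / 4], so [q] bounds
     [|phi 0| / rho] uniformly in [r]. *)
  set (q := 4 * b / (3 + b)).
  assert (Hq : 0 <= q < 1).
  { split; [apply Rmult_le_pos; [lra|]; left; apply Rinv_0_lt_compat; lra|].
    apply Rmult_lt_reg_r with (3 + b); [lra|]. unfold q, Rdiv. rewrite Rmult_assoc, Rinv_l; lra. }
  set (K := 2 + 4 * q ^ 2 / (1 - q ^ 2)).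
  assert (HK : 0 < K).
  { assert (0 <= 4 * q ^ 2 / (1 - q ^ 2)); [|unfold K; lra].
    apply Rmult_le_pos; [nra|]. left. apply Rinv_0_lt_compat. nra. }
  exists (2 * K), kappa. split; [lra|]. split; [unfold kappa; lra|].
  intros r S M Hr HS.
  set (rho := 1 - kappa * (1 - r)) in *.
  assert (Hrho : 0 < rho < 1) by (unfold rho, kappa; nra).
  assert (Hrho3 : (3 + b) / 4 <= rho) by (unfold rho, kappa; nra).
  assert (Hfd := Cdiff_pseries a f Ha Hf).
  assert (Hhd : forall z, inD z -> Cdiff (fun z => f (phi z)) z).
  { intros z Hz. apply (Cdiff_comp f phi); auto. }
  assert (Hhc := circ_cont_on_D _ r Hr Hhd).
  apply Rle_trans with (energy (fun z => f (phi z)) r).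
  { erewrite sum_n_ext; [apply (Bessel r M Hr _ Hhc)|].
    intro m. simpl. now rewrite mean_coef. }
  (* Writing [phi = rho psi], the powers of [rho] move into the coefficients, where they produce the
     weights [(rho^2)^n]. *)
  set (psi := fun z => (RtoC (/ rho) * phi z)%C).
  set (al := fun n => (a n * RtoC rho ^ n)%C).
  assert (Hrz : RtoC rho <> 0%C) by (intro E; apply RtoC_inj in E; lra).
  assert (Hpart : forall N z, horner al (Datatypes.S N) (psi z) = csum (fun n => a n * phi z ^ n)%C N).
  { intros N z. rewrite horner_csum. apply (sum_n_ext (G := C_AbelianMonoid)). intro n.
    unfold al, psi. rewrite <- Cmult_assoc, <- Cpow_mult_l, RtoC_inv by lra.
    do 2 f_equal. rewrite Cmult_assoc, Cinv_r by easy. ring. }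
  assert (Hpd : forall z, inD z -> Cdiff psi z).
  { intros z Hz. apply Cdiff_mult; [apply Cdiff_const|auto]. }
  assert (Hmod : forall z, Cmod (psi z) = / rho * Cmod (phi z)).
  { intro z. unfold psi. rewrite Cmod_mult, Cmod_R, Rabs_pos_eq; [easy|].
    left; apply Rinv_0_lt_compat; lra. }
  assert (Hcirc : forall z, Cmod z = r -> Cmod (phi z) <= rho).
  { intros z Hz. unfold rho. rewrite <- Hz. apply Hgrow. unfold inD. lra. }
  assert (Hpsi1 : forall z, Cmod z = r -> Cmod (psi z) <= 1).
  { intros z Hz. rewrite Hmod. apply Rmult_le_reg_l with rho; [lra|].
    rewrite <- Rmult_assoc, Rinv_r by lra. rewrite Rmult_1_l, Rmult_1_r. now apply Hcirc. }
  assert (Hpsi0 : Cmod (psi 0) <= q).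
  { rewrite Hmod. fold b. apply Rmult_le_reg_l with rho; [lra|].
    rewrite <- Rmult_assoc, Rinv_r by lra. rewrite Rmult_1_l.
    replace b with ((3 + b) / 4 * q) at 1 by (unfold q; field; lra).
    apply Rmult_le_compat_r; lra. }
  apply le_epsilon. intros eps He.
  set (t := fun n => Cmod (a n) * rho ^ n).
  assert (Ht : ex_series t) by (apply Ha; lra).
  assert (Ht0 : forall n, 0 <= t n).
  { intro n. apply Rmult_le_pos; [apply Cmod_ge_0|apply pow_le; lra]. }
  (* The majorant exists for polynomials only, so [f] is truncated with error [e] on the image of
     the circle. From [(|p| + e)^2 <= 2 |p|^2 + 2 e^2] come the factor 2 in [2 * K] and the
     condition [2 e^2 <= eps]. *)
  set (e := Rmin 1 (eps / 2)).
  assert (He0 : 0 < e) by (apply Rmin_pos; lra).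
  assert (He1 : e <= 1) by apply Rmin_l. assert (He2 : e <= eps / 2) by apply Rmin_r.
  destruct (Series_tail_small t e Ht0 Ht He0) as [N HN].
  specialize (HN N (Nat.le_refl N)).
  set (p := fun z => horner al (Datatypes.S N) (psi z)).
  assert (Hpc : circ_cont p r).
  { apply circ_cont_on_D; [easy|]. intros; apply Cdiff_horner; auto. }
  apply Rle_trans with (Re (mean (fun z => RtoC 2 * (p z * Cconj (p z)) + RtoC (2 * e ^ 2))%C r)).
  - apply Re_mean_le.
    + now apply circ_cont_energy.
    + apply circ_cont_plus; [|apply circ_cont_const].
      apply circ_cont_mult; [apply circ_cont_const|now apply circ_cont_energy].
    + intro s. rewrite re_plus, re_scal_l, !Re_mul_conj, re_RtoC.
      set (z := pt r s). assert (Hz : Cmod z = r) by (apply Cmod_pt; lra).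
      assert (HzD : inD z) by (unfold inD; lra).
      assert (T : Cmod (f (phi z) - p z)%C <= e).
      { unfold p. rewrite Hpart.
        eapply Rle_trans; [apply (is_cseries_tail_le (fun n => a n * phi z ^ n)%C t)|lra]; auto.
        intro n. unfold t. rewrite Cmod_mult, Cmod_pow. apply Rmult_le_compat_l; [apply Cmod_ge_0|].
        apply pow_incr. split; [apply Cmod_ge_0|now apply Hcirc]. }
      assert (X := Cmod_triangle (p z) (f (phi z) - p z)%C).
      replace (p z + (f (phi z) - p z))%C with (f (phi z)) in X by ring.
      assert (X1 := Cmod_ge_0 (f (phi z))). assert (X2 := Cmod_ge_0 (p z)).
      assert (Y : Cmod (f (phi z)) ^ 2 <= (Cmod (p z) + e) ^ 2) by (apply pow_incr; lra).
      assert (Z := pow2_ge_0 (Cmod (p z) - e)). nra.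
  - rewrite mean_plus, mean_scal, mean_const.
    2: now apply circ_cont_energy.
    2: apply circ_cont_mult; [apply circ_cont_const|now apply circ_cont_energy].
    2: apply circ_cont_const.
    rewrite re_plus, re_scal_l, re_RtoC. fold (energy p r).
    assert (X := energy_horner_comp psi al (Datatypes.S N) r q Hr Hq Hpd Hpsi1 Hpsi0).
    fold K p in X.
    assert (Y : sqsum al (Datatypes.S N) <= S).
    { rewrite sqsum_sum_n. eapply Rle_trans; [|apply (HS N)]. apply sum_n_le. intros n _.
      unfold al. rewrite Cmod_mult, Cmod_pow, Cmod_R, Rabs_pos_eq, Rpow_mult_distr by lra.
      right. f_equal. rewrite <- !pow_mult. f_equal. lia. }
    assert (K * sqsum al (Datatypes.S N) <= K * S) by (apply Rmult_le_compat_l; lra).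
    nra.
Qed.

(** * The doubling condition implies boundedness *)

Lemma weight_summable (beta : nat -> R) : weight_ok beta ->
  forall r, 0 <= r < 1 -> ex_series (fun n => (r ^ 2) ^ n / beta n).
Proof.
  intros [Hpos Hlim] r Hr.
  (* [s < 1] gives [beta n >= s^n] eventually, and [r < s] makes the comparison ratio [r^2 / s]
     smaller than 1. *)
  set (s := (1 + r) / 2). assert (Hs : r < s < 1) by (unfold s; lra).
  assert (Hev : exists N, forall n, (N <= n)%nat -> s < Rpower (beta n) (/ INR n)).
  { destruct (ex_LimInf_seq (fun n => Rpower (beta n) (/ INR n))) as [l Hl].
    rewrite (is_LimInf_seq_unique _ _ Hl) in Hlim.
    destruct l as [l| |]; simpl in Hlim; [| |easy].
    - assert (He : 0 < l - s) by lra.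
      destruct (proj2 (Hl (mkposreal _ He))) as [N HN]. exists N. intros n Hn.
      specialize (HN n Hn). simpl in HN. lra.
    - destruct (Hl s) as [N HN]. exists N. exact HN. }
  destruct Hev as [N HN].
  (* The shift by [S N] instead of [N] keeps the index positive, as the exponent [/ INR n] must be a
     true inverse. *)
  apply (ex_series_incr_n _ (S N)).
  apply ex_series_nonneg_le with (fun k => (r ^ 2 / s) ^ (S N + k)).
  - intro k. set (n := (S N + k)%nat). specialize (HN n ltac:(lia)).
    assert (Hn : 0 < INR n) by (apply lt_0_INR; lia).
    assert (Hb : s ^ n <= beta n).
    { rewrite <- (Rpower_1 (beta n)) by easy.
      replace 1 with (/ INR n * INR n) by (field; lra).
      rewrite <- Rpower_mult, Rpower_pow by apply exp_pos.
      apply pow_incr. lra. }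
    assert (Hsn : 0 < s ^ n) by (apply pow_lt; lra).
    assert (Hrn : 0 <= (r ^ 2) ^ n) by (apply pow_le, pow_le; lra).
    split.
    + apply Rmult_le_pos; [easy|]. left. now apply Rinv_0_lt_compat.
    + unfold Rdiv. rewrite Rpow_mult_distr, pow_inv. apply Rmult_le_compat_l; [easy|].
      now apply Rinv_le_contravar.
  - apply (ex_series_incr_n (fun k => (r ^ 2 / s) ^ k) (S N)).
    apply ex_series_geom.
    assert (0 <= r ^ 2 / s) by (apply Rmult_le_pos; [apply pow_le; lra|]; left; apply Rinv_0_lt_compat; lra).
    rewrite Rabs_pos_eq by easy.
    apply Rmult_lt_reg_r with s; [lra|]. unfold Rdiv. rewrite Rmult_assoc, Rinv_l by lra. nra.
Qed.

(** Summed over [n], this takes the place of Cauchy-Schwarz between the weights [b] and [1 / b]; the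
    parameter [lam] balances the two sums. *)
Lemma weighted_AMGM (x r b lam : R) : 0 < b -> 0 < lam ->
  2 * (x * r) <= lam * (x ^ 2 * b) + / lam * (r ^ 2 / b).
Proof.
  intros Hb Hl.
  assert (E : lam * (x ^ 2 * b) + / lam * (r ^ 2 / b) - 2 * (x * r) =
     (lam * b * x - r) ^ 2 / (lam * b)) by (field; lra).
  assert (0 <= (lam * b * x - r) ^ 2 / (lam * b)); [|lra].
  apply Rmult_le_pos; [apply pow2_ge_0|]. left. apply Rinv_0_lt_compat. nra.
Qed.

Lemma pow_sq_comm (r : R) (n : nat) : (r ^ n) ^ 2 = (r ^ 2) ^ n.
Proof. rewrite <- !pow_mult. f_equal. lia. Qed.

Lemma H2_summable_on_D (beta : nat -> R) (a : nat -> C) : weight_ok beta ->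
  ex_series (fun n => Cmod (a n) ^ 2 * beta n) -> summable_on_D a.
Proof.
  intros Hw Ha r Hr. assert (Hs := weight_summable beta Hw r Hr). destruct Hw as [Hpos _].
  apply ex_series_nonneg_le with (fun n => Cmod (a n) ^ 2 * beta n + (r ^ 2) ^ n / beta n).
  - intro n. split; [apply Rmult_le_pos; [apply Cmod_ge_0|apply pow_le; lra]|].
    assert (X := weighted_AMGM (Cmod (a n)) (r ^ n) (beta n) 1 (Hpos n) Rlt_0_1).
    rewrite Rinv_1, !Rmult_1_l, pow_sq_comm in X.
    assert (0 <= Cmod (a n) * r ^ n) by (apply Rmult_le_pos; [apply Cmod_ge_0|apply pow_le; lra]).
    lra.
  - now apply (@ex_series_plus R_AbsRing R_NormedModule).
Qed.

Lemma summable_sq (a : nat -> C) (r : R) : summable_on_D a -> 0 <= r < 1 ->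
  ex_series (fun n => Cmod (a n) ^ 2 * (r ^ 2) ^ n).
Proof.
  intros Ha Hr. set (t := fun n => Cmod (a n) * r ^ n).
  assert (Ht0 : forall n, 0 <= t n).
  { intro n. apply Rmult_le_pos; [apply Cmod_ge_0|apply pow_le; lra]. }
  assert (Ht : ex_series t) by now apply Ha.
  apply ex_series_nonneg_le with (fun n => Series t * t n).
  - intro n. replace (Cmod (a n) ^ 2 * (r ^ 2) ^ n) with (t n * t n)
      by (unfold t; rewrite <- pow_sq_comm; ring).
    assert (t n <= Series t).
    { eapply Rle_trans; [apply (sum_n_term_le t n n Ht0 (Nat.le_refl n))|].
      now apply sum_n_le_Series. }
    assert (X := Ht0 n). split; [nra|]. apply Rmult_le_compat_r; easy.
  - now apply (@ex_series_scal R_AbsRing R_NormedModule).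
Qed.

Lemma Bernoulli_compl (s : R) (n : nat) : 0 <= s <= 1 -> 1 - INR n * (1 - s) <= s ^ n.
Proof.
  intro Hs. induction n as [|n IH]; [simpl; lra|].
  rewrite S_INR, <- tech_pow_Rmult.
  apply Rle_trans with (s * (1 - INR n * (1 - s))).
  - assert (X := Rmult_le_pos _ _ (pos_INR n) (Rle_0_sqr (1 - s))). unfold Rsqr in X. lra.
  - apply Rmult_le_compat_l; lra.
Qed.

(** For an essentially decreasing [beta] this is a decreasing weight comparable to it, up to the
    constant of [ess_decreasing]. *)
Fixpoint running_min (beta : nat -> R) (n : nat) : R :=
  match n with O => beta O | S n => Rmin (running_min beta n) (beta (S n)) end.

Lemma running_min_le (beta : nat -> R) (n : nat) : running_min beta n <= beta n.
Proof. destruct n; simpl; [lra|apply Rmin_r]. Qed.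

Lemma running_min_glb (beta : nat -> R) (n : nat) (x : R) :
  (forall k, (k <= n)%nat -> x <= beta k) -> x <= running_min beta n.
Proof.
  intro H. induction n as [|n IH]; simpl; [apply H; lia|].
  apply Rmin_glb; [apply IH; intros; apply H; lia|apply H; lia].
Qed.

(** * Dyadic combinations of radii for a decreasing doubling weight *)

Section DyadicWeights.

Variables (g : nat -> R) (delta : R).
Hypothesis g_pos : forall n, 0 < g n.
Hypothesis g_decr : forall n m, (n <= m)%nat -> g m <= g n.
Hypothesis delta_pos : 0 < delta < 1.
Hypothesis g_doubling : forall n, delta * g n <= g (2 * n)%nat.

Fixpoint dyadic_part (J : nat) (v : nat -> R) : R :=
  match J with
  | O => 0
  | S J => dyadic_part J v + (g (2 ^ J) - g (2 ^ S J)) * v J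
  end.

(* A positive combination of [v 0, ..., v J] whose total mass telescopes to [g 1]. Abel summation
   makes it comparable to [g m] when [v j] is the m-th power of a number near [1 - 2^-j]. *)
Definition dyadic_mean (J : nat) (v : nat -> R) : R := dyadic_part J v + g (2 ^ J) * v J.

Lemma dyadic_part_S (J : nat) (v : nat -> R) :
  dyadic_part (S J) v = dyadic_part J v + (g (2 ^ J) - g (2 ^ S J)) * v J.
Proof. reflexivity. Qed.

Lemma dyadic_gap (J : nat) : 0 <= g (2 ^ J) - g (2 ^ S J).
Proof. assert (g (2 ^ S J) <= g (2 ^ J)) by (apply g_decr; simpl; lia). lra. Qed.

Lemma dyadic_part_nonneg (J : nat) (v : nat -> R) :
  (forall j, 0 <= v j) -> 0 <= dyadic_part J v.
Proof.
  intro H. induction J as [|J IH]; simpl; [lra|].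
  assert (X := Rmult_le_pos _ _ (dyadic_gap J) (H J)). simpl in X. lra.
Qed.

Lemma dyadic_mean_mono (J : nat) (v w : nat -> R) :
  (forall j, v j <= w j) -> dyadic_mean J v <= dyadic_mean J w.
Proof.
  intro H. apply Rplus_le_compat.
  - induction J as [|J IH]; simpl; [lra|]. apply Rplus_le_compat; [easy|].
    apply Rmult_le_compat_l; [apply dyadic_gap|apply H].
  - apply Rmult_le_compat_l; [left; apply g_pos|apply H].
Qed.

Lemma dyadic_mean_scal (J : nat) (c : R) (v : nat -> R) :
  dyadic_mean J (fun j => c * v j) = c * dyadic_mean J v.
Proof.
  unfold dyadic_mean. assert (E : dyadic_part J (fun j => c * v j) = c * dyadic_part J v).
  { induction J as [|J IH]; simpl; [ring|]. rewrite IH. ring. }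
  rewrite E. ring.
Qed.

Lemma dyadic_mean_plus (J : nat) (v w : nat -> R) :
  dyadic_mean J (fun j => v j + w j) = dyadic_mean J v + dyadic_mean J w.
Proof.
  unfold dyadic_mean.
  assert (E : dyadic_part J (fun j => v j + w j) = dyadic_part J v + dyadic_part J w).
  { induction J as [|J IH]; simpl; [ring|]. rewrite IH. ring. }
  rewrite E. ring.
Qed.

Lemma dyadic_mean_ext (J : nat) (v w : nat -> R) :
  (forall j, v j = w j) -> dyadic_mean J v = dyadic_mean J w.
Proof.
  intro H. apply Rle_antisym; apply dyadic_mean_mono; intro j; right;
  [apply H|symmetry; apply H].
Qed.

Lemma dyadic_mean_sum (J M : nat) (x : nat -> R) (v : nat -> nat -> R) :
  sum_n (fun m => x m * dyadic_mean J (v m)) M =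
  dyadic_mean J (fun j => sum_n (fun m => x m * v m j) M).
Proof.
  induction M as [|M IH].
  - rewrite sum_n_0, <- dyadic_mean_scal. apply dyadic_mean_ext. intro j. now rewrite sum_n_0.
  - rewrite sum_n_S, IH, <- dyadic_mean_scal, <- dyadic_mean_plus.
    apply dyadic_mean_ext. intro j. now rewrite sum_n_S.
Qed.

Lemma dyadic_mean_lim (J : nat) (s : nat -> nat -> R) (l : nat -> R) :
  (forall j, is_lim_seq (s j) (l j)) ->
  is_lim_seq (fun N => dyadic_mean J (fun j => s j N)) (dyadic_mean J l).
Proof.
  intro H. apply is_lim_seq_plus'.
  - induction J as [|J IH]; simpl; [apply is_lim_seq_const|].
    apply is_lim_seq_plus'; [easy|].
    apply (is_lim_seq_scal_l (s J) _ (l J)). apply H.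
  - apply (is_lim_seq_scal_l (s J) _ (l J)). apply H.
Qed.

(** The weights of the indices from [j0] on telescope to [g (2^j0)], and the earlier terms are
    nonnegative. *)
Lemma dyadic_mean_ge (J j0 : nat) (v : nat -> R) (c : R) : (j0 <= J)%nat -> 0 <= c ->
  (forall j, 0 <= v j) -> (forall j, (j0 <= j)%nat -> c <= v j) ->
  c * g (2 ^ j0) <= dyadic_mean J v.
Proof.
  intros HJ Hc Hv Hvc.
  assert (X : c * g (2 ^ j0) <= dyadic_part J v + g (2 ^ J) * c).
  { induction HJ as [|J HJ IH].
    - assert (Y := dyadic_part_nonneg j0 v Hv). lra.
    - rewrite dyadic_part_S.
      assert (Y := Rmult_le_compat_l _ _ _ (dyadic_gap J) (Hvc J HJ)). lra. }
  assert (Y := Rmult_le_compat_l _ _ _ (Rlt_le _ _ (g_pos (2 ^ J))) (Hvc J HJ)).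
  unfold dyadic_mean. lra.
Qed.

(** The indices from [j1] on have total weight [g (2^j1) <= g n]; those below are dominated by a
    geometric sum in [2^j]. When [J < j1], the last term is not part of that sum and costs a second
    [E]. *)
Lemma dyadic_mean_le (J j1 n : nat) (v : nat -> R) (E : R) : 0 <= E ->
  (n <= 2 ^ j1)%nat -> (forall j, 0 <= v j <= 1) ->
  (forall j, (j < j1)%nat -> g (2 ^ j) * v j <= E * (2 ^ j / 2 ^ j1) * g n) ->
  dyadic_mean J v <= (2 * E + 1) * g n.
Proof.
  intros HE Hn Hv Hsmall.
  assert (Hgn := g_pos n). assert (HEg : 0 <= E * g n) by (apply Rmult_le_pos; lra).
  assert (Hg1 : g (2 ^ j1) <= g n) by now apply g_decr.
  assert (P2 : forall j, 0 < 2 ^ j) by (intro; apply pow_lt; lra).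
  assert (Hratio : forall j, (j <= j1)%nat -> 2 ^ j / 2 ^ j1 <= 1).
  { intros j Hj. apply Rmult_le_reg_r with (2 ^ j1); [easy|].
    unfold Rdiv. rewrite Rmult_assoc, Rinv_l by (apply Rgt_not_eq, P2).
    rewrite Rmult_1_l, Rmult_1_r. apply Rle_pow; [lra|easy]. }
  assert (Hlow : forall K, (K <= j1)%nat -> dyadic_part K v <= E * (2 ^ K / 2 ^ j1) * g n).
  { induction K as [|K IH]; intro HK.
    - simpl. replace (E * (1 / 2 ^ j1) * g n) with (E * g n * / 2 ^ j1) by (field; apply Rgt_not_eq, P2).
      apply Rmult_le_pos; [easy|]. left. now apply Rinv_0_lt_compat.
    - rewrite dyadic_part_S. specialize (IH ltac:(lia)). assert (X := Hsmall K ltac:(lia)).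
      assert (Y : (g (2 ^ K) - g (2 ^ S K)) * v K <= g (2 ^ K) * v K).
      { apply Rmult_le_compat_r; [apply Hv|]. assert (Z := g_pos (2 ^ S K)). lra. }
      replace (E * (2 ^ S K / 2 ^ j1) * g n) with
        (E * (2 ^ K / 2 ^ j1) * g n + E * (2 ^ K / 2 ^ j1) * g n)
        by (simpl; field; apply Rgt_not_eq, P2).
      lra. }
  destruct (Nat.le_gt_cases j1 J) as [HJ|HJ].
  - assert (Hhigh : dyadic_part J v <= E * g n + g (2 ^ j1) - g (2 ^ J)).
    { induction HJ as [|J HJ IH].
      - assert (X := Hlow j1 (Nat.le_refl j1)).
        replace (E * (2 ^ j1 / 2 ^ j1) * g n) with (E * g n) in X by (field; apply Rgt_not_eq, P2). lra.
      - rewrite dyadic_part_S.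
        assert (Y := Rmult_le_compat_l _ _ _ (dyadic_gap J) (proj2 (Hv J))). lra. }
    assert (Y := Rmult_le_compat_l _ _ _ (Rlt_le _ _ (g_pos (2 ^ J))) (proj2 (Hv J))).
    unfold dyadic_mean. lra.
  - assert (X := Hlow J ltac:(lia)). assert (Y := Hsmall J HJ).
    assert (Z := Hratio J ltac:(lia)).
    assert (E * (2 ^ J / 2 ^ j1) * g n <= E * g n).
    { replace (E * g n) with (E * 1 * g n) by ring. apply Rmult_le_compat_r; [lra|].
      now apply Rmult_le_compat_l. }
    unfold dyadic_mean. lra.
Qed.

(** The alternative [j = O] is there for [m = 0], where no power of two is at most [2 * m]. *)
Lemma dyadic_index (m : nat) : exists j, (m <= 2 ^ j)%nat /\ (j = O \/ (2 ^ j <= 2 * m)%nat).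
Proof.
  destruct m as [|m].
  - exists O. split; [simpl; lia|now left].
  - exists (Nat.log2_up (S m)). destruct m as [|m].
    + split; [simpl; lia|left; reflexivity].
    + assert (H := Nat.log2_up_spec (S (S m)) ltac:(lia)).
      split; [apply H|right]. set (l := Nat.log2_up (S (S m))) in *.
      destruct l as [|l]; [simpl in *; lia|]. simpl Nat.pred in H. rewrite Nat.pow_succ_r'. lia.
Qed.

Lemma doubling_iter (i n : nat) : delta ^ i * g n <= g (2 ^ i * n)%nat.
Proof.
  induction i as [|i IH].
  - simpl. replace (n + 0)%nat with n by lia. lra.
  - simpl pow. rewrite Rmult_assoc.
    apply Rle_trans with (delta * g (2 ^ i * n)%nat); [apply Rmult_le_compat_l; lra|].
    replace (2 ^ S i * n)%nat with (2 * (2 ^ i * n))%nat by (simpl; ring). apply g_doubling.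
Qed.

Lemma pow_one_minus_ge_half (j m : nat) : (m <= 2 ^ j)%nat ->
  / 4 <= ((1 - / 2 ^ S j) ^ 2) ^ m.
Proof.
  intro Hm. assert (P2 : 0 < 2 ^ j) by (apply pow_lt; lra).
  assert (Hi : 0 < / 2 ^ S j <= / 2).
  { split; [apply Rinv_0_lt_compat, pow_lt; lra|]. apply Rinv_le_contravar; [lra|].
    simpl. assert (1 <= 2 ^ j) by (apply pow_R1_Rle; lra). lra. }
  assert (Bern := Bernoulli_compl (1 - / 2 ^ S j) m ltac:(lra)).
  replace (1 - (1 - / 2 ^ S j)) with (/ 2 ^ S j) in Bern by ring.
  assert (H : / 2 <= (1 - / 2 ^ S j) ^ m).
  { eapply Rle_trans; [|exact Bern].
    assert (INR m <= 2 ^ j).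
    { replace (2 ^ j) with (INR (2 ^ j)) by (rewrite pow_INR; reflexivity). now apply le_INR. }
    assert (INR m * / 2 ^ S j <= 2 ^ j * / 2 ^ S j) by (apply Rmult_le_compat_r; lra).
    replace (2 ^ j * / 2 ^ S j) with (/ 2) in H0 by (simpl; field; lra). lra. }
  rewrite <- pow_sq_comm. nra.
Qed.

(** Combines [1 - x <= exp (- x)] with [exp (- u) <= 1 / u] at [u = 2 n x / p]: decay in [n x] of
    any prescribed order [p]. *)
Lemma pow_one_minus_le (x : R) (n p : nat) : 0 < x < 1 -> (0 < n)%nat -> (0 < p)%nat ->
  ((1 - x) ^ 2) ^ n <= (INR p / (2 * INR n * x)) ^ p.
Proof.
  intros Hx Hn Hp.
  assert (Pn : 0 < INR n) by now apply lt_0_INR. assert (Pp : 0 < INR p) by now apply lt_0_INR.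
  set (y := 2 * INR n * x). assert (Py : 0 < y) by (unfold y; nra).
  assert (H1 : ((1 - x) ^ 2) ^ n <= exp (- y)).
  { rewrite <- pow_mult. apply Rle_trans with (exp (- x) ^ (2 * n)).
    - apply pow_incr. split; [lra|]. assert (X := exp_ineq1_le (- x)). lra.
    - right. rewrite <- Rpower_pow by apply exp_pos. unfold Rpower. rewrite ln_exp. f_equal.
      rewrite mult_INR. unfold y. simpl. ring. }
  assert (H2 : exp (- y) = (exp (- (y / INR p))) ^ p).
  { rewrite <- Rpower_pow by apply exp_pos. unfold Rpower. rewrite ln_exp. f_equal. field. lra. }
  assert (H3 : exp (- (y / INR p)) <= INR p / y).
  { rewrite exp_Ropp. replace (INR p / y) with (/ (y / INR p)) by (field; lra).
    apply Rinv_le_contravar; [apply Rdiv_lt_0_compat; lra|].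
    assert (X := exp_ineq1_le (y / INR p)). lra. }
  rewrite H2 in H1. eapply Rle_trans; [exact H1|].
  apply pow_incr. split; [left; apply exp_pos|exact H3].
Qed.

Theorem dyadic_transfer (K kappa : R) (x y : nat -> R) (Y : R) : 0 < K -> 0 < kappa < 1 ->
  (forall m, 0 <= x m) -> (forall n, 0 <= y n) ->
  (forall rho, 0 <= rho < 1 -> ex_series (fun n => y n * (rho ^ 2) ^ n)) ->
  (forall r S M, 0 < r < 1 ->
    (forall N, sum_n (fun n => y n * ((1 - kappa * (1 - r)) ^ 2) ^ n) N <= S) ->
    sum_n (fun m => x m * (r ^ 2) ^ m) M <= K * S) ->
  (forall N, sum_n (fun n => y n * g n) N <= Y) ->
  exists B, forall M, sum_n (fun m => x m * g m) M <= B.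
Proof.
  intros HK Hk Hx Hy Hsum Htrans HY.
  assert (P2 : forall j, 0 < 2 ^ j) by (intro; apply pow_lt; lra).
  set (r := fun j => 1 - / 2 ^ S j).
  assert (Hinv : forall j, 0 < / 2 ^ S j <= / 2).
  { intro j. split; [apply Rinv_0_lt_compat, P2|]. apply Rinv_le_contravar; [lra|].
    simpl. assert (1 <= 2 ^ j) by (apply pow_R1_Rle; lra). lra. }
  assert (Hr : forall j, 0 < r j < 1) by (intro j; unfold r; assert (X := Hinv j); lra).
  set (rho := fun j => 1 - kappa * (1 - r j)).
  assert (Hrho : forall j, 0 < rho j < 1) by (intro j; unfold rho; assert (X := Hr j); nra).
  (* For [2^j = 2^j1 / 2^i], doubling allows [g (2^j)] to exceed [g (2^j1)] by [delta^-i]. Decay of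
     order [p] gains [(delta / 2)^i], which pays for that and leaves the factor [2^-i] of a
     geometric sum. The constant [E] below is what [pow_one_minus_le] yields at
     [x = kappa / 2^(j+1)]. *)
  assert (Hp : exists p, (0 < p)%nat /\ (/ 2) ^ p <= delta / 2).
  { destruct (pow_lt_1_zero (/ 2)) with (y := delta / 2) as [p Hp];
      [rewrite Rabs_pos_eq; lra|lra|].
    exists (S p). split; [lia|]. specialize (Hp (S p) ltac:(lia)).
    rewrite Rabs_pos_eq in Hp by (apply pow_le; lra). lra. }
  destruct Hp as [p [Hp0 Hp]].
  assert (Pp : 0 < INR p) by now apply lt_0_INR.
  set (E := (2 * INR p / kappa) ^ p).
  assert (HE : 0 <= E).
  { apply pow_le. apply Rmult_le_pos; [lra|]. left. apply Rinv_0_lt_compat; lra. }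
  assert (Hupper : forall J n, dyadic_mean J (fun j => (rho j ^ 2) ^ n) <= (2 * E + 1) * g n).
  { intros J n. destruct (dyadic_index n) as [j1 [Hj1 Hj1']].
    apply dyadic_mean_le with j1; [easy|easy| |].
    - intro j. assert (X := Hrho j). split; [apply pow_le, pow_le; lra|].
      rewrite <- (pow1 n). apply pow_incr. split; [apply pow_le; lra|]. nra.
    - intros j Hj. destruct Hj1' as [->|Hj1']; [lia|].
      assert (Hn0 : (0 < n)%nat).
      { assert (2 ^ j1 <> 0)%nat by (apply Nat.pow_nonzero; lia). lia. }
      assert (Pn : 0 < INR n) by now apply lt_0_INR.
      assert (Hn2 : 2 ^ j1 <= 2 * INR n).
      { replace (2 ^ j1) with (INR (2 ^ j1)) by (rewrite pow_INR; reflexivity).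
        replace (2 * INR n) with (INR (2 * n)) by (rewrite mult_INR; reflexivity).
        now apply le_INR. }
      set (i := (j1 - j)%nat).
      assert (E1 : 2 ^ j1 = 2 ^ j * 2 ^ i) by (unfold i; rewrite <- pow_add; f_equal; lia).
      assert (V : (rho j ^ 2) ^ n <= E * (delta / 2) ^ i).
      { unfold rho, r. replace (1 - kappa * (1 - (1 - / 2 ^ S j))) with (1 - kappa / 2 ^ S j)
          by (unfold Rdiv; ring).
        eapply Rle_trans; [apply (pow_one_minus_le _ n p); [|easy|easy]|].
        - assert (X := Hinv j). unfold Rdiv. nra.
        - replace (INR p / (2 * INR n * (kappa / 2 ^ S j))) with
            (2 * INR p / kappa * (2 ^ j / (2 * INR n))) by (simpl; field; repeat split; try lra;
              apply Rgt_not_eq, P2).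
          rewrite Rpow_mult_distr. fold E. apply Rmult_le_compat_l; [easy|].
          apply Rle_trans with (((/ 2) ^ i) ^ p).
          + apply pow_incr. split.
            * apply Rmult_le_pos; [left; apply P2|]. left. apply Rinv_0_lt_compat. lra.
            * apply Rmult_le_reg_r with (2 * INR n); [lra|].
              unfold Rdiv. rewrite Rmult_assoc, Rinv_l, Rmult_1_r by lra.
              rewrite pow_inv. assert (X := P2 i).
              apply Rmult_le_reg_l with (2 ^ i); [easy|].
              rewrite <- Rmult_assoc, Rinv_r by lra. lra.
          + rewrite <- pow_mult, Nat.mul_comm, pow_mult. apply pow_incr.
            split; [apply pow_le; lra|easy]. }
      assert (D := doubling_iter i (2 ^ j)).
      assert (Ej : (2 ^ i * 2 ^ j = 2 ^ j1)%nat)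
        by (unfold i; rewrite <- Nat.pow_add_r; f_equal; lia).
      rewrite Ej in D. assert (Dn := g_decr n (2 ^ j1) Hj1).
      apply Rle_trans with (g (2 ^ j) * (E * (delta / 2) ^ i));
        [apply Rmult_le_compat_l; [left; apply g_pos|easy]|].
      replace (2 ^ j / 2 ^ j1) with ((/ 2) ^ i).
      + unfold Rdiv. rewrite Rpow_mult_distr.
        replace (g (2 ^ j) * (E * (delta ^ i * (/ 2) ^ i))) with
          (E * (/ 2) ^ i * (delta ^ i * g (2 ^ j))) by ring.
        apply Rmult_le_compat_l; [|lra]. apply Rmult_le_pos; [easy|]. apply pow_le; lra.
      + rewrite E1, pow_inv. field. split; apply Rgt_not_eq, P2. }
  (* The first summand serves [m > 0]: [/ 4] from the powers, [delta] from replacing [g (2^j0)] by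
     [g m]. The second serves [m = 0], as the total weight is [g 1] and not [g 0]. *)
  set (A := 4 / delta + g O / g 1%nat).
  assert (P1 : 0 < g O / g 1%nat) by (apply Rdiv_lt_0_compat; apply g_pos).
  assert (P4 : 0 < 4 / delta) by (apply Rdiv_lt_0_compat; lra).
  assert (HA : 0 < A) by (unfold A; lra).
  assert (Hlower : forall J m, (m <= 2 ^ J)%nat ->
    g m <= A * dyadic_mean J (fun j => (r j ^ 2) ^ m)).
  { intros J m HmJ.
    assert (Hnn : forall j, 0 <= (r j ^ 2) ^ m).
    { intro j. apply pow_le, pow_le. left. apply Hr. }
    destruct m as [|m].
    - assert (X : 1 * g (2 ^ 0) <= dyadic_mean J (fun j => (r j ^ 2) ^ 0)).
      { apply dyadic_mean_ge; [lia|lra|easy|]. intros; simpl; lra. }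
      simpl (2 ^ 0)%nat in X. rewrite Rmult_1_l in X.
      apply Rle_trans with (g O / g 1%nat * g 1%nat).
      + right. field. apply Rgt_not_eq, g_pos.
      + assert (G1 := g_pos 1). apply Rmult_le_compat; unfold A; lra.
    - destruct (dyadic_index (S m)) as [j0 [Hj0 Hj0']].
      (* An index beyond [J] is replaced by [J] itself, which still satisfies [S m <= 2^J]. *)
      assert (Hj0J : exists j0, (S m <= 2 ^ j0)%nat /\ (2 ^ j0 <= 2 * S m)%nat /\ (j0 <= J)%nat).
      { destruct (Nat.le_gt_cases j0 J) as [H|H].
        - exists j0. repeat split; [easy| |easy]. destruct Hj0' as [->|]; [simpl; lia|easy].
        - exists J. repeat split; [easy| |lia].
          destruct Hj0' as [->|H']; [lia|].
          assert (2 ^ J <= 2 ^ j0)%nat by (apply Nat.pow_le_mono_r; lia). lia. }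
      clear j0 Hj0 Hj0'. destruct Hj0J as [j0 [Ha [Hb Hc]]].
      assert (X : / 4 * g (2 ^ j0) <= dyadic_mean J (fun j => (r j ^ 2) ^ S m)).
      { apply dyadic_mean_ge; [easy|lra|easy|]. intros j Hj. unfold r.
        apply pow_one_minus_ge_half.
        assert (2 ^ j0 <= 2 ^ j)%nat by (apply Nat.pow_le_mono_r; lia). lia. }
      assert (Y1 := g_decr _ _ Hb). assert (Y2 := g_doubling (S m)).
      assert (X' : delta / 4 * g (S m) <= dyadic_mean J (fun j => (r j ^ 2) ^ S m)) by lra.
      apply Rle_trans with (4 / delta * (delta / 4 * g (S m))); [right; field; lra|].
      assert (G := g_pos (S m)). apply Rmult_le_compat; unfold A; try lra.
      apply Rmult_le_pos; lra. }
  exists (A * (K * ((2 * E + 1) * Y))). intro M.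
  assert (HJ : exists J, (M <= 2 ^ J)%nat).
  { exists M. assert (X := Nat.pow_gt_lin_r 2 M ltac:(lia)). lia. }
  destruct HJ as [J HJ].
  apply Rle_trans with (A * sum_n (fun m => x m * dyadic_mean J (fun j => (r j ^ 2) ^ m)) M).
  - rewrite <- sum_n_scal. apply sum_n_le. intros m Hm.
    replace (A * (x m * dyadic_mean J (fun j => (r j ^ 2) ^ m))) with
      (x m * (A * dyadic_mean J (fun j => (r j ^ 2) ^ m))) by ring.
    apply Rmult_le_compat_l; [apply Hx|]. apply Hlower. lia.
  - apply Rmult_le_compat_l; [lra|].
    rewrite (dyadic_mean_sum J M x (fun m j => (r j ^ 2) ^ m)).
    set (s := fun j => Series (fun n => y n * (rho j ^ 2) ^ n)).
    assert (Hterm : forall j n, 0 <= y n * (rho j ^ 2) ^ n).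
    { intros j n. apply Rmult_le_pos; [easy|]. apply pow_le, pow_le. left. apply Hrho. }
    assert (Hex : forall j, ex_series (fun n => y n * (rho j ^ 2) ^ n)).
    { intro j. apply Hsum. assert (X := Hrho j). lra. }
    apply Rle_trans with (dyadic_mean J (fun j => K * s j)).
    + apply dyadic_mean_mono. intro j. apply Htrans; [apply Hr|]. intro N.
      apply (sum_n_le_Series (fun n => y n * (rho j ^ 2) ^ n)); [apply Hterm|apply Hex].
    + rewrite dyadic_mean_scal. apply Rmult_le_compat_l; [lra|].
      (* [Htrans] takes a bound for the whole series at each radius, whereas [Hupper] compares
         partial sums; the combination of radii is finite, so it commutes with the limit in [N]. *)
      assert (L := dyadic_mean_lim J (fun j N => sum_n (fun n => y n * (rho j ^ 2) ^ n) N) s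
        (fun j => Series_correct _ (Hex j))).
      apply (is_lim_seq_le _ (fun _ => (2 * E + 1) * Y) _ _) with (2 := L) (3 := is_lim_seq_const _).
      intro N. rewrite <- (dyadic_mean_sum J N y (fun n j => (rho j ^ 2) ^ n)).
      apply Rle_trans with ((2 * E + 1) * sum_n (fun n => y n * g n) N).
      * rewrite <- sum_n_scal. apply sum_n_le. intros n _.
        replace ((2 * E + 1) * (y n * g n)) with (y n * ((2 * E + 1) * g n)) by ring.
        apply Rmult_le_compat_l; [apply Hy|apply Hupper].
      * apply Rmult_le_compat_l; [lra|apply HY].
Qed.

End DyadicWeights.

Theorem Delta2_all_bounded (beta : nat -> R) (phi : C -> C) :
  weight_ok beta -> ess_decreasing beta -> Delta2 beta ->
  (forall z, inD z -> Cdiff phi z) -> (forall z, inD z -> inD (phi z)) ->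
  Cphi_bounded beta phi.
Proof.
  intros Hw [K [HK Hdec]] [delta [Hdel Hdoub]] Hphi Hmap f [a [Hf Ha]].
  assert (Hpos := proj1 Hw).
  assert (Hs := H2_summable_on_D beta a Hw Ha).
  assert (Hfd := Cdiff_pseries a f Hs Hf).
  exists (coef (fun z => f (phi z))). split.
  { apply (holomorphic_power_series (fun z => f (phi z))).
    intros z Hz. apply (Cdiff_comp f phi); auto. }
  destruct (composition_energy phi f a Hphi Hmap Hs Hf) as [K1 [kappa [HK1 [Hk Htr]]]].
  set (g := running_min beta).
  assert (Hg : forall n, beta n / K <= g n).
  { intro n. apply running_min_glb. intros k Hkn. assert (X := Hdec n k Hkn).
    apply Rmult_le_reg_r with K; [lra|]. unfold Rdiv. rewrite Rmult_assoc, Rinv_l by lra. lra. }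
  assert (Hgb : forall n, g n <= beta n) by apply running_min_le.
  assert (Hterm : forall n, 0 <= Cmod (a n) ^ 2 * beta n).
  { intro n. apply Rmult_le_pos; [apply pow2_ge_0|left; apply Hpos]. }
  (* Doubling survives in [g] with constant [delta / K]: [g (2 n) >= beta (2 n) / K >= delta * beta
     n / K] and [beta n >= g n]. *)
  destruct (dyadic_transfer g (delta / K)) with (K := K1) (kappa := kappa)
    (x := fun m => Cmod (coef (fun z => f (phi z)) m) ^ 2) (y := fun n => Cmod (a n) ^ 2)
    (Y := Series (fun n => Cmod (a n) ^ 2 * beta n)) as [B HB]; auto.
  - intro n. eapply Rlt_le_trans; [|apply Hg]. apply Rdiv_lt_0_compat; [apply Hpos|lra].
  - intros n m Hnm. induction Hnm as [|m Hm IH]; [lra|].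
    eapply Rle_trans; [|exact IH]. apply Rmin_l.
  - split; [apply Rdiv_lt_0_compat; lra|].
    apply Rmult_lt_reg_r with K; [lra|]. unfold Rdiv. rewrite Rmult_assoc, Rinv_l; lra.
  - intro n. apply Rle_trans with (beta (2 * n)%nat / K); [|apply Hg].
    apply Rle_trans with (delta / K * beta n).
    + apply Rmult_le_compat_l; [left; apply Rdiv_lt_0_compat; lra|apply Hgb].
    + unfold Rdiv. rewrite Rmult_assoc, (Rmult_comm (/ K)), <- Rmult_assoc.
      apply Rmult_le_compat_r; [left; apply Rinv_0_lt_compat; lra|].
      apply Rge_le, Hdoub.
  - intro m. apply pow2_ge_0.
  - intro n. apply pow2_ge_0.
  - intros rho Hrho. now apply summable_sq.
  - intro N. apply Rle_trans with (sum_n (fun n => Cmod (a n) ^ 2 * beta n) N).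
    + apply sum_n_le. intros n _. apply Rmult_le_compat_l; [apply pow2_ge_0|apply Hgb].
    + now apply sum_n_le_Series.
  - apply ex_series_bounded with (K * B).
    + intro n. apply Rmult_le_pos; [apply pow2_ge_0|left; apply Hpos].
    + intro M. apply Rle_trans with (K * sum_n
        (fun m => Cmod (coef (fun z => f (phi z)) m) ^ 2 * g m) M).
      * rewrite <- sum_n_scal. apply sum_n_le. intros m _.
        rewrite <- Rmult_assoc, (Rmult_comm K), Rmult_assoc.
        apply Rmult_le_compat_l; [apply pow2_ge_0|].
        assert (X := Hg m). apply Rmult_le_compat_r with (r := K) in X; [|lra].
        unfold Rdiv in X. rewrite Rmult_assoc, Rinv_l in X by lra. lra.
      * apply Rmult_le_compat_l; [lra|apply HB].
Qed.

(** * Boundedness implies the doubling condition *)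

(* The squared norm of evaluation at [r] on [H^2(beta)]. *)
Definition repro (beta : nat -> R) (r : R) : R := Series (fun n => (r ^ 2) ^ n / beta n).

Definition tau (a r : R) : R := (a + r) / (1 + a * r).

Lemma T_real (a r : R) : 0 < a < 1 -> 0 <= r -> T (RtoC a) (RtoC r) = RtoC (tau a r).
Proof.
  intros Ha Hr. unfold T, tau.
  replace (Cconj (RtoC a)) with (RtoC a) by (unfold Cconj, RtoC; simpl; f_equal; ring).
  rewrite <- RtoC_mult, <- !RtoC_plus, <- RtoC_div; [easy|]. nra.
Qed.

(** The first bound makes iterates of [tau] approach 1 geometrically; the second separates [r] from
    [tau a r], so that powers of [r / tau a r] decay. *)
Lemma tau_compl (a r : R) : 0 < a < 1 -> 0 <= r < 1 ->
  0 < 1 - tau a r <= (1 - a) * (1 - r) /\ a * (1 - r) <= tau a r - r.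
Proof.
  intros Ha Hr.
  assert (Hd : 0 < 1 + a * r) by nra.
  assert (E1 : 1 - tau a r = (1 - a) * (1 - r) / (1 + a * r)) by (unfold tau; field; lra).
  assert (E2 : tau a r - r = a * (1 - r) * ((1 + r) / (1 + a * r))) by (unfold tau; field; lra).
  assert (Hi : / (1 + a * r) <= 1) by (rewrite <- Rinv_1; apply Rinv_le_contravar; nra).
  assert (Hi0 : 0 < / (1 + a * r)) by now apply Rinv_0_lt_compat.
  assert (P : 0 < (1 - a) * (1 - r)) by nra.
  rewrite E1, E2. unfold Rdiv. split; [split|].
  - nra.
  - nra.
  - assert (1 <= (1 + r) * / (1 + a * r)).
    { apply Rmult_le_reg_r with (1 + a * r); [easy|]. rewrite Rmult_assoc, Rinv_l by lra. nra. }
    assert (0 < a * (1 - r)) by nra. nra.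
Qed.

Lemma tau_range (a r : R) : 0 < a < 1 -> 0 <= r < 1 -> 0 < tau a r < 1.
Proof. intros Ha Hr. assert (H := tau_compl a r Ha Hr). nra. Qed.

Section Evaluation.

Variable beta : nat -> R.
Hypothesis beta_ok : weight_ok beta.

Let beta_pos (n : nat) : 0 < beta n := proj1 beta_ok n.

Lemma repro_term_nonneg (r : R) (n : nat) : 0 <= (r ^ 2) ^ n / beta n.
Proof.
  apply Rmult_le_pos; [apply pow_le, pow2_ge_0|]. left. apply Rinv_0_lt_compat, beta_pos.
Qed.

Lemma repro_ge_0 (r : R) : 0 <= r < 1 -> / beta O <= repro beta r.
Proof.
  intro Hr. eapply Rle_trans; [|apply (sum_n_le_Series _ 0 (repro_term_nonneg r))].
  - rewrite sum_n_0. simpl. right. field. apply Rgt_not_eq, beta_pos.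
  - now apply weight_summable.
Qed.

Lemma repro_pos (r : R) : 0 <= r < 1 -> 0 < repro beta r.
Proof.
  intro Hr. eapply Rlt_le_trans; [|now apply repro_ge_0]. apply Rinv_0_lt_compat, beta_pos.
Qed.

(** This is [weighted_AMGM] with [lam = sqrt (repro beta r)]. The bound is not homogeneous in [b],
    but it is applied to one fixed function at varying [r], where only the factor
    [sqrt (repro beta r)] matters. *)
Lemma evaluation_bound (b : nat -> C) (r : R) (w : C) : 0 <= r < 1 ->
  ex_series (fun n => Cmod (b n) ^ 2 * beta n) ->
  is_cseries (fun n => b n * RtoC r ^ n)%C w ->
  2 * Cmod w <= sqrt (repro beta r) * (Series (fun n => Cmod (b n) ^ 2 * beta n) + 1).
Proof.
  intros Hr Hb Hw. set (S := Series (fun n => Cmod (b n) ^ 2 * beta n)).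
  assert (Hk := repro_pos r Hr). set (lam := sqrt (repro beta r)).
  assert (Hl : 0 < lam) by now apply sqrt_lt_R0.
  assert (Hll : lam * lam = repro beta r) by (apply sqrt_sqrt; lra).
  assert (X : Cmod (2 * w)%C <= lam * S + / lam * repro beta r).
  { apply (is_cseries_Cmod_le (fun n => 2 * (b n * RtoC r ^ n))%C
      (fun n => lam * (Cmod (b n) ^ 2 * beta n) + / lam * ((r ^ 2) ^ n / beta n))).
    - intro n. rewrite !Cmod_mult, Cmod_pow, !Cmod_R, (Rabs_pos_eq 2), (Rabs_pos_eq r) by lra.
      assert (Y := weighted_AMGM (Cmod (b n)) (r ^ n) (beta n) lam (beta_pos n) Hl).
      now rewrite pow_sq_comm in Y.
    - now apply is_cseries_scal.
    - apply (@is_series_plus R_AbsRing R_NormedModule);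
      apply (@is_series_scal R_AbsRing R_NormedModule); apply Series_correct; [easy|].
      now apply weight_summable. }
  rewrite Cmod_mult, Cmod_R, Rabs_pos_eq in X by lra.
  rewrite <- Hll in X. replace (/ lam * (lam * lam)) with lam in X by (field; lra). lra.
Qed.

Lemma Series_finite_sum (u : nat -> nat -> R) (M : nat) : (forall n, ex_series (u n)) ->
  ex_series (fun k => sum_n (fun n => u n k) M) /\
  sum_n (fun n => Series (u n)) M = Series (fun k => sum_n (fun n => u n k) M).
Proof.
  intro H. induction M as [|M [IH1 IH2]].
  - split.
    + apply ex_series_ext with (u O); [intro; now rewrite sum_n_0|apply H].
    + rewrite sum_n_0. apply Series_ext. intro; now rewrite sum_n_0.
  - split.
    + apply ex_series_ext with (fun k => plus (sum_n (fun n => u n k) M) (u (S M) k)).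
      * intro k. now rewrite sum_n_S.
      * apply (@ex_series_plus R_AbsRing R_NormedModule); [easy|apply H].
    + rewrite sum_n_S, IH2, <- Series_plus by auto. apply Series_ext. intro k. now rewrite sum_n_S.
Qed.

(* [a n] is the square root of the sum over [k] of the squared [n]-th coefficients of [2^-k] times
   the normalized kernel at [rho k]; unlike for the sum of the kernels, the norm is then immediate. *)
Lemma kernel_superposition (rho : nat -> R) : (forall k, 0 <= rho k < 1) ->
  exists a : nat -> R, (forall n, 0 <= a n) /\ ex_series (fun n => a n ^ 2 * beta n) /\
    forall k n, (/ 2) ^ k * (rho k ^ n / beta n) / sqrt (repro beta (rho k)) <= a n.
Proof.
  intro Hrho.
  set (N := fun k => repro beta (rho k)).
  assert (HN : forall k, 0 < N k) by (intro; apply repro_pos, Hrho).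
  (* The square of the left side of the last claim, whence [/ 4]. Summed over [n] with weight
     [beta n], column [k] is at most [(/ 4)^k]. *)
  set (u := fun n k => (/ 4) ^ k * ((rho k ^ 2) ^ n / beta n ^ 2 / N k)).
  assert (Hu0 : forall n k, 0 <= u n k).
  { intros n k. apply Rmult_le_pos; [apply pow_le; lra|].
    apply Rmult_le_pos; [apply Rmult_le_pos; [apply pow_le, pow2_ge_0|]|].
    - left. apply Rinv_0_lt_compat, pow_lt, beta_pos.
    - left. now apply Rinv_0_lt_compat. }
  assert (Hgeo : ex_series (fun k => (/ 4) ^ k)) by (apply ex_series_geom; rewrite Rabs_pos_eq; lra).
  assert (Hu : forall n, ex_series (u n)).
  { intro n. apply ex_series_nonneg_le with (fun k => beta O / beta n ^ 2 * (/ 4) ^ k).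
    - intro k. split; [apply Hu0|]. unfold u. rewrite Rmult_comm.
      apply Rmult_le_compat_r; [apply pow_le; lra|].
      assert (Hbn : 0 < / beta n ^ 2) by (apply Rinv_0_lt_compat, pow_lt, beta_pos).
      assert (H1 : (rho k ^ 2) ^ n <= 1).
      { rewrite <- (pow1 n). apply pow_incr. assert (X := Hrho k). split; [apply pow2_ge_0|nra]. }
      assert (H2 : / N k <= beta O).
      { rewrite <- (Rinv_inv (beta O)). apply Rinv_le_contravar; [apply Rinv_0_lt_compat, beta_pos|].
        apply repro_ge_0, Hrho. }
      assert (H3 : 0 <= (rho k ^ 2) ^ n) by apply pow_le, pow2_ge_0.
      assert (H4 : 0 < / N k) by now apply Rinv_0_lt_compat.
      unfold Rdiv. replace (beta O * / beta n ^ 2) with (1 * / beta n ^ 2 * beta O) by ring.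
      apply Rmult_le_compat; [|lra| |easy].
      + apply Rmult_le_pos; lra.
      + apply Rmult_le_compat_r; lra.
    - now apply (@ex_series_scal R_AbsRing R_NormedModule). }
  set (s := fun n => Series (u n)).
  assert (Hs0 : forall n, 0 <= s n) by (intro n; now apply Series_nonneg).
  exists (fun n => sqrt (s n)). split; [intro; apply sqrt_pos|]. split.
  - apply ex_series_bounded with (Series (fun k => (/ 4) ^ k)).
    + intro n. apply Rmult_le_pos; [apply pow2_ge_0|left; apply beta_pos].
    + intro M.
      assert (Hbu : forall n, ex_series (fun k => beta n * u n k))
        by (intro; now apply (@ex_series_scal R_AbsRing R_NormedModule)).
      destruct (Series_finite_sum (fun n k => beta n * u n k) M Hbu) as [HE1 HE2].
      apply Rle_trans with (sum_n (fun n => Series (fun k => beta n * u n k)) M).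
      * apply sum_n_le. intros n _. rewrite Series_scal_l. fold (s n).
        rewrite pow2_sqrt by easy. lra.
      * rewrite HE2. apply Series_le; [|easy]. intro k. split.
        -- apply sum_n_nonneg. intro n. apply Rmult_le_pos; [left; apply beta_pos|apply Hu0].
        -- apply Rle_trans with ((/ 4) ^ k * / N k * sum_n (fun n => (rho k ^ 2) ^ n / beta n) M).
           ++ rewrite <- sum_n_scal. apply sum_n_le. intros n _. right. unfold u. field.
              split; [apply Rgt_not_eq, beta_pos|apply Rgt_not_eq, HN].
           ++ assert (X : sum_n (fun n => (rho k ^ 2) ^ n / beta n) M <= N k).
              { apply sum_n_le_Series; [apply repro_term_nonneg|].
                apply weight_summable; [easy|apply Hrho]. }
              assert (P : 0 <= (/ 4) ^ k) by (apply pow_le; lra).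
              assert (HNk := HN k). assert (Hi : 0 < / N k) by now apply Rinv_0_lt_compat.
              rewrite Rmult_assoc. rewrite <- (Rmult_1_r ((/ 4) ^ k)) at 2.
              apply Rmult_le_compat_l; [easy|].
              rewrite <- (Rinv_l (N k)) by lra. apply Rmult_le_compat_l; lra.
  - intros k n. assert (HNk := HN k). assert (Hb := beta_pos n).
    assert (Hq : 0 < sqrt (N k)) by now apply sqrt_lt_R0.
    fold (N k).
    apply Rsqr_incr_0_var; [|apply sqrt_pos]. rewrite Rsqr_sqrt by easy.
    apply Rle_trans with (u n k).
    + right. unfold u, Rsqr. rewrite <- pow_sq_comm.
      replace (/ 4) with (/ 2 * / 2) by lra. rewrite Rpow_mult_distr.
      rewrite <- (sqrt_sqrt (N k)) at 3 by lra. field. lra.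
    + eapply Rle_trans; [apply (sum_n_term_le (u n) k k (Hu0 n) (Nat.le_refl k))|].
      now apply sum_n_le_Series.
Qed.

(* If the norms of evaluation at [tau r] and at [r] were not comparable, a positive superposition
   of reproducing kernels would leave the space; positivity replaces the closed graph theorem. *)
Theorem repro_tau_bound (a : R) : 0 < a < 1 -> Cphi_bounded beta (T (RtoC a)) ->
  exists K, forall r, 0 <= r < 1 -> repro beta (tau a r) <= K * repro beta r.
Proof.
  intros Ha HT. apply NNPP. intro Hno.
  (* Square roots turn [16^k] into [4^k], and the superposition loses [2^-k]; the remaining [2^k]
     contradicts the evaluation bound. *)
  assert (Hbad : forall k : nat, exists r, 0 <= r < 1 /\ 16 ^ k * repro beta r < repro beta (tau a r)).
  { intro k. apply NNPP. intro H. apply Hno. exists (16 ^ k). intros r Hr.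
    apply Rnot_lt_le. intro Hlt. apply H. now exists r. }
  set (r := fun k => proj1_sig (constructive_indefinite_description _ (Hbad k))).
  assert (Hr : forall k, 0 <= r k < 1 /\ 16 ^ k * repro beta (r k) < repro beta (tau a (r k))).
  { intro k. exact (proj2_sig (constructive_indefinite_description _ (Hbad k))). }
  set (rho := fun k => tau a (r k)).
  assert (Hrho : forall k, 0 <= rho k < 1).
  { intro k. destruct (Hr k) as [Hk _]. assert (X := tau_range a (r k) Ha Hk). unfold rho. lra. }
  destruct (kernel_superposition rho Hrho) as [c [Hc0 [Hc Hck]]].
  assert (HcC : ex_series (fun n => Cmod (RtoC (c n)) ^ 2 * beta n)).
  { revert Hc. apply ex_series_ext. intro n. now rewrite Cmod_R, Rabs_pos_eq. }
  assert (Hsum := H2_summable_on_D beta (fun n => RtoC (c n)) beta_ok HcC).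
  destruct (power_series_sum _ Hsum) as [f Hf].
  destruct (HT f) as [b [Hb Hbs]].
  { exists (fun n => RtoC (c n)). split; [exact Hf|exact HcC]. }
  set (S := Series (fun n => Cmod (b n) ^ 2 * beta n)).
  assert (Hall : forall j : nat, 2 ^ j <= S + 1).
  { intro j. destruct (Hr j) as [Hrj Hbig]. assert (Hrj' := Hrho j).
    assert (HD : inD (RtoC (r j))) by (unfold inD; rewrite Cmod_R, Rabs_pos_eq; lra).
    assert (HD' : inD (RtoC (rho j))) by (unfold inD; rewrite Cmod_R, Rabs_pos_eq; lra).
    assert (Ev := evaluation_bound b (r j) _ Hrj Hbs (Hb _ HD)). fold S in Ev.
    rewrite T_real in Ev by (easy || apply Hrj). fold (rho j) in Ev.
    set (N := repro beta (rho j)) in *. set (N0 := repro beta (r j)) in *.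
    assert (PN0 : 0 < N0) by now apply repro_pos. assert (PN : 0 < N) by now apply repro_pos.
    assert (Hex : ex_series (fun n => c n * rho j ^ n)).
    { assert (X := Hsum (rho j) Hrj'). revert X. apply ex_series_ext. intro n.
      now rewrite Cmod_R, Rabs_pos_eq. }
    assert (Efr : f (RtoC (rho j)) = RtoC (Series (fun n => c n * rho j ^ n))).
    { apply (is_cseries_unique (fun n => RtoC (c n) * RtoC (rho j) ^ n)%C); [now apply Hf|].
      apply is_cseries_ext with (fun n => RtoC (c n * rho j ^ n)).
      - intro n. now rewrite RtoC_mult, RtoC_pow.
      - now apply is_cseries_RtoC, Series_correct. }
    assert (Hq : 0 < sqrt N) by now apply sqrt_lt_R0.
    assert (Low : (/ 2) ^ j * sqrt N <= Series (fun n => c n * rho j ^ n)).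
    { apply Rle_trans with (Series (fun n => (/ 2) ^ j / sqrt N * ((rho j ^ 2) ^ n / beta n))).
      - rewrite Series_scal_l. fold (repro beta (rho j)). fold N.
        rewrite <- (sqrt_sqrt N) at 3 by lra. right. field. lra.
      - apply Series_le; [|easy]. intro n.
        assert (Hp : 0 <= (/ 2) ^ j / sqrt N).
        { apply Rmult_le_pos; [apply pow_le; lra|]. left; now apply Rinv_0_lt_compat. }
        split; [apply Rmult_le_pos; [easy|apply repro_term_nonneg]|].
        assert (X := Hck j n). fold N in X.
        assert (Hrn : 0 <= rho j ^ n) by (apply pow_le; lra).
        apply Rmult_le_compat_r with (r := rho j ^ n) in X; [|easy].
        eapply Rle_trans; [right|exact X]. rewrite <- pow_sq_comm. field.
        split; [apply Rgt_not_eq, beta_pos|lra]. }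
    rewrite Efr, Cmod_R in Ev. assert (X := Rle_abs (Series (fun n => c n * rho j ^ n))).
    assert (Hsq : 4 ^ j * sqrt N0 <= sqrt N).
    { apply Rsqr_incr_0_var; [|lra]. rewrite Rsqr_mult, !Rsqr_sqrt by lra.
      unfold Rsqr. rewrite <- Rpow_mult_distr. replace (4 * 4) with 16 by ring.
      change (16 ^ j * N0 < N) in Hbig. lra. }
    assert (Hq0 : 0 < sqrt N0) by now apply sqrt_lt_R0.
    assert (P2 : 0 < (/ 2) ^ j) by (apply pow_lt; lra).
    assert (E2 : (/ 2) ^ j * 4 ^ j = 2 ^ j) by (rewrite <- Rpow_mult_distr; f_equal; lra).
    assert (Y : 2 ^ j * sqrt N0 <= (/ 2) ^ j * sqrt N).
    { rewrite <- E2, Rmult_assoc. apply Rmult_le_compat_l; lra. }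
    assert (P2' : 0 < 2 ^ j) by (apply pow_lt; lra).
    apply Rmult_le_reg_r with (sqrt N0); [easy|].
    assert (0 < 2 ^ j * sqrt N0) by now apply Rmult_lt_0_compat. lra. }
  destruct (Pow_x_infinity 2) with (b := S + 2) as [j Hj]; [rewrite Rabs_pos_eq; lra|].
  specialize (Hj j (Nat.le_refl j)). rewrite Rabs_pos_eq in Hj by (apply pow_le; lra).
  specialize (Hall j). lra.
Qed.

(** * From doubling of the kernel to doubling of the weight *)

Lemma sum_n_add_ge (x : nat -> R) (c : R) (n k : nat) : (forall i, 0 <= x i) ->
  (forall i, (n < i <= n + k)%nat -> c <= x i) -> INR k * c <= sum_n x (n + k).
Proof.
  intros Hx Hc. induction k as [|k IH].
  - simpl. rewrite Rmult_0_l. now apply sum_n_nonneg.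
  - rewrite Nat.add_succ_r, sum_n_S, S_INR.
    assert (IH' := IH ltac:(intros; apply Hc; lia)). assert (X := Hc (S (n + k)) ltac:(lia)). lra.
Qed.

Lemma sum_n_add_le (x y : nat -> R) (c : R) (n k : nat) : 0 <= c -> (forall i, 0 <= y i) ->
  (forall i, (n < i)%nat -> x i <= c * y i) -> sum_n x (n + k) <= sum_n x n + c * sum_n y (n + k).
Proof.
  intros Hc Hy Hxy. induction k as [|k IH].
  - rewrite Nat.add_0_r. assert (X := Rmult_le_pos _ _ Hc (sum_n_nonneg y n Hy)). lra.
  - rewrite Nat.add_succ_r, !sum_n_S. assert (X := Hxy (S (n + k)) ltac:(lia)). lra.
Qed.

(* A Karamata-type argument: comparability of [repro] at [r] and [tau r] makes the terms of index
   at most [N] carry half of [repro beta r] when [1 - r = L / N]. *)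
Theorem Delta2_of_repro_bound (a K : R) : 0 < a < 1 -> ess_decreasing beta ->
  (forall r, 0 <= r < 1 -> repro beta (tau a r) <= K * repro beta r) -> Delta2 beta.
Proof.
  intros Ha [K0 [HK0 Hdec]] Hrep.
  set (C := Rmax 1 K). assert (HC1 : 1 <= C) by apply Rmax_l.
  assert (HC : forall r, 0 <= r < 1 -> repro beta (tau a r) <= C * repro beta r).
  { intros r Hr. eapply Rle_trans; [now apply Hrep|].
    apply Rmult_le_compat_r; [left; now apply repro_pos|apply Rmax_r]. }
  set (it := fun (i : nat) (r : R) => Nat.iter i (tau a) r).
  assert (Hit : forall i r, 0 <= r < 1 -> (0 <= it i r < 1) /\
     1 - it i r <= (1 - a) ^ i * (1 - r) /\ repro beta (it i r) <= C ^ i * repro beta r).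
  { intros i r Hr. induction i as [|i [IH1 [IH2 IH3]]].
    - simpl. lra.
    - change (it (S i) r) with (tau a (it i r)).
      assert (X := tau_compl a _ Ha IH1). assert (Y := tau_range a _ Ha IH1). split; [lra|split].
      + simpl pow. apply Rle_trans with ((1 - a) * (1 - it i r)); [apply X|].
        rewrite Rmult_assoc. apply Rmult_le_compat_l; lra.
      + eapply Rle_trans; [now apply HC|]. simpl pow. rewrite Rmult_assoc.
        apply Rmult_le_compat_l; lra. }
  (* With [1 - r = L / N] and [t = tau a r], [(r / t)^(2 N) <= exp (- 2 a L) = exp (- 2 C) <= 1 / (2
     C)]. The terms of index beyond [N] then contribute at most half of [repro beta r]. *)
  set (L := C / a).
  assert (HL : a * L = C) by (unfold L; field; lra).
  assert (HL1 : 1 <= L) by nra.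
  (* After [p] iterations of [tau] the point [s] has [1 - s <= 1 / (16 N)], so Bernoulli's
     inequality gives [s^(2 i) >= 1 / 2] for all [i <= 4 N]. *)
  destruct (pow_lt_1_zero (1 - a)) with (y := / (16 * L)) as [p Hp];
    [rewrite Rabs_pos_eq; lra|apply Rinv_0_lt_compat; lra|].
  specialize (Hp p (Nat.le_refl p)). rewrite Rabs_pos_eq in Hp by (apply pow_le; lra).
  assert (Cp : 0 < C ^ p) by (apply pow_lt; lra).
  (* Read off from [N / (K0 beta (2 N)) <= repro beta s <= C^p repro beta r <= C^p * 4 N K0 / beta
     N]. *)
  set (D := 4 * C ^ p * K0 ^ 2).
  assert (HD : 0 < D).
  { unfold D. apply Rmult_lt_0_compat; [lra|apply pow_lt; lra]. }
  assert (Hbig : forall N : nat, L <= INR N -> beta N <= D * beta (2 * N)%nat).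
  { intros N HN. assert (PN : 0 < INR N) by lra.
    assert (B1 := beta_pos N). assert (B2 := beta_pos (2 * N)).
    set (r := 1 - L / INR N).
    assert (HLN : 0 < L / INR N <= 1).
    { split; [apply Rdiv_lt_0_compat; lra|].
      apply Rmult_le_reg_r with (INR N); [easy|]. unfold Rdiv. rewrite Rmult_assoc, Rinv_l; lra. }
    assert (Hr : 0 <= r < 1) by (unfold r; lra).
    assert (Er : 1 - r = L / INR N) by (unfold r; ring).
    assert (Htr := tau_range a r Ha Hr). assert (Htc := tau_compl a r Ha Hr).
    set (t := tau a r) in *.
    assert (Hup : repro beta r <= 2 * sum_n (fun n => (r ^ 2) ^ n / beta n) N).
    { set (c := / (2 * C)). assert (Hc : 0 < c) by (apply Rinv_0_lt_compat; lra).
      assert (Hq : 0 <= r / t <= 1 - a * (1 - r)).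
      { split; [apply Rmult_le_pos; [lra|]; left; apply Rinv_0_lt_compat; lra|].
        apply Rmult_le_reg_r with t; [lra|]. unfold Rdiv. rewrite Rmult_assoc, Rinv_l by lra.
        assert (0 <= a * (1 - r)) by nra. nra. }
      assert (Hqe : ((r / t) ^ 2) ^ N <= c).
      { apply Rle_trans with (exp (- (2 * C))).
        - rewrite <- pow_mult. apply Rle_trans with (exp (- (a * (1 - r))) ^ (2 * N)).
          + apply pow_incr. split; [easy|].
            assert (X := exp_ineq1_le (- (a * (1 - r)))). lra.
          + right. rewrite <- Rpower_pow by apply exp_pos. unfold Rpower. rewrite ln_exp. f_equal.
            rewrite mult_INR, Er. change (INR 2) with 2.
            rewrite <- HL. field. lra.
        - rewrite exp_Ropp. unfold c. apply Rinv_le_contravar; [lra|].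
          assert (X := exp_ineq1_le (2 * C)). lra. }
      assert (Htail : forall i, (N < i)%nat -> (r ^ 2) ^ i / beta i <= c * ((t ^ 2) ^ i / beta i)).
      { intros i Hi. unfold Rdiv. rewrite <- Rmult_assoc. apply Rmult_le_compat_r.
        - left. apply Rinv_0_lt_compat, beta_pos.
        - replace (r ^ 2) with ((r / t) ^ 2 * t ^ 2) by (field; lra).
          rewrite Rpow_mult_distr. apply Rmult_le_compat_r; [apply pow_le, pow2_ge_0|].
          eapply Rle_trans; [|exact Hqe]. replace i with (N + (i - N))%nat by lia.
          rewrite pow_add. rewrite <- Rmult_1_r. apply Rmult_le_compat_l; [apply pow_le, pow2_ge_0|].
          rewrite <- (pow1 (i - N)). apply pow_incr. split; [apply pow2_ge_0|].
          assert (0 <= a * (1 - r)) by nra. nra. }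
      assert (Hbound : repro beta r <= sum_n (fun n => (r ^ 2) ^ n / beta n) N + c * repro beta t).
      { apply Series_le_bound; [now apply weight_summable|]. intro M.
        apply Rle_trans with (sum_n (fun n => (r ^ 2) ^ n / beta n) (N + M)).
        - apply sum_n_mono; [apply repro_term_nonneg|lia].
        - eapply Rle_trans; [apply (sum_n_add_le _ (fun n => (t ^ 2) ^ n / beta n) c)|]; auto; [lra| |].
          + intro; apply repro_term_nonneg.
          + apply Rplus_le_compat_l, Rmult_le_compat_l; [lra|].
            apply sum_n_le_Series; [apply repro_term_nonneg|]. apply weight_summable; [easy|lra]. }
      assert (HCr := HC r Hr). fold t in HCr.
      assert (c * repro beta t <= / 2 * repro beta r).
      { apply Rle_trans with (c * (C * repro beta r)); [apply Rmult_le_compat_l; lra|].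
        right. unfold c. field. lra. }
      lra. }
    assert (Hup2 : sum_n (fun n => (r ^ 2) ^ n / beta n) N <= 2 * INR N * (K0 / beta N)).
    { apply Rle_trans with (sum_n (fun _ => K0 / beta N) N).
      - apply sum_n_le. intros n Hn.
        assert (X := Hdec N n Hn). assert (Bn := beta_pos n).
        apply Rle_trans with (1 / beta n).
        + apply Rmult_le_compat_r; [left; now apply Rinv_0_lt_compat|].
          rewrite <- (pow1 n). apply pow_incr. split; [apply pow2_ge_0|nra].
        + apply Rmult_le_reg_r with (beta n * beta N); [nra|].
          replace (1 / beta n * (beta n * beta N)) with (beta N) by (field; lra).
          replace (K0 / beta N * (beta n * beta N)) with (K0 * beta n) by (field; lra). easy.
      (* There are [N + 1] terms, at most [2 N] since [N >= L >= 1]. *)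
      - rewrite (sum_n_const N (K0 / beta N)). rewrite S_INR.
        apply Rmult_le_compat_r; [left; apply Rdiv_lt_0_compat; lra|]. lra. }
    destruct (Hit p r Hr) as [Hs [Hs1 Hs2]]. set (s := it p r) in *.
    assert (Hs3 : INR N * (1 - s) <= / 16).
    { apply Rle_trans with (INR N * (/ (16 * L) * (L / INR N))).
      - apply Rmult_le_compat_l; [lra|]. eapply Rle_trans; [exact Hs1|].
        rewrite Er. apply Rmult_le_compat_r; lra.
      - right. field. lra. }
    (* The [2 N] indices in [(2 N, 4 N]] suffice: each term is at least half of
       [1 / (K0 beta (2 N))]. *)
    assert (Hlow : INR N * / (K0 * beta (2 * N)%nat) <= repro beta s).
    { apply Rle_trans with (sum_n (fun n => (s ^ 2) ^ n / beta n) (2 * N + 2 * N)).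
      - apply Rle_trans with (INR (2 * N) * (/ 2 * / (K0 * beta (2 * N)%nat))).
        + rewrite mult_INR. change (INR 2) with 2. right. field. split; lra.
        + apply sum_n_add_ge; [apply repro_term_nonneg|].
          intros i Hi. assert (X := Hdec i (2 * N)%nat ltac:(lia)).
          unfold Rdiv. apply Rmult_le_compat; [lra|left; apply Rinv_0_lt_compat; nra| |].
          * rewrite <- pow_mult. eapply Rle_trans; [|apply Bernoulli_compl; lra].
            assert (Hi8 : INR (2 * i) <= 8 * INR N).
            { replace (8 * INR N) with (INR (8 * N)) by (rewrite mult_INR; simpl; ring).
              apply le_INR. lia. }
            assert (INR (2 * i) * (1 - s) <= 8 * INR N * (1 - s)) by (apply Rmult_le_compat_r; lra).
            lra.
          * apply Rinv_le_contravar; [apply beta_pos|easy].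
      - apply sum_n_le_Series; [apply repro_term_nonneg|now apply weight_summable]. }
    assert (Hfin : INR N * / (K0 * beta (2 * N)%nat) <= C ^ p * (2 * (2 * INR N * (K0 / beta N)))).
    { eapply Rle_trans; [exact Hlow|]. eapply Rle_trans; [exact Hs2|].
      apply Rmult_le_compat_l; lra. }
    apply Rmult_le_reg_r with (INR N * / (K0 * beta (2 * N)%nat) * / beta N).
    - apply Rmult_lt_0_compat; [apply Rmult_lt_0_compat; [easy|]|]; apply Rinv_0_lt_compat; nra.
    - replace (beta N * (INR N * / (K0 * beta (2 * N)%nat) * / beta N)) with
        (INR N * / (K0 * beta (2 * N)%nat)) by (field; repeat split; lra).
      replace (D * beta (2 * N)%nat * (INR N * / (K0 * beta (2 * N)%nat) * / beta N)) with
        (C ^ p * (2 * (2 * INR N * (K0 / beta N)))) by (unfold D; field; repeat split; lra).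
      exact Hfin. }
  destruct (INR_archimed 1 L ltac:(lra)) as [N0 HN0]. rewrite Rmult_1_r in HN0.
  assert (Hsmall : forall m : nat, exists d, 0 < d /\
    forall n, (n < m)%nat -> d * beta n <= beta (2 * n)%nat).
  { induction m as [|m [d [Hd IH]]].
    - exists 1. split; [lra|]. intros; lia.
    - assert (Bm := beta_pos m). assert (B2m := beta_pos (2 * m)).
      set (e := beta (2 * m)%nat / beta m). assert (He : 0 < e) by now apply Rdiv_lt_0_compat.
      exists (Rmin d e). split; [now apply Rmin_pos|]. intros n Hn.
      assert (Bn := beta_pos n).
      destruct (Nat.eq_dec n m) as [->|Hnm].
      + apply Rle_trans with (e * beta m); [apply Rmult_le_compat_r; [lra|apply Rmin_r]|].
        right. unfold e. field. lra.
      + apply Rle_trans with (d * beta n); [apply Rmult_le_compat_r; [lra|apply Rmin_l]|].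
        apply IH. lia. }
  destruct (Hsmall N0) as [d [Hd Hdn]].
  set (delta := Rmin (/ 2) (Rmin d (/ D))).
  assert (HiD : 0 < / D) by now apply Rinv_0_lt_compat.
  assert (Hd1 : delta <= / 2) by apply Rmin_l.
  assert (Hd2 : delta <= Rmin d (/ D)) by apply Rmin_r.
  assert (Hd3 := Rle_trans _ _ _ Hd2 (Rmin_l _ _)).
  assert (Hd4 := Rle_trans _ _ _ Hd2 (Rmin_r _ _)).
  exists delta. split; [split; [repeat apply Rmin_pos; lra|lra]|].
  intro n. apply Rle_ge. assert (Bn := beta_pos n).
  destruct (Nat.lt_ge_cases n N0) as [H|H].
  - apply Rle_trans with (d * beta n); [apply Rmult_le_compat_r; lra|auto].
  - assert (X : L <= INR n) by (apply le_INR in H; lra).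
    apply Rle_trans with (/ D * beta n); [apply Rmult_le_compat_r; lra|].
    apply Rmult_le_reg_l with D; [easy|]. rewrite <- Rmult_assoc, Rinv_r by lra.
    rewrite Rmult_1_l. now apply Hbig.
Qed.

End Evaluation.

Lemma T_symbol (a : R) : 0 < a < 1 -> symbol (T (RtoC a)).
Proof.
  intro Ha.
  assert (Hconj : Cconj (RtoC a) = RtoC a) by (unfold Cconj, RtoC; simpl; f_equal; ring).
  assert (Hden : forall z, inD z -> (RtoC 1 + Cconj (RtoC a) * z)%C <> 0%C).
  { intros z Hz E. unfold inD in Hz. apply (f_equal Re) in E.
    rewrite Hconj, re_plus, re_scal_l in E. simpl in E.
    assert (X := re_le_Cmod z). apply Rabs_le_between in X. unfold Re in E, X. nra. }
  split; [|split].
  - intros z Hz. apply ex_derive_Cdiff. unfold T, Cdiv. apply Cdiff_mult.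
    + apply Cdiff_plus; [apply Cdiff_const|apply Cdiff_id].
    + apply Cdiff_inv; [now apply Hden|].
      apply Cdiff_plus; [apply Cdiff_const|]. apply Cdiff_mult; [apply Cdiff_const|apply Cdiff_id].
  - intros z Hz. assert (Hd := Hden z Hz). unfold inD, T in *.
    rewrite Cmod_div by easy. apply Cmod_gt_0 in Hd.
    apply Rmult_lt_reg_r with (Cmod (RtoC 1 + Cconj (RtoC a) * z)%C); [easy|].
    unfold Rdiv. rewrite Rmult_assoc, Rinv_l, Rmult_1_l, Rmult_1_r by lra.
    apply Rsqr_incrst_0; [|apply Cmod_ge_0|apply Cmod_ge_0].
    rewrite !Rsqr_pow2, !Cmod2_alt, Hconj.
    assert (Hz2 : Re z ^ 2 + Im z ^ 2 < 1).
    { rewrite <- Cmod2_alt. assert (X := Cmod_ge_0 z). nra. }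
    destruct z as [x y]. simpl in *.
    (* This product is [|1 + a z|^2 - |a + z|^2]. *)
    assert (0 < (1 - a * a) * (1 - (x * x + y * y))) by (apply Rmult_lt_0_compat; nra). lra.
  - exists (RtoC 0), (RtoC (/ 2)). split; [|split].
    + unfold inD. rewrite Cmod_0. lra.
    + unfold inD. rewrite Cmod_R, Rabs_pos_eq; lra.
    + rewrite !T_real by lra. intro E. apply RtoC_inj in E.
      assert (X := tau_compl a (/ 2) Ha ltac:(lra)). unfold tau in *.
      assert (Ea : (a + 0) / (1 + a * 0) = a) by (field; lra). rewrite Ea in E.
      assert (Y : a * (1 + a * / 2) = a + / 2).
      { rewrite E at 1. field. lra. }
      nra.
Qed.

Theorem theorem1p1 (beta : nat -> R) :
  weight_ok beta -> ess_decreasing beta ->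
  ((forall phi : C -> C, symbol phi -> Cphi_bounded beta phi) <->
   (forall a : R, 0 < a < 1 -> Cphi_bounded beta (T (RtoC a)))) /\
  ((forall a : R, 0 < a < 1 -> Cphi_bounded beta (T (RtoC a))) <->
   (exists a : R, 0 < a < 1 /\ Cphi_bounded beta (T (RtoC a)))) /\
  ((exists a : R, 0 < a < 1 /\ Cphi_bounded beta (T (RtoC a))) <->
   Delta2 beta).
Proof.
  intros Hw Hd.
  assert (H12 : (forall phi : C -> C, symbol phi -> Cphi_bounded beta phi) ->
    forall a : R, 0 < a < 1 -> Cphi_bounded beta (T (RtoC a))).
  { intros H a Ha. now apply H, T_symbol. }
  assert (H23 : (forall a : R, 0 < a < 1 -> Cphi_bounded beta (T (RtoC a))) ->
    exists a : R, 0 < a < 1 /\ Cphi_bounded beta (T (RtoC a))).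
  { intro H. exists (/ 2). split; [lra|apply H; lra]. }
  assert (H34 : (exists a : R, 0 < a < 1 /\ Cphi_bounded beta (T (RtoC a))) -> Delta2 beta).
  { intros [a [Ha HT]]. destruct (repro_tau_bound beta Hw a Ha HT) as [K HK].
    now apply (Delta2_of_repro_bound beta Hw a K). }
  assert (H41 : Delta2 beta -> forall phi : C -> C, symbol phi -> Cphi_bounded beta phi).
  { intros HD phi [Hphi [Hmap _]]. apply Delta2_all_bounded; auto.
    intros z Hz. now apply ex_derive_Cdiff, Hphi. }
  tauto.
Qed.
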